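(* Let $\beta>0$, and let $X^*_t$, $Z^+_t$, $Z^-_t$ be the processes defined in the context. (i) With probability 1, $$\limsup_{t\to-\infty}\frac{X^*_t-B_t}{\log|t|}=\limsup_{t\to\infty}\frac{X^*_t-B_t}{\log t}=\limsup_{t\to-\infty}\frac{B_t-X^*_t}{\log|t|}=\limsup_{t\to\infty}\frac{B_t-X^*_t}{\log t}$$ $$=\limsup_{t\to-\infty}\frac{Z^+_t-Z^-_t}{\log|t|}=\limsup_{t\to\infty}\frac{Z^+_t-Z^-_t}{\log t}=\frac{\sigma^2}{2\beta}.$$ (ii) $\mathbb{E}|B_t-X^*_t|=\frac12\cdot\sigma^2/\beta$ for every $t\in\mathbb{R}$. (iii) $\mathbb{E}(Z^+_t-B_t)=\mathbb{E}(B_t-Z^-_t)=\frac34\cdot\sigma^2/\beta$ for every $t\in\mathbb{R}$.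
   Context: $\{B_t,t\in\mathbb{R}\}$ is a two-sided Brownian motion with $B_0=0$: $\{B_t,t>0\}$ and $\{B_{-t},t>0\}$ are independent Brownian motions started from $0$ with $\mathbb{E}B_t^2=\mathbb{E}B_{-t}^2=\sigma^2t$, $\sigma^2>0$. Consider Lipschitz functions $X:\mathbb{R}\to\mathbb{R}$ satisfying $dX_t/dt=-\beta$ whenever $X_t<B_t$ and $dX_t/dt=\beta$ whenever $X_t>B_t$; for almost every $\omega$ there is exactly one of them with $X_t=B_t$ for arbitrarily large $t$, and $X^*_t$ denotes this solution. $Z^+_t$ is the smallest function that is Lipschitz with constant $\beta$ and satisfies $Z^+_t\ge B_t$ for all $t\in\mathbb{R}$; $Z^-_t$ is the largest function that is Lipschitz with constant $\beta$ and satisfies $Z^-_t\le B_t$ for all $t\in\mathbb{R}$ (these exist a.s.). *)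

(* Defs.v *)
From HB Require Import structures.
From mathcomp Require Import all_boot all_order all_algebra.
From mathcomp Require Import all_classical all_reals all_analysis.
Import Order.TTheory GRing.Theory Num.Theory.
Import numFieldNormedType.Exports.

Set Implicit Arguments.
Unset Strict Implicit.
Unset Printing Implicit Defensive.

Local Open Scope classical_set_scope.
Local Open Scope ring_scope.

Section brownian.
Context {d : measure_display} {T : measurableType d} {R : realType}.
Variable P : probability T R.
Implicit Type W : R -> {RV P >-> R}.

Definition sigma_process W (I : set R) : set (set T) :=
  <<s \bigcup_(t in I) preimage_set_system setT (W t) measurable >>.

Definition indep_set_systems (F G : set (set T)) : Prop :=
  forall A B, F A -> G B -> P (A `&` B) = (P A * P B)%E.

(* Only the values of [W] at nonnegative times matter.  The second argument of
   [normal_prob] is the standard deviation. *)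
Definition brownian_motion (sigma : R) W : Prop :=
  [/\ {ae P, forall w, W 0 w = 0},
      {ae P, forall w, {within `[0, +oo[, continuous (fun t : R => W t w)}},
      (forall s t : R, 0 <= s -> s < t -> forall A : set R, measurable A ->
         P [set w | A (W t w - W s w)] =
         normal_prob 0 (sigma * Num.sqrt (t - s)) A) &
      (forall s t : R, 0 <= s -> s < t ->
         indep_set_systems (sigma_process W `[0, s])
           (<<s preimage_set_system setT (W t \- W s) measurable >>))].

Definition two_sided_brownian_motion (sigma : R) W : Prop :=
  [/\ brownian_motion sigma W,
      brownian_motion sigma (fun t => W (- t)) &
      indep_set_systems (sigma_process W `]0, +oo[)
        (sigma_process (fun t => W (- t)) `]0, +oo[)].

End brownian.

Section paths.
Context {R : realType}.
Implicit Types (beta : R) (b x z : R -> R).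

Definition bifurcation_solution beta b x : Prop :=
  [/\ lipschitz x,
      (forall t : R, x t < b t -> is_derive t 1 x (- beta)) &
      (forall t : R, b t < x t -> is_derive t 1 x beta)].

Definition is_Xstar beta b x : Prop :=
  bifurcation_solution beta b x /\
  (forall M : R, exists2 t, M < t & x t = b t).

Definition lipschitz_majorant beta b z : Prop :=
  beta.-lipschitz z /\ (forall t, b t <= z t).

Definition lipschitz_minorant beta b z : Prop :=
  beta.-lipschitz z /\ (forall t, z t <= b t).

Definition is_Zplus beta b z : Prop :=
  lipschitz_majorant beta b z /\
  (forall y, lipschitz_majorant beta b y -> forall t, z t <= y t).

Definition is_Zminus beta b z : Prop :=
  lipschitz_minorant beta b z /\
  (forall y, lipschitz_minorant beta b y -> forall t, y t <= z t).

End paths.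

(* Main.v *)
Require Import Defs.
From HB Require Import structures.
From mathcomp Require Import all_boot all_order all_algebra.
From mathcomp Require Import all_classical all_reals all_analysis.
From mathcomp Require Import measurable_realfun measure.
From mathcomp Require Import zify ring lra.
Import Order.TTheory GRing.Theory Num.Theory.
Import numFieldNormedType.Exports.

(* Let lam = 2 beta / sigma^2. All tails come from one estimate: by the Lindley recursion and a dyadic
   limit, the maximum M over r >= 0 of B (u + r) - B u - beta r satisfies P(M > x) <= exp(- lam x).

   (iii) Z+ t - B t is the maximum of two independent copies of M, one for each direction of time.
   A second moment computation for the recursion (Kingman) gives E M = 1 / lam, so that the tail bound
   is an equality almost everywhere and E max(M, M') = 2 / lam - 1 / (2 lam).

   (i) Borel-Cantelli at integer times bounds Z+ - Z- = sup over s, u of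
   B s - B u - beta |s - t| - beta |u - t| by (1 + eps) ln t / lam. Conversely, if B rises by 2 y in
   time y / beta and then does not come back for a time of order y, a solution X with X u <= B u + y
   falls so far below B that the upper bound is violated; such rises have probability about
   exp(- lam y), and one of them occurs in one of the exp(y / kap) / y disjoint blocks available
   before time exp(y / kap) when kap < 1 / lam.

   (ii) A backward Euler scheme approximates D u = X u - B u in probability uniformly in u, because a
   flat stretch of B forces X and the scheme next to B. Hence D u is a limit of functions of the
   increments after u, with a law that does not depend on u: E (D u)^2 is constant and D u is
   uncorrelated with B u - B t for t < u. Since X is almost surely beta-Lipschitz and has slope beta
   or - beta off the contact set, expanding (D t)^2 - (D u)^2 to first order in u - t gives
   2 beta E |D u| = sigma^2. *)

Local Open Scope classical_set_scope.
Local Open Scope ring_scope.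

Set Implicit Arguments.
Unset Strict Implicit.
Unset Printing Implicit Defensive.

(** * Probabilities and expectations *)


(** Three obstacles shape the proof. The processes [X], [Zp], [Zm] are given only through almost
    sure path properties: nothing presents [X u] as a measurable function of the increments of [B]
    after [u], although stationarity and lack of correlation rest on exactly that. The Euler scheme,
    a function of finitely many increments, supplies it in the limit. Next, a solution may have any
    Lipschitz constant and any slope where it touches [B]; the slope bound [beta], needed for (ii)
    and for the lower bound in (i), has to be extracted from the scarcity of contacts. Finally, the
    law of a maximum is never computed through reflection or stopping times: a one-sided exponential
    bound and a matching mean determine the integrals that are needed. Suprema over continuous time
    enter as countable unions over dyadic times, and jumps and flat stretches are sought on
    deterministic grids, so that independence of past and future at fixed times is the only
    independence used. *)

Definition Pr {d} {T : measurableType d} {R : realType} (P : probability T R)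
  (A : set T) : R := fine (P A).

Definition Ex {d} {T : measurableType d} {R : realType} (P : probability T R)
  (f : T -> R) : R := (\int[P]_(w in setT) f w)%R.

Definition itg {d} {T : measurableType d} {R : realType} (P : probability T R)
  (f : T -> R) : Prop := P.-integrable setT (EFin \o f).

Section prob.
Context {d : measure_display} {T : measurableType d} {R : realType}.
Variable P : probability T R.
Implicit Types (A B : set T) (f g : T -> R).

Lemma PrE A : measurable A -> P A = (Pr P A)%:E.
Proof. by move=> mA; rewrite /Pr fineK// fin_num_measure. Qed.

Lemma Pr_ge0 A : 0 <= Pr P A.
Proof. by rewrite /Pr fine_ge0. Qed.

Lemma Pr_le1 A : measurable A -> Pr P A <= 1.
Proof. by move=> mA; rewrite -lee_fin -PrE// probability_le1. Qed.

Lemma le_Pr A B : measurable A -> measurable B -> A `<=` B -> Pr P A <= Pr P B.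
Proof.
by move=> mA mB AB; rewrite -lee_fin -!PrE//; apply: le_measure; rewrite ?inE.
Qed.

Lemma PrU A B : measurable A -> measurable B -> Pr P (A `|` B) <= Pr P A + Pr P B.
Proof.
move=> mA mB; rewrite -lee_fin EFinD -!PrE//; last exact: measurableU.
exact: measureU2.
Qed.

Lemma PrC A : measurable A -> Pr P (~` A) = 1 - Pr P A.
Proof.
move=> mA; apply: EFin_inj; rewrite -PrE; last exact: measurableC.
by rewrite probability_setC// PrE.
Qed.

Lemma PrUD A B : measurable A -> measurable B -> A `&` B = set0 ->
  Pr P (A `|` B) = Pr P A + Pr P B.
Proof.
move=> mA mB AB; apply: EFin_inj; rewrite EFinD -!PrE//; last exact: measurableU.
by rewrite measureU.
Qed.

Lemma itgP f : itg P f <-> measurable_fun setT f /\ (\int[P]_w `|f w|%:E < +oo)%E.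
Proof.
rewrite /itg; split.
  by move=> /integrableP[/measurable_EFinP mf /= fi].
by move=> [mf fi]; apply/integrableP; split => //; exact/measurable_EFinP.
Qed.

Lemma itg_mf f : itg P f -> measurable_fun setT f.
Proof. by move=> /itgP[]. Qed.

Lemma itg_le f g : measurable_fun setT f -> (forall w, `|f w| <= g w) -> itg P g ->
  itg P f.
Proof.
move=> mf fg ig; apply: le_integrable ig => //; first exact/measurable_EFinP.
by move=> w _ /=; rewrite lee_fin (le_trans (fg w))// ler_norm.
Qed.

Lemma itgD f g : itg P f -> itg P g -> itg P (fun w => f w + g w).
Proof. by move=> fi gi; have := integrableD measurableT fi gi. Qed.

Lemma itgB f g : itg P f -> itg P g -> itg P (fun w => f w - g w).
Proof. by move=> fi gi; have := integrableB measurableT fi gi. Qed.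

Lemma itgZ (k : R) f : itg P f -> itg P (fun w => k * f w).
Proof. by move=> fi; have := integrableZl measurableT k fi. Qed.

Lemma itgN f : itg P f -> itg P (fun w => - f w).
Proof. by move=> fi; have := integrableN fi. Qed.

Lemma itg_cst (k : R) : itg P (fun=> k).
Proof. exact: finite_measure_integrable_cst. Qed.

Lemma itg_norm f : itg P f -> itg P (fun w => `|f w|).
Proof.
move=> fi; apply: (itg_le (g := fun w => `|f w|)).
- by apply: measurableT_comp => //; exact: itg_mf.
- by move=> w; rewrite normr_id.
- by have := integrable_norm fi.
Qed.

Lemma ExD f g : itg P f -> itg P g -> Ex P (fun w => f w + g w) = Ex P f + Ex P g.
Proof. by move=> fi gi; rewrite /Ex RintegralD. Qed.

Lemma ExB f g : itg P f -> itg P g -> Ex P (fun w => f w - g w) = Ex P f - Ex P g.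
Proof. by move=> fi gi; rewrite /Ex RintegralB. Qed.

Lemma ExZ (k : R) f : itg P f -> Ex P (fun w => k * f w) = k * Ex P f.
Proof. by move=> fi; rewrite /Ex RintegralZl. Qed.

Lemma ExN f : itg P f -> Ex P (fun w => - f w) = - Ex P f.
Proof.
move=> fi; rewrite -mulN1r -ExZ//; congr Ex; apply/funext => w.
by rewrite mulN1r.
Qed.

Lemma Ex_cst (k : R) : Ex P (fun=> k) = k.
Proof. by rewrite /Ex /Rintegral integral_cst//= probability_setT mule1. Qed.

Lemma le_Ex f g : itg P f -> itg P g -> (forall w, f w <= g w) -> Ex P f <= Ex P g.
Proof. by move=> fi gi fg; apply: le_Rintegral. Qed.

Lemma Ex_ge0 f : (forall w, 0 <= f w) -> 0 <= Ex P f.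
Proof. by move=> f0; apply: Rintegral_ge0. Qed.

Lemma ExE f : itg P f -> (\int[P]_w (f w)%:E = (Ex P f)%:E)%E.
Proof.
by move=> fi; rewrite /Ex /Rintegral fineK//; apply: integrable_fin_num.
Qed.

Lemma itg_ind A : measurable A -> itg P (\1_A).
Proof. by move=> mA; apply: integrable_indic => //=; exact: measurableT. Qed.

Lemma Ex_ind A : measurable A -> Ex P (\1_A) = Pr P A.
Proof. by move=> mA; rewrite /Ex /Rintegral integral_indic// setIT. Qed.

Lemma ler_norm_Ex f : itg P f -> `|Ex P f| <= Ex P (fun w => `|f w|).
Proof. by move=> fi; apply: le_normr_Rintegral. Qed.

Lemma ge0_itg (f : T -> R) (k : R) : measurable_fun setT f -> (forall w, 0 <= f w) ->
  (\int[P]_w (f w)%:E = k%:E)%E -> itg P f /\ Ex P f = k.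
Proof.
move=> mf f0 fk; split; last by rewrite /Ex /Rintegral fk.
apply/itgP; split => //; under eq_integral => w _ do rewrite ger0_norm//.
by rewrite fk ltry.
Qed.

End prob.

(** * Gaussian variables *)


(** The Radon-Nikodym derivative of [normal_prob] and [normal_pdf] have the same integral over every
    measurable set, hence agree almost everywhere. *)
Lemma normal_density_integral {R : realType} (m s : R) (f : R -> \bar R) :
  measurable_fun setT f -> (forall x, (0 <= f x)%E) ->
  (\int[normal_prob m s]_x f x =
   \int[lebesgue_measure]_x (f x * (normal_pdf m s x)%:E))%E.
Proof.
move=> mf f0.
rewrite -(Radon_Nikodym_SigmaFinite.change_of_variables (normal_prob_dominates m s))//.
have mpdf : measurable_fun setT (fun x : R => (normal_pdf m s x)%:E).
  by apply/measurable_EFinP; exact: measurable_normal_pdf.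
have dom := normal_prob_dominates m s.
have fint := Radon_Nikodym_SigmaFinite.f_integrable dom.
have f0' := Radon_Nikodym_SigmaFinite.f_ge0 dom.
apply: ge0_ae_eq_integral => //.
- by apply: emeasurable_funM => //; exact: (measurable_int _ fint).
- exact: emeasurable_funM.
- by move=> x _; rewrite mule_ge0//; exact: f0'.
- by move=> x _; rewrite mule_ge0// lee_fin normal_pdf_ge0.
- apply: ae_eqe_mul2l; apply: integral_ae_eq => // E _ mE.
  by rewrite -Radon_Nikodym_SigmaFinite.f_integral.
Qed.

Definition gaussian {d} {T : measurableType d} {R : realType} (P : probability T R)
  (s : R) (V : T -> R) : Prop :=
  measurable_fun setT V /\
  forall A, measurable A -> P (V @^-1` A) = normal_prob 0 s A.

Section gaussian.
Context {d : measure_display} {T : measurableType d} {R : realType}.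
Variables (P : probability T R).

Lemma integral_law (V : T -> R) (mu : probability (measurableTypeR R) R) (f : R -> \bar R) :
  measurable_fun setT V ->
  (forall A, measurable A -> P (V @^-1` A) = mu A) ->
  measurable_fun setT f -> (forall x, (0 <= f x)%E) ->
  (\int[P]_w f (V w) = \int[mu]_x f x)%E.
Proof.
move=> mV VE mf f0.
have := @ge0_integral_pushforward _ _ T (measurableTypeR R) R V mV P setT f measurableT mf
  (fun x _ => f0 x).
rewrite preimage_setT => <-; apply: eq_measure_integral => A mA _.
exact: VE.
Qed.

Variables (s : R) (s0 : 0 < s).
Variable V : T -> R.
Hypothesis gV : gaussian P s V.

Let mV : measurable_fun setT V := gV.1.
Let sN0 : s != 0. Proof. by rewrite gt_eqF. Qed.

Lemma gaussian_integral (f : R -> \bar R) :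
  measurable_fun setT f -> (forall x, (0 <= f x)%E) ->
  (\int[P]_w f (V w) =
   \int[lebesgue_measure]_x (f x * (normal_pdf 0 s x)%:E))%E.
Proof.
move=> mf f0; rewrite -normal_density_integral//.
exact: (@integral_law V (normal_prob 0 s) f mV gV.2 mf f0).
Qed.

Lemma gaussian_mgf (a : R) :
  (\int[P]_w (expR (a * V w))%:E = (expR (a ^+ 2 * s ^+ 2 / 2))%:E)%E.
Proof.
have mexp : measurable_fun setT (fun x : R => (expR (a * x))%:E).
  apply/measurable_EFinP; apply: measurableT_comp => //.
rewrite (gaussian_integral (f := fun x => (expR (a * x))%:E))//.
(* Completing the square turns the product into a constant times the density centred at
   [a * s ^+ 2]. *)
transitivity (\int[lebesgue_measure]_x
    ((expR (a ^+ 2 * s ^+ 2 / 2))%:E * (normal_pdf (a * s ^+ 2) s x)%:E))%E.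
  apply: eq_integral => x _; rewrite -!EFinM; congr EFin.
  rewrite !normal_pdfE// /normal_fun mulrCA [RHS]mulrCA -!expRD.
  by congr (_ * expR _); field.
rewrite ge0_integralZl//.
- by rewrite integral_normal_pdf mule1.
- by apply/measurable_EFinP; exact: measurable_normal_pdf.
- by move=> x _; rewrite lee_fin normal_pdf_ge0.
Qed.

Lemma mexpV (a : R) : measurable_fun setT (fun w => expR (a * V w)).
Proof. by apply: measurableT_comp => //; exact: measurable_funM. Qed.

Lemma itg_exp (a : R) : itg P (fun w => expR (a * V w)).
Proof.
by have [] := ge0_itg (mexpV a) (fun w => expR_ge0 (a * V w)) (gaussian_mgf a).
Qed.

Lemma Ex_exp (a : R) :
  Ex P (fun w => expR (a * V w)) = expR (a ^+ 2 * s ^+ 2 / 2).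
Proof.
by have [] := ge0_itg (mexpV a) (fun w => expR_ge0 (a * V w)) (gaussian_mgf a).
Qed.

Lemma expR_abs_le (a x : R) : expR (a * `|x|) <= expR (a * x) + expR (- a * x).
Proof.
have := expR_ge0 (a * x); have := expR_ge0 (- a * x).
by case: (ger0P x) => _; rewrite ?mulrN ?mulNr; lra.
Qed.

Lemma itg_expabs (a : R) : itg P (fun w => expR (a * `|V w|)).
Proof.
apply: (itg_le (g := fun w => expR (a * V w) + expR (- a * V w))).
- by apply: measurableT_comp => //; apply: measurable_funM => //; exact: measurableT_comp.
- by move=> w; rewrite ger0_norm ?expR_ge0// expR_abs_le.
- by apply: itgD; exact: itg_exp.
Qed.

Lemma itg_poly (n : nat) : itg P (fun w => `|V w| ^+ n).
Proof.
apply: (itg_le (g := fun w => n`!%:R * expR (1 * `|V w|))).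
- by apply: measurable_funX; exact: measurableT_comp.
- move=> w; rewrite normrX normr_id mul1r.
  case: n => [|n]; first by rewrite expr0 mul1r -expR0 ler_expR.
  have := expR_ge1Dxn n (normr_ge0 (V w)).
  have := normr_ge0 (V w) => V0.
  rewrite -ler_pdivrMl ?ltr0n ?fact_gt0// mulrC; lra.
- by apply: itgZ; exact: itg_expabs.
Qed.

Lemma itg_V : itg P V.
Proof. by apply: itg_le (itg_poly 1) => // w; rewrite expr1. Qed.

Lemma itg_V2 : itg P (fun w => V w ^+ 2).
Proof.
by apply: itg_le (itg_poly 2) => [|w]; [exact: measurable_funX|rewrite normrX].
Qed.

Lemma Pr_gaussian (A : set R) : measurable A ->
  Pr P (V @^-1` A) = fine (normal_prob 0 s A).
Proof. by move=> mA; rewrite /Pr gV.2. Qed.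

(** The variance is extracted from the exponential moments: [expR (h * V) + expR (- h * V) - 2] has
    a known mean, equal to [h ^+ 2 * s ^+ 2] up to order [h ^+ 3], and differs from
    [h ^+ 2 * V ^+ 2] by a cubic error of finite mean. Dividing by [h ^+ 2] and shrinking [h]
    identifies the two. *)
Lemma Ex_V2 : Ex P (fun w => V w ^+ 2) = s ^+ 2.
Proof.
set m := Ex P _.
(* The first term is the constant of the cubic remainder [D1], the second that of [D2]. *)
pose K := 12 * expR (2 * s ^+ 2) + s ^+ 4 * expR (s ^+ 2).
have K0 : 0 < K.
  have := expR_gt0 (2 * s ^+ 2).
  have : 0 <= s ^+ 4 * expR (s ^+ 2) by rewrite mulr_ge0 ?expR_ge0 ?exprn_even_ge0.
  rewrite /K; lra.
suff H (h : R) : 0 < h -> h <= 1 -> `|m - s ^+ 2| <= h * K.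
  apply/eqP; rewrite -subr_eq0 -normr_eq0; apply/eqP/le_anti.
  rewrite normr_ge0 andbT leNgt; apply/negP => m0.
  have h0 : 0 < Num.min 1 (`|m - s ^+ 2| / (2 * K)).
    by rewrite lt_min ltr01 divr_gt0// mulr_gt0.
  have := H _ h0; rewrite ge_min lexx/= => /(_ isT).
  apply/negP; rewrite -ltNge.
  apply: (@le_lt_trans _ _ (`|m - s ^+ 2| / (2 * K) * K)).
    by apply: ler_wpM2r; [exact: ltW|rewrite ge_min lexx orbT].
  rewrite (_ : _ / _ * K = `|m - s ^+ 2| / 2); first lra.
  by field; rewrite gt_eqF.
move=> h0 h1.
have e1 (x : R) : 0 <= x -> x <= expR x - 1 <= x * expR x.
  move=> x0; have := expR_ge1Dx x; have := expR_ge1Dx (- x).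
  have := expRxMexpNx_1 x; have := expR_gt0 x => ex0 eq1 l1 l2.
  apply/andP; split; first lra.
  have : expR x * (1 + - x) <= 1 by rewrite -eq1 ler_pM2l// ; lra.
  lra.
(* With [x = h * |z|], the difference is [(expR x - 1) ^+ 2 * expR (- x) - x ^+ 2], which [e1]
   places within [x ^+ 3 * expR x] of 0; then [|z| ^+ 3 <= 6 * expR |z|] and [h <= 1] absorb the
   cube into exponentials. *)
have bnd (z : R) : `|expR (h * z) + expR (- h * z) - 2 - h ^+ 2 * z ^+ 2|
    <= 6 * h ^+ 3 * (expR (2 * z) + expR (- 2 * z)).
  have x0 : 0 <= h * `|z| by rewrite mulr_ge0// ltW.
  have -> : expR (h * z) + expR (- h * z) = expR (h * `|z|) + expR (- (h * `|z|)).
    by case: (ger0P z) => _; rewrite ?mulNr ?mulrN ?opprK// addrC.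
  have -> : h ^+ 2 * z ^+ 2 = (h * `|z|) ^+ 2.
    by rewrite exprMn real_normK// num_real.
  apply: (@le_trans _ _ ((h * `|z|) ^+ 3 * expR (h * `|z|))).
    move: (h * `|z|) x0 => x x0; have /andP[l1 l2] := e1 _ x0.
    have eq1 := expRxMexpNx_1 x.
    have eqn : expR x + expR (- x) - 2 = (expR x - 1) ^+ 2 * expR (- x).
      rewrite sqrrB1 mulrDl mulrBl expr2 -mulrA eq1 mulr1 mulrnAl eq1 mul1r; lra.
    have ln := expR_ge1Dx (- x).
    have ex0 := expR_gt0 x; have enx0 := expR_gt0 (- x).
    have up : (expR x - 1) ^+ 2 * expR (- x) <= x ^+ 2 * expR x.
      have : (expR x - 1) ^+ 2 <= (x * expR x) ^+ 2.
        by rewrite ler_pXn2r// nnegrE; lra.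
      rewrite -(ler_pM2r enx0) exprMn (expr2 (expR x)) -!mulrA eq1 mulr1//.
    have lo : x ^+ 2 * (1 - x) <= (expR x - 1) ^+ 2 * expR (- x).
      have : x ^+ 2 <= (expR x - 1) ^+ 2 by rewrite ler_pXn2r// nnegrE; lra.
      rewrite -(ler_pM2r enx0); apply: le_trans.
      by rewrite ler_wpM2l// sqr_ge0.
    have up2 : x ^+ 2 * expR x <= x ^+ 2 * (1 + x * expR x).
      by rewrite ler_wpM2l ?sqr_ge0//; lra.
    have x3 : 0 <= x ^+ 3 by rewrite exprn_ge0.
    have x3e : x ^+ 3 <= x ^+ 3 * expR x.
      rewrite ler_peMr//; lra.
    rewrite eqn; rewrite ler_norml; apply/andP; split.
      by move: lo x3e; rewrite mulrBr mulr1 -exprSr; lra.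
    by move: up up2; rewrite mulrDr mulr1 mulrA -exprSr; lra.
  have hz : expR (h * `|z|) <= expR (1 * `|z|) by rewrite ler_expR ler_wpM2r.
  have z3 : `|z| ^+ 3 <= 6 * expR (1 * `|z|).
    rewrite mul1r; have := expR_ge1Dxn 2 (normr_ge0 z).
    rewrite (_ : 3`! = 6)%N//; lra.
  rewrite exprMn -[leLHS]mulrA.
  rewrite (_ : 6 * _ * _ = h ^+ 3 * (6 * (expR (2 * z) + expR (- 2 * z)))); last ring.
  rewrite ler_wpM2l ?exprn_ge0 ?(ltW h0)//.
  apply: (@le_trans _ _ (6 * expR (1 * `|z|) * expR (1 * `|z|))).
    by rewrite ler_pM ?exprn_ge0 ?expR_ge0.
  rewrite -mulrA -expRD -mulrDl ler_wpM2l//.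
  rewrite (_ : 1 + 1 = 2)//; exact: expR_abs_le.
have int1 : itg P (fun w => expR (h * V w) + expR (- h * V w) - 2).
  by apply: itgB; [apply: itgD; exact: itg_exp|exact: itg_cst].
have int2 : itg P (fun w => h ^+ 2 * V w ^+ 2) by apply: itgZ; exact: itg_V2.
have E1 : Ex P (fun w => expR (h * V w) + expR (- h * V w) - 2)
    = 2 * (expR (h ^+ 2 * s ^+ 2 / 2) - 1).
  rewrite ExB ?ExD; try (by apply: itg_exp) || (by apply: itg_cst).
    by rewrite !Ex_exp Ex_cst sqrrN; ring.
  by apply: itgD; exact: itg_exp.
have D1 : `|2 * (expR (h ^+ 2 * s ^+ 2 / 2) - 1) - h ^+ 2 * m| <=
    6 * h ^+ 3 * (2 * expR (2 * s ^+ 2)).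
  rewrite -E1 /m -ExZ; last exact: itg_V2.
  rewrite -ExB//; apply: le_trans (ler_norm_Ex _) _; first exact: itgB.
  have -> : 6 * h ^+ 3 * (2 * expR (2 * s ^+ 2)) =
      Ex P (fun w => 6 * h ^+ 3 * (expR (2 * V w) + expR (- 2 * V w))).
    rewrite ExZ ?ExD; try exact: itg_exp.
      by rewrite !Ex_exp sqrrN (_ : 2 ^+ 2 * s ^+ 2 / 2 = 2 * s ^+ 2); [ring|field].
    by apply: itgD; exact: itg_exp.
  apply: le_Ex.
  - by apply: itg_norm; exact: itgB.
  - by apply: itgZ; apply: itgD; exact: itg_exp.
  - by move=> w; exact: bnd.
have h20 : 0 < h ^+ 2 by rewrite exprn_gt0.
have h21 : h ^+ 2 <= 1 by rewrite exprn_ile1// ltW.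
have y0 : 0 <= h ^+ 2 * s ^+ 2 / 2 by rewrite divr_ge0// mulr_ge0// sqr_ge0.
have /andP[l1 l2] := e1 _ y0.
have ey : expR (h ^+ 2 * s ^+ 2 / 2) <= expR (s ^+ 2).
  rewrite ler_expR; have := sqr_ge0 s; nra.
have D2 : 2 * (expR (h ^+ 2 * s ^+ 2 / 2) - 1) - h ^+ 2 * s ^+ 2 <=
   h ^+ 3 * (s ^+ 4 * expR (s ^+ 2)).
  set y := h ^+ 2 * s ^+ 2 / 2 in y0 l1 l2 ey *.
  have l3 : expR y - 1 <= y * expR (s ^+ 2) by apply: le_trans l2 _; rewrite ler_wpM2l.
  have l4 : y * (expR y - 1) <= y * (y * expR (s ^+ 2)) by rewrite ler_wpM2l.
  have -> : h ^+ 2 * s ^+ 2 = 2 * y by rewrite /y; field.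
  have l5 : 2 * (expR y - 1) - 2 * y <= 2 * (y * (expR y - 1)) by lra.
  apply: le_trans l5 _; apply: le_trans (_ : 2 * (y * (y * expR (s ^+ 2))) <= _); first lra.
  have -> : 2 * (y * (y * expR (s ^+ 2))) = h ^+ 3 * (h / 2 * (s ^+ 4 * expR (s ^+ 2))).
    by rewrite /y; field.
  rewrite ler_wpM2l ?exprn_ge0 ?(ltW h0)//.
  have : 0 <= s ^+ 4 * expR (s ^+ 2) by rewrite mulr_ge0 ?expR_ge0 ?exprn_even_ge0.
  nra.
have : h ^+ 2 * `|m - s ^+ 2| <= h ^+ 3 * K.
  rewrite -[X in X * _]ger0_norm ?(ltW h20)// -normrM /K.
  move: D1; rewrite ler_norml => /andP[d1 d2]; rewrite ler_norml.
  set E1' := expR (h ^+ 2 * s ^+ 2 / 2) in D2 d1 d2 l1 l2 *.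
  have s4 : 0 <= h ^+ 3 * (s ^+ 4 * expR (s ^+ 2)).
    by rewrite mulr_ge0 ?exprn_ge0 ?(ltW h0)// mulr_ge0 ?expR_ge0 ?exprn_even_ge0.
  by apply/andP; split; lra.
by rewrite (_ : h ^+ 3 * K = h ^+ 2 * (h * K)) ?ler_pM2l//; ring.
Qed.

(** [x ^+ 4 / 24 <= expR x] at [x = |V| / s], together with [expR (1 / 2) <= 2], gives the factor 24
    * 2 * 2. *)
Lemma Ex_V4 : Ex P (fun w => V w ^+ 4) <= 96 * s ^+ 4.
Proof.
have i4 : itg P (fun w => V w ^+ 4).
  by apply: itg_le (itg_poly 4) => [|w]; [exact: measurable_funX|rewrite normrX].
have sV : 0 <= s^-1 by rewrite invr_ge0 ltW.
have e12 : expR (1 / 2) <= 2 :> R.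
  have := expR_ge1Dx (- (1 / 2) : R); have := expRxMexpNx_1 (1 / 2 : R).
  have := expR_gt0 (1 / 2 : R); nra.
apply: (@le_trans _ _ (Ex P (fun w => 24 * s ^+ 4 *
    (expR (s^-1 * V w) + expR (- s^-1 * V w))))); last first.
  rewrite ExZ ?ExD; try exact: itg_exp; last by apply: itgD; exact: itg_exp.
  rewrite !Ex_exp sqrrN (_ : s^-1 ^+ 2 * s ^+ 2 / 2 = 1 / 2); last by field.
  have : 0 <= s ^+ 4 by rewrite exprn_even_ge0.
  nra.
apply: le_Ex => //; first by apply: itgZ; apply: itgD; exact: itg_exp.
move=> w; have := expR_ge1Dxn 3 (mulr_ge0 sV (normr_ge0 (V w))).
rewrite (_ : 4`! = 24)%N// => h.
have := expR_abs_le s^-1 (V w) => h2.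
have -> : V w ^+ 4 = s ^+ 4 * (s^-1 * `|V w|) ^+ 4.
  rewrite exprMn mulrA -exprMn divff// expr1n mul1r.
  by rewrite -normrX ger0_norm// exprn_even_ge0.
have s40 : 0 <= s ^+ 4 by rewrite exprn_even_ge0.
rewrite (_ : 24 * _ * _ = s ^+ 4 * (24 * (expR (s^-1 * V w) + expR (- s^-1 * V w)))); last ring.
rewrite ler_wpM2l//; lra.
Qed.

(** [2 <= pi <= 4] places [2 * pi * s ^+ 2] between [(2 * s) ^+ 2] and [(3 * s) ^+ 2]. *)
Lemma normal_peak_bounds : 1 / (3 * s) <= normal_peak s <= 1 / (2 * s).
Proof.
have p2 := @pi_ge2 R; have p4 : pi <= 4 :> R by have := @pihalf_lt2 R; lra.
have s20 : 0 <= s ^+ 2 * pi *+ 2 by rewrite mulrn_wge0// mulr_ge0 ?sqr_ge0// pi_ge0.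
have s22 : 0 < s ^+ 2 by rewrite exprn_gt0.
have l : 2 * s <= Num.sqrt (s ^+ 2 * pi *+ 2).
  rewrite -(@ler_pXn2r _ 2)// ?nnegrE ?sqrtr_ge0 ?mulr_ge0 ?(ltW s0)//.
  by rewrite sqr_sqrtr// exprMn -mulr_natr; nra.
have u : Num.sqrt (s ^+ 2 * pi *+ 2) <= 3 * s.
  rewrite -(@ler_pXn2r _ 2)// ?nnegrE ?sqrtr_ge0 ?mulr_ge0 ?(ltW s0)//.
  by rewrite sqr_sqrtr// exprMn -mulr_natr; nra.
have s2 : 0 < 2 * s by rewrite mulr_gt0.
rewrite /normal_peak !div1r; apply/andP; split.
  by rewrite lef_pV2 ?posrE ?mulr_gt0//; lra.
by rewrite lef_pV2 ?posrE//; lra.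
Qed.

(** On the unit interval from [z] the density is at least its value at the right end. *)
Lemma gaussian_tail_ge (z : R) : 0 <= z ->
  1 / (3 * s) * expR (- (z + 1) ^+ 2 / (2 * s ^+ 2)) <= Pr P [set w | z <= V w].
Proof.
move=> z0; have /andP[pk _] := normal_peak_bounds.
have mm : measurable [set x : R | z <= x].
  rewrite (_ : [set x : R | _] = `[z, +oo[%classic); first exact: measurable_itv.
  by apply/seteqP; split => x /=; rewrite in_itv/= andbT.
rewrite -lee_fin -PrE; last by have := mV measurableT mm; rewrite setTI.
rewrite (gV.2 _ mm) /normal_prob.
apply: (@le_trans _ _ (\int[lebesgue_measure]_(x in `[z, (z + 1)%R])
   (1 / (3 * s) * expR (- (z + 1) ^+ 2 / (2 * s ^+ 2)))%:E)%E).
  rewrite integral_cst//= lebesgue_measure_itv/= lte_fin ltrDl ltr01.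
  by rewrite -EFinD -EFinM lee_fin (_ : z + 1 - z = 1) ?mulr1//; ring.
apply: (@le_trans _ _ (\int[lebesgue_measure]_(x in `[z, (z + 1)%R]) (normal_pdf 0 s x)%:E)%E).
  apply: ge0_le_integral => //=.
  - by move=> x _; rewrite lee_fin mulr_ge0// ?expR_ge0// divr_ge0// mulr_ge0// ltW.
  - by apply/measurable_EFinP; apply: measurable_funTS; exact: measurable_normal_pdf.
  - move=> x; rewrite in_itv/= => /andP[zx xz].
    rewrite lee_fin normal_pdfE// /normal_fun subr0 ler_pM//.
    + by rewrite divr_ge0// mulr_ge0// ltW.
    + rewrite -(mulr_natl (s ^+ 2)) ler_expR ler_wpM2r ?invr_ge0 ?mulr_ge0 ?sqr_ge0 ?(ltW s0)//.
      by rewrite lerN2 ler_pXn2r// nnegrE ?(le_trans z0 zx)//; lra.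
apply: ge0_subset_integral => //.
- by apply/measurable_EFinP; apply: measurable_funTS; exact: measurable_normal_pdf.
- by move=> x _; rewrite lee_fin normal_pdf_ge0.
- by move=> x /=; rewrite in_itv/= => /andP[].
Qed.

Lemma gaussian_small (z : R) : 0 <= z -> Pr P [set w | `|V w| <= z] <= z / s.
Proof.
move=> z0; have /andP[_ pk] := normal_peak_bounds.
have -> : [set w | `|V w| <= z] = V @^-1` `[- z, z].
  by apply/seteqP; split => w /=; rewrite in_itv/= ler_norml.
have mm : measurable (`[- z, z]%classic : set R) by exact: measurable_itv.
rewrite -lee_fin -PrE; last by have := mV measurableT mm; rewrite setTI.
rewrite (gV.2 _ mm) /normal_prob.
apply: (@le_trans _ _ (\int[lebesgue_measure]_(x in `[(- z)%R, z]) (1 / (2 * s))%:E)%E).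
  apply: ge0_le_integral => //=.
  - by move=> x _; rewrite lee_fin normal_pdf_ge0.
  - by apply/measurable_EFinP; apply: measurable_funTS; exact: measurable_normal_pdf.
  - by move=> x _; rewrite lee_fin (le_trans (normal_pdf_ub _ _ sN0)).
rewrite integral_cst//= lebesgue_measure_itv/= lte_fin.
case: ifPn => _; last by rewrite mule0 lee_fin divr_ge0// ltW.
rewrite -EFinD -EFinM lee_fin (_ : 1 / (2 * s) * (z - - z) = z / s)//.
by field.
Qed.

Lemma normal_prob_sym (A : set R) : measurable A ->
  normal_prob 0 s (-%R @^-1` A) = normal_prob 0 s A.
Proof.
move=> mA; rewrite /normal_prob.
transitivity (\int[lebesgue_measure]_(x in (-%R : R -> measurableTypeR R) @^-1` A)
   (((fun x => (normal_pdf 0 s x)%:E) \o -%R) x))%E.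
  apply: eq_integral => x _ /=.
  by rewrite !normal_pdfE// /normal_fun !subr0 sqrrN.
rewrite -ge0_integral_pushforward//=; first last.
- by move=> x _; rewrite lee_fin normal_pdf_ge0.
- by apply/measurable_EFinP; apply: measurable_funTS; exact: measurable_normal_pdf.
by apply: eq_measure_integral => //= B mB _; exact: lebesgue_measureN.
Qed.

Lemma gaussianN : gaussian P s (fun w => - V w).
Proof.
split; first exact: measurableT_comp.
move=> A mA; rewrite -normal_prob_sym//.
rewrite (_ : _ @^-1` A = V @^-1` (-%R @^-1` A))// gV.2//.
by have := oppr_measurable measurableT mA; rewrite setTI.
Qed.

End gaussian.

Section gaussian_sym.
Context {d : measure_display} {T : measurableType d} {R : realType}.
Variables (P : probability T R) (s : R) (s0 : 0 < s) (V : T -> R).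
Hypothesis gV : gaussian P s V.

(** [V] and [- V] have the same law, so the positive and the negative part of [V] have the same
    mean. *)
Lemma Ex_V : Ex P V = 0.
Proof.
have gN := gaussianN s0 gV.
have iV := itg_V s0 gV.
pose f (x : R) := Num.max x 0.
have mf : measurable_fun setT f by exact: measurable_maxr.
have i1 : itg P (fun w => f (V w)).
  apply: itg_le (itg_norm iV); first by apply: measurableT_comp => //; exact: gV.1.
  by move=> w; rewrite /f; case: (leP (V w) 0) => h; rewrite ?normr0.
have i2 : itg P (fun w => f (- V w)).
  apply: itg_le (itg_norm iV); first by apply: measurableT_comp => //; exact: gN.1.
  by move=> w; rewrite /f; case: (leP (- V w) 0) => h; rewrite ?normr0 ?normrN.
have -> : V = (fun w => f (V w) - f (- V w)).
  by apply/funext => w; rewrite /f; case: (leP (V w) 0); case: (leP (- V w) 0); lra.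
rewrite ExB//; apply/eqP; rewrite subr_eq0; apply/eqP.
have f0 (x : R) : (0 <= (f x)%:E)%E by rewrite lee_fin /f le_max lexx orbT.
have mfE : measurable_fun setT (EFin \o f) by exact/measurable_EFinP.
by rewrite /Ex /Rintegral (gaussian_integral gV mfE f0)
           (gaussian_integral gN mfE f0).
Qed.

Lemma gaussian_ge0 : 1 / 2 <= Pr P [set w | 0 <= V w].
Proof.
have gN := gaussianN s0 gV.
have mm : measurable [set x : R | 0 <= x].
  rewrite (_ : [set x : R | _] = `[0, +oo[%classic); first exact: measurable_itv.
  by apply/seteqP; split => x /=; rewrite in_itv/= andbT.
have m1 : measurable [set w | 0 <= V w].
  by have := gV.1 measurableT _ mm; rewrite setTI.
have m2 : measurable [set w | 0 <= - V w].
  by have := gN.1 measurableT _ mm; rewrite setTI.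
have : Pr P setT <= Pr P [set w | 0 <= V w] + Pr P [set w | 0 <= - V w].
  rewrite -(_ : [set w | 0 <= V w] `|` [set w | 0 <= - V w] = setT).
    exact: PrU.
  apply/seteqP; split => // w _ /=; rewrite oppr_ge0.
  by case: (leP 0 (V w)) => h; [left|right; exact: ltW].
have -> : Pr P [set w | 0 <= - V w] = Pr P [set w | 0 <= V w].
  by rewrite (Pr_gaussian gN mm) (Pr_gaussian gV mm).
by rewrite /Pr probability_setT/=; lra.
Qed.

End gaussian_sym.

(** * Independent increments *)


Definition meas_wrt {d} {T : measurableType d} {R : realType} (G : set (set T)) (f : T -> R) : Prop :=
  forall A : set R, measurable A -> <<s G >> (f @^-1` A).

Section meas_wrt.
Context {d : measure_display} {T : measurableType d} {R : realType}.
Implicit Types (G H : set (set T)) (f g : T -> R).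

Lemma meas_wrtE G f : meas_wrt G f <->
  measurable_fun (setT : set (g_sigma_algebraType G)) (f : g_sigma_algebraType G -> R).
Proof.
split; first by move=> h _ A mA; rewrite setTI; exact: h.
by move=> h A mA; have := h measurableT A mA; rewrite setTI.
Qed.

Lemma meas_wrt_cst G (c : R) : meas_wrt G (fun=> c).
Proof. by apply/meas_wrtE. Qed.

Lemma meas_wrtD G f g : meas_wrt G f -> meas_wrt G g -> meas_wrt G (fun w => f w + g w).
Proof. by move=> /meas_wrtE mf /meas_wrtE mg; apply/meas_wrtE; exact: measurable_funD. Qed.

Lemma meas_wrtB G f g : meas_wrt G f -> meas_wrt G g -> meas_wrt G (fun w => f w - g w).
Proof. by move=> /meas_wrtE mf /meas_wrtE mg; apply/meas_wrtE; exact: measurable_funB. Qed.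

Lemma meas_wrt_comp G (h : R -> R) f : measurable_fun setT h -> meas_wrt G f ->
  meas_wrt G (fun w => h (f w)).
Proof. by move=> mh /meas_wrtE mf; apply/meas_wrtE; exact: measurableT_comp. Qed.

Lemma sub_sigma G H : (forall A, G A -> <<s H >> A) -> <<s G >> `<=` <<s H >>.
Proof. by move=> GH; apply: smallest_sub => //; exact: smallest_sigma_algebra. Qed.

Lemma sub_sigmaS G H : G `<=` H -> <<s G >> `<=` <<s H >>.
Proof. by move=> GH; apply: sub_sigma => A /GH; exact: sub_gen_smallest. Qed.

Lemma meas_wrtS G H f : (forall A, G A -> <<s H >> A) -> meas_wrt G f -> meas_wrt H f.
Proof. by move=> GH mf A mA; apply: (sub_sigma GH); exact: mf. Qed.

Lemma sigmaT G : <<s G >> setT.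
Proof. by have := @measurableT _ (g_sigma_algebraType G). Qed.

Lemma sigmaI G A B : <<s G >> A -> <<s G >> B -> <<s G >> (A `&` B).
Proof. by have := @measurableI _ (g_sigma_algebraType G) A B. Qed.

Lemma sigmaU G A B : <<s G >> A -> <<s G >> B -> <<s G >> (A `|` B).
Proof. by have := @measurableU _ (g_sigma_algebraType G) A B. Qed.

Lemma sigmaC G A : <<s G >> A -> <<s G >> (~` A).
Proof. by have := @measurableC _ (g_sigma_algebraType G) A. Qed.

Lemma sigma_bigcup G (F : (set T)^nat) : (forall n, <<s G >> (F n)) ->
  <<s G >> (\bigcup_n F n).
Proof. by have := @bigcupT_measurable _ (g_sigma_algebraType G) F. Qed.

Lemma sigma_bigcap G (F : (set T)^nat) : (forall n, <<s G >> (F n)) ->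
  <<s G >> (\bigcap_n F n).
Proof. by have := @bigcapT_measurable _ (g_sigma_algebraType G) F. Qed.

Lemma sigma_le G f (c : R) : meas_wrt G f -> <<s G >> [set w | f w <= c].
Proof.
move=> mf; have := mf `]-oo, c]%classic (measurable_itv _).
by congr (<<s G >> _); apply/seteqP; split => w /=; rewrite in_itv.
Qed.

Lemma sigma_ge G f (c : R) : meas_wrt G f -> <<s G >> [set w | c <= f w].
Proof.
move=> mf; have := mf `[c, +oo[%classic (measurable_itv _).
by congr (<<s G >> _); apply/seteqP; split => w /=; rewrite in_itv/= andbT.
Qed.

Lemma sigma_gt G f (c : R) : meas_wrt G f -> <<s G >> [set w | c < f w].
Proof.
move=> mf; have := mf `]c, +oo[%classic (measurable_itv _).
by congr (<<s G >> _); apply/seteqP; split => w /=; rewrite in_itv/= andbT.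
Qed.

Lemma sigma_lt G f (c : R) : meas_wrt G f -> <<s G >> [set w | f w < c].
Proof.
move=> mf; have := mf `]-oo, c[%classic (measurable_itv _).
by congr (<<s G >> _); apply/seteqP; split => w /=; rewrite in_itv.
Qed.

End meas_wrt.

Definition incgen {d} {T : measurableType d} {R : realType} (B : R -> T -> R) (I : set R) : set (set T) :=
  \bigcup_(p in I `*` I) preimage_set_system setT (fun w => B p.1 w - B p.2 w) measurable.

Definition incs {d} {T : measurableType d} {R : realType} (B : R -> T -> R) (I : set R) : set (set T) :=
  <<s incgen B I >>.

Section incs.
Context {d : measure_display} {T : measurableType d} {R : realType}.
Implicit Types (B : R -> T -> R) (I J : set R).

Lemma gen_preimage I (f : R -> T -> R) t : I t ->
  meas_wrt (\bigcup_(t in I) preimage_set_system setT (f t) measurable) (f t).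
Proof.
move=> It A mA; apply: sub_gen_smallest; exists t => //; exists A => //.
by rewrite setTI.
Qed.

Lemma incs_inc B I s t : I s -> I t -> meas_wrt (incgen B I) (fun w => B t w - B s w).
Proof.
move=> Is It A mA; apply: sub_gen_smallest; exists (t, s) => //; exists A => //.
by rewrite setTI.
Qed.

Lemma incsP B I G : (forall s t, I s -> I t -> meas_wrt G (fun w => B t w - B s w)) ->
  forall A, incs B I A -> <<s G >> A.
Proof.
move=> h A; apply: sub_sigma => {}A [[t s] /= [It Is]] [C mC <-].
by rewrite setTI; exact: (h s t Is It C mC).
Qed.

Lemma incs_sub B I J : I `<=` J -> forall A, incs B I A -> incs B J A.
Proof. by move=> IJ; apply: incsP => s t /IJ Is /IJ It; exact: incs_inc. Qed.

Lemma incsN B I A : incs (fun t w => - B t w) I A -> incs B I A.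
Proof.
apply: incsP => s t Is It.
rewrite (_ : (fun w => _) = (fun w => B s w - B t w)); first exact: incs_inc.
by apply/funext => w; rewrite opprK addrC.
Qed.

Lemma incs_rev B I A : incs (fun t => B (- t)) I A -> incs B [set t | I (- t)] A.
Proof.
by apply: incsP => s t Is It; apply: (@incs_inc B _ (- s) (- t)) => /=; rewrite opprK.
Qed.

Lemma incs_rev' B I A : incs B I A -> incs (fun t => B (- t)) [set t | I (- t)] A.
Proof.
apply: incsP => s t Is It; rewrite -{1}(opprK s) -{1}(opprK t).
by apply: (@incs_inc (fun t => B (- t)) _ (- s) (- t)) => /=; rewrite opprK.
Qed.

End incs.

Section indep.
Context {d : measure_display} {T : measurableType d} {R : realType}.
Variable P : probability T R.
Implicit Types G H : set (set T).

Lemma indepC G H : indep_set_systems P G H -> indep_set_systems P H G.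
Proof. by move=> h A B HA GB; rewrite setIC h// muleC. Qed.

Lemma indepS G G' H H' : G' `<=` G -> H' `<=` H ->
  indep_set_systems P G H -> indep_set_systems P G' H'.
Proof. by move=> GG HH h A B /GG GA /HH HB; exact: h. Qed.

(** Dynkin's argument: for a fixed [B] in [H], the measurable sets independent of [B] form a Dynkin
    system, and the Dynkin system generated by an intersection-stable [G] is already the
    sigma-algebra. *)
Lemma indep_gen G H : setI_closed G -> G `<=` measurable -> H `<=` measurable ->
  indep_set_systems P G H -> indep_set_systems P <<s G >> H.
Proof.
move=> GI mG mH h A B; rewrite -setI_closed_g_dynkin_g_sigma_algebra//.
move=> + HB; have mB := mH _ HB.
suff : <<d G >> `<=` [set A | measurable A /\ P (A `&` B) = (P A * P B)%E].
  by move=> + dA => /(_ _ dA)[].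
apply: smallest_sub; last by move=> C GC; split; [exact: mG|exact: h].
split => /=.
- by rewrite setTI probability_setT mul1e; split.
- move=> C [mC PC]; split; first exact: measurableC.
  have -> : ~` C `&` B = B `\` (C `&` B).
    apply/seteqP; split => w /=; first by move=> [nC wB]; split => // -[].
    by move=> [wB nCB]; split => // wC; exact: nCB.
  rewrite measureD ?setIA//; [|exact: measurableI|]; last first.
    by rewrite ltey_eq fin_num_measure.
  have -> : B `&` C `&` B = C `&` B by rewrite (setIC B) -setIA setIid.
  have -> : (P B - P (C `&` B) = P B - P C * P B)%E by congr (_ - _)%E.
  rewrite probability_setC// !PrE// -EFinM -EFinB -EFinB -EFinM.
  by congr EFin; ring.
- move=> F tF FG; split; first by apply: bigcupT_measurable => n; have [] := FG n.
  rewrite setI_bigcupl measure_bigcup//; last 2 first.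
    by move=> n _; apply: measurableI => //; have [] := FG n.
    exact: trivIset_setIr.
  rewrite measure_bigcup//; last by move=> n _; have [] := FG n.
  rewrite muleC PrE// -nneseriesZl; last by move=> n _; exact: measure_ge0.
  by apply: eq_eseriesr => n _; have [_ h'] := FG n; rewrite -(PrE P mB) muleC; exact: h'.
Qed.

End indep.

(** These intersections generate the join of two sigma-algebras; their stability makes [indep_gen]
    applicable to that join. *)
Lemma setI_closed_inter {T : Type} (F G : set (set T)) :
  setI_closed F -> setI_closed G ->
  setI_closed [set A | exists C D, [/\ F C, G D & A = C `&` D]].
Proof.
move=> FI GI _ _ [C1 [D1 [FC1 GD1 ->]]] [C2 [D2 [FC2 GD2 ->]]].
exists (C1 `&` C2), (D1 `&` D2); split; [exact: FI|exact: GI|by rewrite setIACA].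
Qed.

Lemma sigma_process_measurable {d} {T : measurableType d} {R : realType}
  (W : R -> T -> R) (I : set R) : (forall t, measurable_fun setT (W t)) ->
  <<s \bigcup_(t in I) preimage_set_system setT (W t) measurable >> `<=` measurable.
Proof.
move=> mW; apply: smallest_sub; first exact: sigma_algebra_measurable.
by move=> A [t _ [C mC <-]]; exact: mW.
Qed.

Lemma incs_measurable {d} {T : measurableType d} {R : realType}
  (W : R -> T -> R) (I : set R) : (forall t, measurable_fun setT (W t)) ->
  incs W I `<=` measurable.
Proof.
move=> mW; apply: smallest_sub; first exact: sigma_algebra_measurable.
move=> A [[t s] /= _ [C mC <-]].
exact: (measurable_funB (mW t) (mW s)).
Qed.

Definition valgen {d} {T : measurableType d} {R : realType} (W : R -> T -> R) (I : set R) :=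
  \bigcup_(t in I) preimage_set_system setT (W t) measurable.

(* The values of a Brownian motion at nonnegative times, normalised so that it starts at 0 everywhere. *)
Record bm0 {d} {T : measurableType d} {R : realType} (P : probability T R)
    (sigma : R) (W : R -> T -> R) : Prop := {
  bm0_meas : forall t, measurable_fun setT (W t);
  bm0_0 : forall w, W 0 w = 0;
  bm0_law : forall s t : R, 0 <= s -> s < t ->
    gaussian P (sigma * Num.sqrt (t - s)) (fun w => W t w - W s w);
  bm0_indep : forall s t : R, 0 <= s -> s < t ->
    indep_set_systems P <<s valgen W `[0, s] >>
      (preimage_set_system setT (fun w => W t w - W s w) measurable) }.

Section bm0.
Context {d : measure_display} {T : measurableType d} {R : realType}.
Variables (P : probability T R) (sigma : R) (W : R -> T -> R).
Hypothesis hW : bm0 P sigma W.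

Let F (b : R) := <<s valgen W `[0, b] >>.
Let fgen (b : R) (s : seq R) : set (set T) :=
  \bigcup_(r in [set` s]) preimage_set_system setT (fun w => W r w - W b w) measurable.

Let mW t : measurable_fun setT (W t) := bm0_meas hW t.

Let valW b t : 0 <= t <= b -> meas_wrt (valgen W `[0, b]) (W t).
Proof. by move=> tb; apply: gen_preimage; rewrite /= in_itv. Qed.

Let F_sub b b' : b <= b' -> F b `<=` F b'.
Proof.
move=> bb'; apply: sub_sigmaS => A [t /=]; rewrite in_itv/= => /andP[t0 tb] h.
by exists t => //=; rewrite in_itv/= t0 (le_trans tb).
Qed.

Let fgen_F b b' s : 0 <= b -> path <%R b s -> last b s <= b' ->
  <<s fgen b s >> `<=` F b'.
Proof.
move=> b0 ps lb; apply: sub_sigma => A [r /= rs [C mC <-]]; rewrite setTI.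
have bl : b <= last b s.
  have := mem_last b s; rewrite inE => /predU1P[->//|].
  by have /allP h := order_path_min lt_trans ps; move/h => /ltW.
have h1 : b < r by have /allP := order_path_min lt_trans ps; exact.
have h2 : r <= last b s.
  elim: s b ps rs {b0 bl h1 lb} => //= x s IH b /andP[bx ps]; rewrite inE => /predU1P[->|rs].
    have := mem_last x s; rewrite inE => /predU1P[->//|].
    by have /allP h := order_path_min lt_trans ps; move/h => /ltW.
  exact: (IH x).
have := @meas_wrtB _ _ _ (valgen W `[0, b']) (W r) (W b).
apply => //; apply: valW.
- by rewrite (le_trans b0 (ltW h1)) (le_trans h2).
- by rewrite b0 (le_trans bl).
Qed.

Let fgen_last b s : meas_wrt (fgen b s) (fun w => W (last b s) w - W b w).
Proof.
have := mem_last b s; rewrite inE => /predU1P[->|h].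
  rewrite (_ : (fun w => _) = fun=> 0); first exact: meas_wrt_cst.
  by apply/funext => w; rewrite subrr.
by apply: (@gen_preimage _ _ _ _ (fun r w => W r w - W b w)).
Qed.

Let indep0 (b : R) : indep_set_systems P (F b) <<s fgen b [::] >>.
Proof.
have mF : F b `<=` measurable by exact: sigma_process_measurable.
apply: indepC; apply: indep_gen => //.
- by move=> A B [r /=].
- by move=> A [r /=].
- by move=> A B [r /=].
Qed.

(** The definition of Brownian motion separates the past from one increment at a time. Induction on
    the grid, with points added at the right end: the last increment is independent of everything up
    to [last b s], which contains both [F b] and the earlier grid increments. *)
Lemma bm0_grid b s : 0 <= b -> path <%R b s ->
  indep_set_systems P (F b) <<s fgen b s >>.
Proof.
move=> b0; elim/last_ind: s => [|s r IH]; first by move=> _; exact: indep0.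
rewrite rcons_path => /andP[ps br].
have mF c : F c `<=` measurable by exact: sigma_process_measurable.
have bl : b <= last b s.
  have := mem_last b s; rewrite inE => /predU1P[->//|].
  by have /allP h := order_path_min lt_trans ps; move/h => /ltW.
pose Xi w := W r w - W (last b s) w.
pose Pi := [set A | exists C D, [/\ <<s fgen b s >> C,
   preimage_set_system setT Xi measurable D & A = C `&` D]].
have sub : <<s fgen b (rcons s r) >> `<=` <<s Pi >>.
  have h1 : forall A, <<s fgen b s >> A -> <<s Pi >> A.
    move=> A sA; apply: sub_gen_smallest; exists A, setT; split => //.
    - by exists setT => //; rewrite preimage_setT setIT.
    - by rewrite setIT.
  have h2 : meas_wrt Pi Xi.
    move=> A mA; apply: sub_gen_smallest; exists setT, (Xi @^-1` A).
    by split; [exact: sigmaT|exists A => //; rewrite setTI|rewrite setTI].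
  apply: sub_sigma => A [r0 /=]; rewrite mem_rcons inE => /predU1P[->|rs] [C mC <-].
    rewrite setTI; suff : meas_wrt Pi (fun w => W r w - W b w) by exact.
    rewrite (_ : (fun w => _) = (fun w => Xi w + (W (last b s) w - W b w))).
      apply: meas_wrtD => //.
      by move=> E mE; apply: h1; exact: (@fgen_last b s E mE).
    by apply/funext => w; rewrite /Xi; ring.
  apply: h1; rewrite setTI.
  exact: (@gen_preimage _ _ _ [set` s] (fun r w => W r w - W b w) r0 rs).
apply: (indepS (G := F b) (H := <<s Pi >>)) => //.
apply: indepC; apply: indep_gen => //.
- apply: setI_closed_inter => A B; first exact: sigmaI.
  move=> [A' mA <-] [B' mB <-]; exists (A' `&` B'); first exact: measurableI.
  by rewrite !setTI preimage_setI.
- move=> A [C [D [sC [E mE <-] ->]]]; apply: measurableI.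
    by apply: (mF (last b s)); exact: (fgen_F b0 ps (lexx _)).
  exact: (measurable_funB (mW r) (mW (last b s))).
- move=> A B [C [D [sC iD ->]]] FB.
  have l0 := le_trans b0 bl.
  have FC : F (last b s) C by exact: (fgen_F b0 ps (lexx _)).
  have FB' : F (last b s) B by exact: (F_sub bl).
  have ind := bm0_indep hW l0 br.
  rewrite setIAC (ind _ _ _ iD); last exact: sigmaI.
  rewrite (ind _ _ FC iD) setIC (IH ps _ _ FB sC).
  by rewrite muleC (muleC (P B)) !muleA (muleC (P D)).
Qed.

(** Events determined by a finite grid after [b] generate the future and are stable under
    intersection, because two grids lie in a common one. *)
Lemma bm0_future b : 0 <= b ->
  indep_set_systems P (F b) (incs W [set t | b <= t]).
Proof.
move=> b0.
have mF c : F c `<=` measurable by exact: sigma_process_measurable.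
pose Pi := [set A | exists2 s, path <%R b s & <<s fgen b s >> A].
(* Normal form of a grid, as [bm0_grid] expects it: increasing, without repetition, restricted to
   points after [b]. *)
pose N (l : seq R) := sort <=%R (undup [seq r <- l | b < r]).
have Npath l : path <%R b (N l).
  rewrite path_sortedE; last exact: lt_trans.
  by rewrite all_sort all_undup filter_all/= sort_lt_sorted undup_uniq.
have Nmem l r : r \in N l = (b < r) && (r \in l).
  by rewrite mem_sort mem_undup mem_filter.
apply: (indepS (G := F b) (H := <<s Pi >>)) => //.
  apply: incsP => s t /= bs bt A mA.
  apply: sub_gen_smallest; exists (N [:: s; t]) => //.
  have h r : r \in [:: s; t] -> b <= r -> meas_wrt (fgen b (N [:: s; t])) (fun w => W r w - W b w).
    move=> rst; rewrite le_eqVlt => /predU1P[<-|br].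
      rewrite (_ : (fun w => _) = fun=> 0); first exact: meas_wrt_cst.
      by apply/funext => w; rewrite subrr.
    by apply: (@gen_preimage _ _ _ _ (fun r w => W r w - W b w)); rewrite /= Nmem br.
  have := meas_wrtB (h t _ bt) (h s _ bs); rewrite !inE !eqxx orbT => /(_ isT isT) h'.
  rewrite (_ : (fun w => _) = (fun w => W t w - W b w - (W s w - W b w))); first exact: h'.
  by apply/funext => w; ring.
apply: indepC; apply: indep_gen => //.
- move=> A B [s ps sA] [s' ps' sB]; exists (N (s ++ s')) => //.
  have sub s1 : path <%R b s1 -> {subset s1 <= s ++ s'} ->
      <<s fgen b s1 >> `<=` <<s fgen b (N (s ++ s')) >>.
    move=> p1 ss; apply: sub_sigmaS => C [r /= rs1 h]; exists r => //=.
    by rewrite Nmem ss// andbT; have /allP := order_path_min lt_trans p1; exact.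
  apply: sigmaI; [apply: (sub s) => //|apply: (sub s') => //] => x xs.
    by rewrite mem_cat xs.
  by rewrite mem_cat xs orbT.
- by move=> A [s ps sA]; apply: (mF (last b s)); exact: (fgen_F b0 ps (lexx _)).
- by move=> A B [s ps sA] FB; apply: (indepC (bm0_grid b0 ps)).
Qed.

End bm0.

Lemma ae_eq_Pr {d} {T : measurableType d} {R : realType} (P : probability T R)
    (A B : set T) : measurable A -> measurable B ->
  {ae P, forall w, A w <-> B w} -> P A = P B.
Proof.
move=> mA mB h.
rewrite -(setIT A) -(setIT B) -!integral_indic//.
apply: ae_eq_integral => //.
- by apply/measurable_EFinP; exact: measurable_indic.
- by apply/measurable_EFinP; exact: measurable_indic.
apply: filterS h => w [AB BA] _; congr EFin; rewrite !indicE.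
have [h|h] := pselect (A w); first by rewrite !mem_set//; exact: AB.
by rewrite !memNset// => /BA.
Qed.

Section indep_integral.
Context {d : measure_display} {T : measurableType d} {R : realType}.
Variable P : probability T R.

(** A measure that is a product on rectangles is the product measure, and Tonelli's theorem
    separates the variables. The marginals enter as [mu] and [nu] rather than as image measures, so
    that several pairs of variables can be compared through one formula. *)
Lemma indep_integral (U V : T -> R) (mu nu : probability (measurableTypeR R) R)
    (h : R * R -> \bar R) :
  measurable_fun setT U -> measurable_fun setT V ->
  (forall A B, measurable A -> measurable B ->
    P (U @^-1` A `&` V @^-1` B) = (mu A * nu B)%E) ->
  measurable_fun setT h -> (forall x, (0 <= h x)%E) ->
  (\int[P]_w h (U w, V w) = \int[nu]_y \int[mu]_x h (x, y))%E.
Proof.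
move=> mU mV UV mh h0.
pose phi := fun w => (U w, V w) : measurableTypeR R * measurableTypeR R.
have mphi : measurable_fun setT phi by exact/measurable_fun_pairP.
have := @ge0_integral_pushforward _ _ T (measurableTypeR R * measurableTypeR R)%type
  R phi mphi P setT h measurableT mh (fun x _ => h0 x).
rewrite preimage_setT => /esym ->.
rewrite -(fubini_tonelli2 (m1 := mu) (m2 := nu) h mh h0).
apply: eq_measure_integral => A mA _; apply/esym/product_measure_unique => //.
Qed.

(** Serves to find the law of an increment across time 0 without convolving Gaussian laws. *)
Lemma indep_sum_law (U V U' V' : T -> R) (mu nu : probability (measurableTypeR R) R)
    (A : set R) :
  measurable_fun setT U -> measurable_fun setT V ->
  measurable_fun setT U' -> measurable_fun setT V' ->
  (forall A B, measurable A -> measurable B ->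
    P (U @^-1` A `&` V @^-1` B) = (mu A * nu B)%E) ->
  (forall A B, measurable A -> measurable B ->
    P (U' @^-1` A `&` V' @^-1` B) = (mu A * nu B)%E) ->
  measurable A ->
  P ((fun w => U w + V w) @^-1` A) = P ((fun w => U' w + V' w) @^-1` A).
Proof.
move=> mU mV mU' mV' UV UV' mA.
pose h (x : R * R) : \bar R := (\1_A (x.1 + x.2))%:E.
have mh : measurable_fun setT h.
  apply/measurable_EFinP; apply: measurableT_comp; first exact: measurable_indic.
  exact: measurable_funD.
have h0 x : (0 <= h x)%E by rewrite lee_fin.
have := indep_integral mU' mV' UV' mh h0.
rewrite -(indep_integral mU mV UV mh h0) /h/= => e.
have mS : measurable ((fun w => U w + V w) @^-1` A).
  by have := measurable_funD mU mV measurableT mA; rewrite setTI.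
have mS' : measurable ((fun w => U' w + V' w) @^-1` A).
  by have := measurable_funD mU' mV' measurableT mA; rewrite setTI.
rewrite -(setIT (_ @^-1` A)) -[in RHS](setIT (_ @^-1` A)) -!integral_indic//.
Qed.

End indep_integral.

(* The sigma-algebras are generated by increments, not by values: this makes the notion invariant
   under translations, sign change and time reversal. *)
Record igi {d} {T : measurableType d} {R : realType} (P : probability T R)
    (sigma : R) (B : R -> T -> R) : Prop := {
  igi_meas : forall t, measurable_fun setT (B t);
  igi_law : forall s t : R, s < t ->
    gaussian P (sigma * Num.sqrt (t - s)) (fun w => B t w - B s w);
  igi_indep : forall b : R,
    indep_set_systems P (incs B [set t | t <= b]) (incs B [set t | b <= t]);
  igi_cont : {ae P, forall w, continuous (fun t => B t w)} }.

Section two_sided.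
Context {d : measure_display} {T : measurableType d} {R : realType}.
Variables (P : probability T R) (sigma : R) (s0 : 0 < sigma).

(** The past of [b] is generated by the negative times and [[0, b]], its future lies in the
    sigma-algebra of positive times. Independence of the two half-lines splits off the negative
    part, [bm0_future] the rest. *)
Lemma two_sided_indep (W : R -> T -> R) :
  bm0 P sigma W -> bm0 P sigma (fun t => W (- t)) ->
  indep_set_systems P <<s valgen W `]0, +oo[ >>
    <<s valgen (fun t => W (- t)) `]0, +oo[ >> ->
  forall b, 0 <= b ->
  indep_set_systems P (incs W [set t | t <= b]) (incs W [set t | b <= t]).
Proof.
move=> hW hW' PN b b0.
have mW := bm0_meas hW; have mW' := bm0_meas hW'.
set Pos := <<s valgen W `]0, +oo[ >> in PN.
set Neg := <<s valgen (fun t => W (- t)) `]0, +oo[ >> in PN.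
pose Fb := <<s valgen W `[0, b] >>.
have W0 (G : set (set T)) : meas_wrt G (W 0).
  rewrite (_ : W 0 = fun=> 0); first exact: meas_wrt_cst.
  by apply/funext => w; exact: (bm0_0 hW).
have posW t : 0 <= t -> meas_wrt (valgen W `]0, +oo[) (W t).
  rewrite le_eqVlt => /predU1P[<-|t0]; first exact: W0.
  by apply: gen_preimage; rewrite /= in_itv/= t0.
have FbPos : Fb `<=` Pos.
  apply: sub_sigma => A [t /=]; rewrite in_itv/= => /andP[t0 _] [C mC <-].
  by rewrite setTI; exact: posW.
have futPos : incs W [set t | b <= t] `<=` Pos.
  by apply: incsP => s t /= bs bt; apply: meas_wrtB; apply: posW; exact: le_trans b0 _.
pose Pi := [set A | exists C D, [/\ Neg C, Fb D & A = C `&` D]].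
have mNeg : Neg `<=` measurable by exact: sigma_process_measurable.
have mFb : Fb `<=` measurable by exact: sigma_process_measurable.
apply: (indepS (G := <<s Pi >>) (H := incs W [set t | b <= t])) => //.
  have h t : t <= b -> meas_wrt Pi (W t).
    move=> tb A mA; apply: sub_gen_smallest; have [t0|t0] := leP 0 t.
      exists setT, (W t @^-1` A); split; rewrite ?setTI//; first exact: sigmaT.
      by apply: gen_preimage => //; rewrite /= in_itv/= t0.
    exists (W t @^-1` A), setT; split; rewrite ?setIT//; last exact: sigmaT.
    rewrite -{1}(opprK t).
    by apply: (@gen_preimage _ _ _ _ (fun t => W (- t)) (- t)) => //; rewrite /= in_itv/= oppr_gt0 t0.
  by apply: incsP => s t /= sb tb; apply: meas_wrtB; exact: h.
apply: indep_gen.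
- by apply: setI_closed_inter => A B; exact: sigmaI.
- by move=> A [C [D [/mNeg mC /mFb mD ->]]]; exact: measurableI.
- exact: incs_measurable.
- move=> A B [C [D [NC FD ->]]] fB.
  have PB := futPos _ fB; have PD := FbPos _ FD.
  rewrite -setIA setIC (PN _ _ _ NC); last exact: sigmaI.
  rewrite (bm0_future hW b0 FD fB) (setIC C) (PN _ _ PD NC).
  by rewrite muleAC.
Qed.

Lemma bm0_law0 (W : R -> T -> R) (t : R) : bm0 P sigma W -> 0 < t ->
  gaussian P (sigma * Num.sqrt t) (W t).
Proof.
move=> hW t0; have := bm0_law hW (lexx 0) t0; rewrite subr0.
by congr gaussian; apply/funext => w; rewrite (bm0_0 hW) subr0.
Qed.

Lemma two_sided_law (W : R -> T -> R) :
  bm0 P sigma W -> bm0 P sigma (fun t => W (- t)) ->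
  indep_set_systems P <<s valgen W `]0, +oo[ >>
    <<s valgen (fun t => W (- t)) `]0, +oo[ >> ->
  forall s t : R, s < t -> gaussian P (sigma * Num.sqrt (t - s)) (fun w => W t w - W s w).
Proof.
move=> hW hW' PN s t st.
have mW := bm0_meas hW.
have [s_ge0|s_lt0] := leP 0 s; first exact: (bm0_law hW).
have [t_le0|t_gt0] := leP t 0.
  have := bm0_law hW' (s := - t) (t := - s); rewrite oppr_ge0 ltrN2 => /(_ t_le0 st).
  rewrite !opprK addrC => g.
  have st0 : 0 < sigma * Num.sqrt (t - s) by rewrite mulr_gt0// sqrtr_gt0 subr_gt0.
  have := gaussianN st0 g.
  by congr gaussian; apply/funext => w; rewrite opprB.
(* Across 0 the increment is [W t + (- W s)], a sum of independent Gaussian variables of variances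
   [sigma ^+ 2 * t] and [sigma ^+ 2 * (- s)]. The terms of [(W (t - s) - W (- s)) + W (- s)] are
   independent with the same two laws, and that sum telescopes to a variable of known law. *)
have ns : 0 < - s by rewrite oppr_gt0.
split; first exact: measurable_funB.
move=> A mA.
have nst : - s < t - s by rewrite ltrDr.
have gV := bm0_law0 hW' ns; rewrite opprK in gV.
have gU := bm0_law0 hW t_gt0.
have gV' := bm0_law0 hW ns.
have gU' := bm0_law hW (ltW ns) nst; rewrite opprK subrK in gU'.
have s0' : 0 < sigma * Num.sqrt (- s) by rewrite mulr_gt0// sqrtr_gt0.
have gVN := gaussianN s0' gV.
pose mu : probability (measurableTypeR R) R := normal_prob 0 (sigma * Num.sqrt t).
pose nu : probability (measurableTypeR R) R := normal_prob 0 (sigma * Num.sqrt (- s)).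
have e1 C D : measurable C -> measurable D ->
    P (W t @^-1` C `&` (fun w => - W s w) @^-1` D) = (mu C * nu D)%E.
  move=> mC mD; rewrite PN.
  - by rewrite (gU.2 _ mC) (gVN.2 _ mD).
  - by apply: gen_preimage => //; rewrite /= in_itv/= t_gt0.
  - apply: (@meas_wrt_comp _ _ _ _ -%R) => //.
    rewrite -(opprK s).
    by apply: (@gen_preimage _ _ _ _ (fun t => W (- t)) (- s)); rewrite /= in_itv/= ns.
have e2 C D : measurable C -> measurable D ->
    P ((fun w => W (t - s) w - W (- s) w) @^-1` C `&` W (- s) @^-1` D) = (mu C * nu D)%E.
  move=> mC mD; rewrite setIC (bm0_indep hW (ltW ns) nst).
  - by rewrite muleC (gU'.2 _ mC) (gV'.2 _ mD).
  - by apply: gen_preimage => //; rewrite /= in_itv/= lexx ltW.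
  - by exists C => //; rewrite setTI.
have := indep_sum_law (mW t) gVN.1 gU'.1 (mW (- s)) e1 e2 mA => ->.
have ts0 : 0 < t - s by rewrite subr_gt0.
have := (bm0_law0 hW ts0).2 A mA => <-; congr (P _).
by apply/seteqP; split => w /=; rewrite subrK.
Qed.

(** Forcing the value at time 0 changes each increment only on a null set and does not enlarge the
    sigma-algebra of the past. *)
Lemma brownian_bm0 (W : R -> {RV P >-> R}) : brownian_motion sigma W ->
  bm0 P sigma (fun t w => if t == 0 then 0 else W t w).
Proof.
move=> [ae0 _ law ind].
set W' := fun t w => _.
have mW' t : measurable_fun setT (W' t).
  by rewrite /W'; case: eqP => _; [exact: measurable_cst|exact: measurable_funP].
have law0 s t : 0 <= s -> s < t -> gaussian P (sigma * Num.sqrt (t - s)) (fun w => W t w - W s w).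
  move=> s_ge0 st; split; first by apply: measurable_funB; exact: measurable_funP.
  by move=> A mA; exact: law.
have aeW s t : {ae P, forall w, W' t w - W' s w = W t w - W s w}.
  by apply: filterS ae0 => w w0; rewrite /W'; do 2 case: eqP => [->|_]; rewrite ?w0.
have minc s t : measurable_fun setT (fun w => W' t w - W' s w) by exact: measurable_funB.
have pre s t A F : 0 <= s -> s < t -> measurable A -> measurable F ->
    P (F `&` (fun w => W' t w - W' s w) @^-1` A) =
    P (F `&` (fun w => W t w - W s w) @^-1` A).
  move=> s_ge0 st mA mF; apply: ae_eq_Pr.
  - by apply: measurableI => //; have := minc s t measurableT A mA; rewrite setTI.
  - apply: measurableI => //.
    by have := (law0 s t s_ge0 st).1 measurableT A mA; rewrite setTI.
  - by apply: filterS (aeW s t) => w /= ->.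
split => //.
- by move=> w; rewrite /W' eqxx.
- move=> s t s_ge0 st; split => // A mA.
  rewrite -(setTI (_ @^-1` A)) (pre s t)// setTI.
  exact: (law0 s t s_ge0 st).2.
- move=> s t s_ge0 st F _ FF [A mA <-]; rewrite setTI.
  have FW : sigma_process W `[0, s] F.
    move: F FF; apply: sub_sigma => A' [t' /= t's [C mC <-]]; rewrite setTI /W'.
    case: eqP => [_|_]; first exact: meas_wrt_cst.
    by apply: gen_preimage.
  have mF : measurable F.
    by move: F {FF} FW; apply: sigma_process_measurable => t'; exact: measurable_funP.
  rewrite pre// -[in RHS](setTI (_ @^-1` A)) [in RHS]pre// setTI.
  apply: (ind s t) => //.
  apply: sub_gen_smallest; exists A => //.
  by rewrite setTI.
Qed.

Lemma continuous_glue (f : R -> R) : {within `[0, +oo[, continuous f} ->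
  {within `[0, +oo[, continuous (fun t => f (- t))} -> continuous f.
Proof.
move=> /continuous_within_itvcyP[cf rf] /continuous_within_itvcyP[cg rg] t.
have [t0|t0|->] := ltgtP t 0.
- have -> : f = (fun x => f (- x)) \o -%R by apply/funext => x /=; rewrite opprK.
  apply: continuous_comp; first exact: opp_continuous.
  by apply: cg; rewrite in_itv/= oppr_gt0 t0.
- by apply: cf; rewrite in_itv/= t0.
- apply/left_right_continuousP; split => //.
  apply/cvg_at_leftNP; rewrite oppr0.
  by move: rg; rewrite oppr0.
Qed.

Lemma two_sided_igi (W : R -> {RV P >-> R}) : two_sided_brownian_motion sigma W ->
  exists B : R -> T -> R, igi P sigma B /\ {ae P, forall w t, B t w = W t w}.
Proof.
move=> [bW bW' PN].
pose B (t : R) (w : T) := if t == 0 then 0 else W t w.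
exists B.
have BE : (fun t w => if t == 0 then 0 else W (- t) w) = (fun t => B (- t)).
  by apply/funext => t; apply/funext => w; rewrite /B oppr_eq0.
have hB := brownian_bm0 bW; rewrite -/B in hB.
have hB' := brownian_bm0 bW'; rewrite BE in hB'.
have PN' : indep_set_systems P <<s valgen B `]0, +oo[ >>
    <<s valgen (fun t => B (- t)) `]0, +oo[ >>.
  apply: (indepS _ _ PN); apply: sub_sigma => A [t /=]; rewrite in_itv/= andbT => t0 [C mC <-];
    rewrite setTI /B ?oppr_eq0 (gt_eqF t0); apply: gen_preimage => //; rewrite /= in_itv/= t0//.
have PN'' : indep_set_systems P <<s valgen (fun t => B (- t)) `]0, +oo[ >>
    <<s valgen (fun t => B (- - t)) `]0, +oo[ >>.
  rewrite (_ : (fun t => B (- - t)) = B); first exact: indepC.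
  by apply/funext => t; rewrite opprK.
have hB'' : bm0 P sigma (fun t => B (- - t)).
  by rewrite (_ : (fun t => B (- - t)) = B)//; apply/funext => t; rewrite opprK.
have aeB : {ae P, forall w t, B t w = W t w}.
  have [ae0 _ _ _] := bW.
  by apply: filterS ae0 => w w0 t; rewrite /B; case: eqP => [->|//].
split=> //; split.
- exact: (bm0_meas hB).
- exact: two_sided_law.
- move=> b; have [b0|b0] := leP 0 b; first exact: (two_sided_indep hB).
  (* The reversed process turns a negative [b] into the positive time [- b], with past and future
     exchanged. *)
  have nb : 0 <= - b by rewrite oppr_ge0 ltW.
  have := two_sided_indep hB' hB'' PN'' nb => /indepC.
  apply: indepS => A /incs_rev'; apply: incs_sub => t /=.
    by rewrite lerNl.
  by rewrite lerNr.
- have [_ c1 _ _] := bW; have [_ c2 _ _] := bW'.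
  apply: filterS3 aeB c1 c2 => w wB cc1 cc2.
  rewrite (_ : (fun t => B t w) = (fun t => W t w)); last by apply/funext.
  exact: continuous_glue.
Qed.

End two_sided.

Section igi_sym.
Context {d : measure_display} {T : measurableType d} {R : realType}.
Variables (P : probability T R) (sigma : R) (s0 : 0 < sigma).

Lemma igiN (B : R -> T -> R) : igi P sigma B -> igi P sigma (fun t w => - B t w).
Proof.
move=> [mB law ind cont]; split.
- by move=> t; exact: measurableT_comp.
- move=> s t st.
  have st0 : 0 < sigma * Num.sqrt (t - s) by rewrite mulr_gt0// sqrtr_gt0 subr_gt0.
  have := gaussianN st0 (law s t st).
  by congr gaussian; apply/funext => w; rewrite opprB opprK addrC.
- by move=> b; apply: (indepS _ _ (ind b)); exact: incsN.
- by apply: filterS cont => w cw t; apply: cvgN; exact: cw.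
Qed.

Lemma igi_rev (B : R -> T -> R) : igi P sigma B -> igi P sigma (fun t => B (- t)).
Proof.
move=> [mB law ind cont]; split.
- by move=> t; exact: mB.
- move=> s t st.
  have st0 : 0 < sigma * Num.sqrt (t - s) by rewrite mulr_gt0// sqrtr_gt0 subr_gt0.
  have nst : - t < - s by rewrite ltrN2.
  have := law _ _ nst; rewrite opprK addrC => /(gaussianN st0).
  by congr gaussian; apply/funext => w; rewrite opprB.
- move=> b; apply: indepC; apply: (indepS _ _ (ind (- b))) => A /incs_rev; apply: incs_sub => t /=.
    by rewrite lerNr.
  by rewrite lerNl.
- apply: filterS cont => w cw t.
  by apply: (@continuous_comp _ _ _ -%R (fun t => B t w)); [exact: opp_continuous|exact: cw].
Qed.

End igi_sym.

(** * Maxima of Brownian motion with drift *)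


Section square_integrable.
Context {d : measure_display} {T : measurableType d} {R : realType}.
Variable P : probability T R.
Implicit Types f g : T -> R.

Definition itg2 f := measurable_fun setT f /\ itg P (fun w => f w ^+ 2).

Lemma itg2_itg f : itg2 f -> itg P f.
Proof.
move=> [mf f2]; apply: (itg_le (g := fun w => 1 + f w ^+ 2)) => //.
  by move=> w; rewrite ler_norml; apply/andP; split; nra.
by apply: itgD => //; exact: itg_cst.
Qed.

Lemma itgM f g : itg2 f -> itg2 g -> itg P (fun w => f w * g w).
Proof.
move=> [mf f2] [mg g2]; apply: (itg_le (g := fun w => f w ^+ 2 + g w ^+ 2)).
- exact: measurable_funM.
- by move=> w; rewrite ler_norml; apply/andP; split; nra.
- exact: itgD.
Qed.

Lemma itg2D f g : itg2 f -> itg2 g -> itg2 (fun w => f w + g w).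
Proof.
move=> [mf f2] [mg g2]; split; first exact: measurable_funD.
apply: (itg_le (g := fun w => 2 * f w ^+ 2 + 2 * g w ^+ 2)).
- by apply: measurable_funX; exact: measurable_funD.
- by move=> w; rewrite ger0_norm ?sqr_ge0//; have := sqr_ge0 (f w - g w); nra.
- by apply: itgD; exact: itgZ.
Qed.

Lemma itg2N f : itg2 f -> itg2 (fun w => - f w).
Proof.
move=> [mf f2]; split; first exact: measurableT_comp.
by under eq_fun do rewrite sqrrN.
Qed.

Lemma itg2B f g : itg2 f -> itg2 g -> itg2 (fun w => f w - g w).
Proof. by move=> f2 /itg2N g2; exact: itg2D. Qed.

Lemma itg2_cst c : itg2 (fun=> c).
Proof. by split => //; exact: itg_cst. Qed.

Lemma itg2_le f g : measurable_fun setT f -> (forall w, `|f w| <= `|g w|) -> itg2 g -> itg2 f.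
Proof.
move=> mf fg [mg g2]; split => //; apply: itg_le g2; first exact: measurable_funX.
move=> w; rewrite ger0_norm ?sqr_ge0// -(real_normK (num_real (f w))).
by rewrite -(real_normK (num_real (g w))) ler_pXn2r// nnegrE.
Qed.

Lemma gaussian_itg2 (s : R) f : 0 < s -> gaussian P s f -> itg2 f.
Proof. by move=> s0 gf; split; [exact: gf.1|exact: (itg_V2 s0 gf)]. Qed.

(** Where [k <= f < k + 1] the exponential is at most [expR (lam / 2 * (k + 1))]; summing against
    the tail leaves a geometric series of ratio [expR (- (lam / 2))], since only half of [lam] is
    spent. *)
Lemma tail_exp_moment f (C lam : R) : measurable_fun setT f -> (forall w, 0 <= f w) ->
  0 < lam -> 0 <= C ->
  (forall x, 0 <= x -> Pr P [set w | x <= f w] <= C * expR (- lam * x)) ->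
  itg P (fun w => expR (lam / 2 * f w)) /\
  Ex P (fun w => expR (lam / 2 * f w)) <= C * expR (lam / 2) / (1 - expR (- (lam / 2))).
Proof.
move=> mf f0 lam0 C0 tail; set mu := lam / 2.
have mu0 : 0 < mu by rewrite divr_gt0.
set K := _ / _.
have z1 : expR (- mu) < 1 by rewrite expR_lt1 oppr_lt0.
pose A (k : nat) := [set w | k%:R <= f w].
have mA k : measurable (A k).
  have := mf measurableT _ (measurable_itv `[k%:R, +oo[); rewrite setTI.
  by congr measurable; apply/seteqP; split => w /=; rewrite in_itv/= andbT.
have mexp : measurable_fun setT (fun w => expR (mu * f w)).
  by apply: measurableT_comp => //; exact: measurable_funM.
pose g (k : nat) (w : T) : \bar R := (expR (mu * k.+1%:R) * \1_(A k) w)%:E.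
have g0 k w : (0 <= g k w)%E by rewrite lee_fin mulr_ge0 ?expR_ge0.
have mg k : measurable_fun setT (g k).
  by apply/measurable_EFinP; apply: measurable_funM => //; exact: measurable_indic.
have ub : (\int[P]_w (expR (mu * f w))%:E <= K%:E)%E.
  apply: (@le_trans _ _ (\int[P]_w (\sum_(k <oo) g k w))%E).
    apply: ge0_le_integral => //.
    - exact/measurable_EFinP.
    - by apply: ge0_emeasurable_sum => // k w _ _; exact: g0.
    - move=> w _; have /Num.Theory.truncn_itv/andP[n1 n2] := f0 w.
      set n := Num.truncn (f w) in n1 n2.
      apply: (@le_trans _ _ (g n w)).
        rewrite lee_fin indicE mem_set// mulr1 ler_expR ler_wpM2l//; exact: ltW.
      rewrite -[leLHS](@big_nat1 _ _ +%E n (fun k => g k w)).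
      apply: (@le_trans _ _ (\sum_(0 <= k < n.+1) g k w)%E).
        by rewrite big_nat1 big_nat_recr//= leeDr// sume_ge0.
      exact: nneseries_lim_ge.
  rewrite integral_nneseries//.
  apply: lime_le; first by apply: is_cvg_nneseries => k _ _; exact: integral_ge0.
  apply: nearW => n.
  apply: (@le_trans _ _ (\sum_(0 <= k < n) (geometric (C * expR mu) (expR (- mu)) k)%:E)%E).
    apply: lee_sum => k _.
    rewrite /g; under eq_integral do rewrite EFinM.
    rewrite ge0_integralZl ?lee_fin ?expR_ge0//; last first.
      by apply/measurable_EFinP; exact: measurable_indic.
    rewrite (ExE (itg_ind P (mA k))) Ex_ind// -EFinM lee_fin /geometric/=.
    apply: (@le_trans _ _ (expR (mu * k.+1%:R) * (C * expR (- lam * k%:R)))).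
      by rewrite ler_wpM2l ?expR_ge0// tail.
    rewrite -expRM_natl mulrCA -[leRHS]mulrA ler_wpM2l// -!expRD ler_expR -natr1 /mu; lra.
  rewrite sumEFin lee_fin.
  have := @geometric_seriesE R (C * expR mu) (expR (- mu)).
  rewrite lt_eqF// => /(_ isT) /(congr1 (fun s => s n)) e.
  rewrite [leLHS](_ : _ = series (geometric (C * expR mu) (expR (- mu))) n)// e/=.
  rewrite /K; have z0 : 0 <= expR (- mu) ^+ n by rewrite exprn_ge0 ?expR_ge0.
  rewrite ler_wpM2r ?invr_ge0 ?subr_ge0 ?(ltW z1)//.
  by rewrite ler_piMr ?mulr_ge0 ?expR_ge0//; lra.
have i : itg P (fun w => expR (mu * f w)).
  apply/itgP; split => //; under eq_integral do rewrite ger0_norm ?expR_ge0//.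
  exact: le_lt_trans ub (ltry _).
by split => //; rewrite -lee_fin -ExE.
Qed.

(** [x ^+ 2 / 2 <= expR x] at [x = lam / 2 * |f|]; hence the factor [8 / lam ^+ 2]. *)
Lemma tail_itg2 f (C lam : R) : measurable_fun setT f ->
  0 < lam -> 0 <= C ->
  (forall x, 0 <= x -> Pr P [set w | x <= `|f w|] <= C * expR (- lam * x)) ->
  itg2 f /\ Ex P (fun w => f w ^+ 2) <=
   8 / lam ^+ 2 * (C * expR (lam / 2) / (1 - expR (- (lam / 2)))).
Proof.
move=> mf lam0 C0 tail.
have mf' : measurable_fun setT (fun w => `|f w|) by exact: measurableT_comp.
have [i ub] := tail_exp_moment mf' (fun w => normr_ge0 (f w)) lam0 C0 tail.
have h w : f w ^+ 2 <= 8 / lam ^+ 2 * expR (lam / 2 * `|f w|).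
  have x0 : 0 <= lam / 2 * `|f w| by rewrite mulr_ge0// divr_ge0// ltW.
  have := expR_ge1Dxn 1 x0; rewrite (_ : 2`! = 2)%N// => le.
  rewrite -(real_normK (num_real (f w))).
  have -> : `|f w| ^+ 2 = 8 / lam ^+ 2 * ((lam / 2 * `|f w|) ^+ 2 / 2).
    by field; rewrite gt_eqF.
  by rewrite ler_wpM2l ?divr_ge0 ?sqr_ge0//; lra.
have i2 : itg P (fun w => f w ^+ 2).
  apply: (itg_le (g := fun w => 8 / lam ^+ 2 * expR (lam / 2 * `|f w|))).
  - exact: measurable_funX.
  - by move=> w; rewrite ger0_norm ?sqr_ge0.
  - exact: itgZ.
split => //.
apply: (@le_trans _ _ (Ex P (fun w => 8 / lam ^+ 2 * expR (lam / 2 * `|f w|)))).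
  by apply: le_Ex => //; exact: itgZ.
by rewrite ExZ// ler_wpM2l// divr_ge0// sqr_ge0.
Qed.

End square_integrable.

Lemma P_indic {d} {T : measurableType d} {R : realType} (mu : measure T R) (A : set T) :
  measurable A -> mu A = (\int[mu]_w (\1_A w)%:E)%E.
Proof. by move=> mA; rewrite integral_indic// setIT. Qed.

Lemma measurable_ge {d} {T : measurableType d} {R : realType} (f : T -> R) (y : R) :
  measurable_fun setT f -> measurable [set w | y <= f w].
Proof.
move=> mf; have := mf measurableT _ (measurable_itv `[y, +oo[); rewrite setTI.
by congr measurable; apply/seteqP; split => w /=; rewrite in_itv/= andbT.
Qed.

Lemma law_ex {d} {T : measurableType d} {R : realType} (P : probability T R) (U : T -> R) :
  measurable_fun setT U -> exists mu : probability (measurableTypeR R) R,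
    forall A, measurable A -> P (U @^-1` A) = mu A.
Proof.
move=> mU; pose m := isMeasurableFun.Build _ _ T (measurableTypeR R) U mU.
pose X : {RV P >-> measurableTypeR R} := HB.pack U m.
by exists (distribution P X).
Qed.

(** A recursion that runs backwards in time: the value at [u] uses the value at [u + h] and the
    increment between, hence only increments after [u]. The Lindley recursion and the Euler scheme
    both have this form, so measurability, independence and invariance of the law under shifts are
    proved once. *)
Fixpoint chain {T : Type} {R : realType} (G : R * R -> R) (h : R) (B : R -> T -> R)
    (k : nat) (u : R) : T -> R :=
  match k with
  | 0%N => fun=> 0
  | k'.+1 => fun w => G (chain G h B k' (u + h) w, B (u + h) w - B u w)
  end.

Arguments chain : simpl never.

Lemma chainS {T : Type} {R : realType} (G : R * R -> R) (h : R) (B : R -> T -> R) k u w :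
  chain G h B k.+1 u w = G (chain G h B k (u + h) w, B (u + h) w - B u w).
Proof. by []. Qed.

Section chain.
Context {d : measure_display} {T : measurableType d} {R : realType}.
Variables (P : probability T R) (sigma : R) (s0 : 0 < sigma) (B : R -> T -> R).
Hypothesis hB : igi P sigma B.
Variables (G : R * R -> R) (h : R) (h0 : 0 < h).
Hypothesis mG : measurable_fun setT G.

Lemma chain_meas k u : meas_wrt (incgen B [set t | u <= t]) (chain G h B k u).
Proof.
elim: k u => [|k IH] u; first exact: meas_wrt_cst.
have uh : u <= u + h by rewrite lerDl ltW.
apply/meas_wrtE.
have m1 : meas_wrt (incgen B [set t | u <= t]) (chain G h B k (u + h)).
  apply: meas_wrtS (IH (u + h)) => A gA.
  have : incs B [set t | u + h <= t] A by exact: sub_gen_smallest.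
  by apply: incs_sub => t /=; exact: le_trans.
have m2 : meas_wrt (incgen B [set t | u <= t]) (fun w => B (u + h) w - B u w).
  by apply: incs_inc => /=.
move/meas_wrtE : m1 => m1; move/meas_wrtE : m2 => m2.
by apply: (measurableT_comp mG); apply/measurable_fun_pairP; split.
Qed.

Lemma incs_meas (I : set R) (f : T -> R) : meas_wrt (incgen B I) f -> measurable_fun setT f.
Proof.
move=> mf _ A mA; rewrite setTI.
exact: (incs_measurable (igi_meas hB) (mf A mA)).
Qed.

Lemma chain_mfun k u : measurable_fun setT (chain G h B k u).
Proof. exact: (incs_meas (@chain_meas k u)). Qed.

Lemma chain_indep (k : nat) (u : R) A C : measurable A -> measurable C ->
  P (chain G h B k (u + h) @^-1` A `&` (fun w => B (u + h) w - B u w) @^-1` C) =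
  (P (chain G h B k (u + h) @^-1` A) * normal_prob 0 (sigma * Num.sqrt h) C)%E.
Proof.
move=> mA mC; rewrite setIC (igi_indep hB (b := u + h)).
- have uh : u < u + h by rewrite ltrDl.
  have [_ ->//] := igi_law hB uh.
  by rewrite muleC; congr (_ * normal_prob 0 (_ * Num.sqrt _) C)%E; ring.
- by apply: incs_inc => //=; rewrite lerDl ltW.
- exact: chain_meas.
Qed.

(** By [chain_indep] the law is the image under [G] of the product of the law one step later and a
    normal law; by induction neither factor depends on the time. *)
Lemma chain_law k u u' A : measurable A ->
  P (chain G h B k u @^-1` A) = P (chain G h B k u' @^-1` A).
Proof.
elim: k u u' A => [//|k IH] u u' A mA.
have [mu muE] := law_ex P (chain_mfun k (u + h)).
pose nu : probability (measurableTypeR R) R := normal_prob 0 (sigma * Num.sqrt h).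
pose g (x : R * R) : \bar R := (\1_A (G x))%:E.
have mg : measurable_fun setT g.
  by apply/measurable_EFinP; apply: measurableT_comp => //; exact: measurable_indic.
have g0 x : (0 <= g x)%E by rewrite lee_fin.
have inc u1 : measurable_fun setT (fun w => B (u1 + h) w - B u1 w).
  by apply: measurable_funB; exact: igi_meas hB _.
have key u1 : P ((fun w => G (chain G h B k (u1 + h) w, B (u1 + h) w - B u1 w)) @^-1` A)
   = (\int[nu]_y \int[mu]_x g (x, y))%E.
  have mE : measurable ((fun w => G (chain G h B k (u1 + h) w, B (u1 + h) w - B u1 w)) @^-1` A).
    by have := @chain_mfun k.+1 u1 measurableT A mA; rewrite setTI.
  rewrite -(@indep_integral _ _ _ P _ _ mu nu g (chain_mfun k (u1 + h)) (inc u1) _ mg g0).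
    exact: P_indic.
  move=> C D mC mD; rewrite chain_indep//.
  by rewrite (IH _ (u + h))// muE.
by rewrite [LHS]key [RHS]key.
Qed.

End chain.

(* Lindley recursion: M -> max 0 (xi + M - th h) turns the maximum over k steps of the walk
   B (u + j h) - B u - th j h into the maximum over k + 1 steps. *)
Definition lindG {R : realType} (th h : R) (x : R * R) : R := Num.max 0 (x.1 + x.2 - th * h).

Lemma measurable_lindG {R : realType} (th h : R) : measurable_fun setT (lindG th h).
Proof.
apply: measurable_maxr => //; apply: measurable_funB => //.
exact: measurable_funD.
Qed.

Section lindley.
Context {d : measure_display} {T : measurableType d} {R : realType}.
Variables (P : probability T R) (sigma : R) (s0 : 0 < sigma) (B : R -> T -> R).
Hypothesis hB : igi P sigma B.
Variables (th : R) (th0 : 0 < th).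

Let lam := 2 * th / sigma ^+ 2.
Let lind (h : R) := chain (lindG th h) h B.

Lemma lind_ge0 h k u w : 0 <= lind h k u w.
Proof. by case: k => [|k]; rewrite // /lind chainS /lindG le_max lexx. Qed.

Lemma lind_ge h k u w j : (j <= k)%N -> B (u + j%:R * h) w - B u w - th * (j%:R * h) <= lind h k u w.
Proof.
elim: k j u => [|k IH] [|j] u //; rewrite ?mul0r ?addr0 ?subrr ?mulr0 ?subr0 ?lind_ge0// ltnS => jk.
have := IH j (u + h) jk => H.
rewrite /lind chainS /lindG/= le_max; apply/orP; right.
rewrite (_ : u + j.+1%:R * h = u + h + j%:R * h); last by rewrite -natr1; ring.
by move: H; rewrite -natr1 /lind; lra.
Qed.

Lemma lind_le h k u w S : 0 < h -> (forall r, 0 <= r -> B (u + r) w - B u w - th * r <= S) ->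
  lind h k u w <= S.
Proof.
move=> h0; elim: k u S => [|k IH] u S HS.
  by have := HS 0 (lexx _); rewrite addr0 mulr0 subrr subr0.
rewrite /lind chainS /lindG/= ge_max; apply/andP; split.
  by have := HS 0 (lexx _); rewrite addr0 mulr0 subrr subr0.
have := IH (u + h) (S - (B (u + h) w - B u w - th * h)).
rewrite -/(lind h k (u + h) w) => H.
suff : lind h k (u + h) w <= S - (B (u + h) w - B u w - th * h) by rewrite /lind; lra.
apply: H => r r0; have := HS (h + r); rewrite addrA => HSr.
have := HSr (addr_ge0 (ltW h0) r0); lra.
Qed.

Lemma lind_nd h k u w : lind h k u w <= lind h k.+1 u w.
Proof.
elim: k u => [|k IH] u; first exact: lind_ge0.
rewrite /lind chainS [leRHS]chainS /lindG/= ge_max; rewrite le_max lexx/= le_max; apply/orP; right.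
rewrite lerD2r lerD2r; exact: IH.
Qed.

(* exp(lam(xi - th h)) has mean one, so one step of the recursion preserves the bound. *)
Lemma lind_tail h k u x : 0 < h ->
  Pr P [set w | x <= lind h k u w] <= expR (- lam * x).
Proof.
move=> h0.
have mlind k' u' : measurable_fun setT (lind h k' u').
  by apply: (chain_mfun hB) => //; exact: measurable_lindG.
have lam0 : 0 < lam by rewrite divr_gt0 ?mulr_gt0 ?exprn_gt0.
have triv y : y <= 0 -> 1 <= expR (- lam * y).
  by move=> y0; rewrite -[leLHS]expR0 ler_expR mulNr -mulrN mulr_ge0 ?oppr_ge0// ltW.
elim: k u x => [|k IH] u x.
  have [x0|x0] := leP x 0.
    apply: le_trans (triv _ x0); rewrite (_ : [set _ | _] = setT) ?Pr_le1//.
    by apply/seteqP; split.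
  rewrite (_ : [set _ | _] = set0); first by rewrite /Pr measure0/= expR_ge0.
  by apply/seteqP; split.
have [x0|x0] := leP x 0.
  by apply: le_trans (triv _ x0); rewrite Pr_le1//; exact: measurable_ge.
have minc : measurable_fun setT (fun w => B (u + h) w - B u w).
  by apply: measurable_funB; exact: igi_meas hB _.
have [mu muE] := law_ex P (mlind k (u + h)).
pose nu : probability (measurableTypeR R) R := normal_prob 0 (sigma * Num.sqrt h).
pose A : set (R * R) := [set z | x <= z.1 + z.2 - th * h].
have mA : measurable A.
  have mf : measurable_fun setT (fun z : R * R => z.1 + z.2 - th * h).
    by apply: measurable_funB => //; exact: measurable_funD.
  have := mf measurableT _ (measurable_itv `[x, +oo[); rewrite setTI.
  by congr measurable; apply/seteqP; split => w /=; rewrite in_itv/= andbT.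
pose g (z : R * R) : \bar R := (\1_A z)%:E.
have mg : measurable_fun setT g by apply/measurable_EFinP; exact: measurable_indic.
have g0 z : (0 <= g z)%E by rewrite lee_fin.
have mge (y : R) : measurable [set z : R | y <= z].
  exact: (@measurable_ge _ _ _ (fun z : R => z) y (@measurable_id _ _ _)).
(* Since [x > 0], only the second argument of the maximum can reach [x]. *)
have e : P [set w | x <= lind h k.+1 u w] =
    (\int[P]_w g (lind h k (u + h) w, (B (u + h) w - B u w)%R))%E.
  rewrite P_indic; last exact: measurable_ge.
  apply: eq_integral => w _; rewrite /g !indicE; congr (nat_of_bool _)%:R%:E.
  apply/idP/idP; rewrite !in_setE/= /A/= /lind chainS /lindG/= le_max leNgt x0//=.
rewrite -lee_fin -PrE; last exact: measurable_ge.
rewrite e (indep_integral (mu := mu) (nu := nu) (mlind k (u + h)) minc)//; last first.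
  move=> C D mC mD; rewrite -muE//.
  by apply: (chain_indep hB) => //; exact: measurable_lindG.
apply: (@le_trans _ _ (\int[nu]_y (expR (- lam * (x + th * h)) * expR (lam * y))%:E)%E).
  apply: ge0_le_integral => //.
  - by move=> y _; exact: integral_ge0.
  - exact: (measurable_fun_fubini_tonelli_G (m1 := mu) g).
  - apply/measurable_EFinP; apply: measurable_funM => //; exact: measurableT_comp.
  - move=> y _.
    rewrite [leLHS](_ : _ = mu [set z | x + th * h - y <= z]); last first.
      rewrite P_indic; last exact: mge.
      apply: eq_integral => z _; rewrite /g !indicE; congr (nat_of_bool _)%:R%:E.
      by apply/idP/idP; rewrite !in_setE/= /A/=; lra.
    rewrite -muE; last exact: mge.
    rewrite -expRD (_ : _ @^-1` _ = [set w | x + th * h - y <= lind h k (u + h) w])//.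
    rewrite PrE; last exact: measurable_ge.
    rewrite lee_fin; apply: le_trans (IH _ _) _; rewrite ler_expR; lra.
have uh : u < u + h by rewrite ltrDl.
have gV := igi_law hB uh; rewrite (_ : u + h - u = h) in gV; last by ring.
have sh0 : 0 < sigma * Num.sqrt h by rewrite mulr_gt0// sqrtr_gt0.
have mexp : measurable_fun setT (fun y : R => (expR (- lam * (x + th * h)) * expR (lam * y))%:E).
  by apply/measurable_EFinP; apply: measurable_funM => //; exact: measurableT_comp.
rewrite -(integral_law (mu := nu) gV.1 gV.2 mexp); last first.
  by move=> y; rewrite lee_fin mulr_ge0// expR_ge0.
rewrite (ExE (itgZ _ (itg_exp sh0 gV lam))) ExZ; last exact: itg_exp gV _.
rewrite (Ex_exp sh0 gV) lee_fin -expRD ler_expR [(sigma * _) ^+ 2]exprMn sqr_sqrtr ?(ltW h0)//.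
by rewrite le_eqVlt; apply/orP; left; apply/eqP; rewrite /lam; field; rewrite gt_eqF.
Qed.

End lindley.

(* Only dyadic times are used, so that [Dev] is an event; by continuity its complement still controls
   all r >= 0 (lemma [Dev_path]). *)
Definition dev {T : Type} {R : realType} (B : R -> T -> R) (th u x : R) (n : nat) : set T :=
  [set w | exists j, (j <= n * 2 ^ n)%N /\
     x < B (u + j%:R * (2 ^- n)) w - B u w - th * (j%:R * (2 ^- n))].

Definition Dev {T : Type} {R : realType} (B : R -> T -> R) (th u x : R) : set T :=
  \bigcup_n dev B th u x n.

(** A single [n] fixes the mesh [2 ^- n] and the horizon [n]. Taking [n > r + e^-1] puts [r] below
    the horizon, and [n < 2 ^ n] makes the mesh finer than the radius [e] on which [f] exceeds
    [x]. *)
Lemma dyadic_witness {R : realType} (f : R -> R) (r x : R) : continuous f -> 0 <= r ->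
  x < f r -> exists n j, (j <= n * 2 ^ n)%N /\ x < f (j%:R * 2 ^- n).
Proof.
move=> cf r0 xf.
have /nbhs_ballP[e /= e0 eb] : \forall y \near r, x < f y by exact: cvgr_gt (cf r) _ xf.
have re : 0 <= r + e^-1 by rewrite addr_ge0// invr_ge0 ltW.
have /Num.Theory.truncn_itv/andP[_ n1] := re.
set n := (Num.truncn (r + e^-1)).+1 in n1.
have n2 : n%:R < 2 ^+ n :> R by rewrite -natrX ltr_nat ltn_expl.
have p0 : 0 < 2 ^+ n :> R by rewrite exprn_gt0.
have pe : 2 ^- n < e.
  rewrite -(invrK e) ltf_pV2 ?posrE ?invr_gt0//; apply: lt_trans n2; lra.
have rp0 : 0 <= r * 2 ^+ n by rewrite mulr_ge0// ltW.
have /Num.Theory.truncn_itv/andP[j1 j2] := rp0.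
set j := Num.truncn (r * 2 ^+ n) in j1 j2.
have ei0 : 0 < e^-1 by rewrite invr_gt0.
exists n, j; split.
  rewrite -(ler_nat R) natrM natrX; apply: le_trans j1 _.
  by rewrite ler_wpM2r// ?ltW//; lra.
apply: eb; rewrite /ball/= ltr_norml.
have e1 : j%:R * 2 ^- n <= r by rewrite ler_pdivrMr.
have e2 : r < (j%:R + 1) * 2 ^- n by rewrite ltr_pdivlMr// natr1.
by rewrite mulrDl mul1r in e2; apply/andP; split; lra.
Qed.

Lemma sigma0 {d} {T : measurableType d} (G : set (set T)) : <<s G >> set0.
Proof. by have := @measurable0 _ (g_sigma_algebraType G). Qed.

Section Doob.
Context {d : measure_display} {T : measurableType d} {R : realType}.
Variables (P : probability T R) (sigma : R) (s0 : 0 < sigma) (B : R -> T -> R).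
Hypothesis hB : igi P sigma B.
Implicit Types (th u x : R).

Lemma dev_meas_wrt th u x n : incs B [set t | u <= t] (dev B th u x n).
Proof.
rewrite (_ : dev _ _ _ _ _ = \bigcup_j (if (j <= n * 2 ^ n)%N then
    [set w | x + th * (j%:R * (2 ^- n)) < B (u + j%:R * (2 ^- n)) w - B u w] else set0)).
  apply: sigma_bigcup => j; case: ifP => _; last exact: sigma0.
  apply: sigma_gt; apply: incs_inc => //=.
  by rewrite lerDl mulr_ge0// invr_ge0 exprn_ge0.
apply/seteqP; split => w.
  by move=> [j [jn h]]; exists j => //; rewrite jn/=; lra.
by move=> [j _]; case: ifP => //= jn h; exists j; split => //; lra.
Qed.

Lemma Dev_meas_wrt th u x : incs B [set t | u <= t] (Dev B th u x).
Proof. by apply: sigma_bigcup => n; exact: dev_meas_wrt. Qed.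

Lemma dev_measurable th u x n : measurable (dev B th u x n).
Proof. exact: (incs_measurable (igi_meas hB) (@dev_meas_wrt th u x n)). Qed.

Lemma Dev_measurable th u x : measurable (Dev B th u x).
Proof. exact: (incs_measurable (igi_meas hB) (@Dev_meas_wrt th u x)). Qed.

Lemma dev_nd th u x : nondecreasing_seq (dev B th u x).
Proof.
apply/nondecreasing_seqP => n; apply/subsetPset => w [j [jn h]].
exists (j * 2)%N; split.
  by rewrite expnS mulnCA mulnC leq_mul2l/= (leq_trans jn)// leq_mul2r leqnSn orbT.
suff -> : (j * 2)%:R * (2 ^- n.+1) = j%:R * (2 ^- n) :> R by [].
by rewrite natrM exprS invfM mulrA mulfK.
Qed.

(** At dyadic level [n] the event is contained in a tail event of the Lindley recursion with step
    [2 ^- n], whose bound does not involve the step; the levels increase, so continuity from below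
    passes to the union. *)
Lemma Dev_tail th u x : 0 < th -> Pr P (Dev B th u x) <= expR (- (2 * th / sigma ^+ 2) * x).
Proof.
move=> th0; rewrite -lee_fin -PrE; last exact: Dev_measurable.
have := @nondecreasing_cvg_mu _ _ _ P _ (dev_measurable th u x) (Dev_measurable th u x) (dev_nd th u x).
move/cvg_lim => <-//; apply: lime_le.
  by apply/cvg_ex; eexists; apply: nondecreasing_cvg_mu;
   [exact: dev_measurable|exact: Dev_measurable|exact: dev_nd].
apply: nearW => n /=; rewrite PrE; last exact: dev_measurable.
have p0 : 0 < (2 ^- n : R) by rewrite invr_gt0 exprn_gt0.
rewrite lee_fin; apply: le_trans (lind_tail s0 hB th0 (n * 2 ^ n) u x p0).
apply: le_Pr; first exact: dev_measurable.
  by apply: measurable_ge; apply: (chain_mfun hB) => //; exact: measurable_lindG.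
by move=> w [j [jn /ltW h]]; apply: le_trans h _; exact: lind_ge.
Qed.

Lemma Dev_path th u x w : continuous (fun t => B t w) -> ~ Dev B th u x w ->
  forall r, 0 <= r -> B (u + r) w - B u w - th * r <= x.
Proof.
move=> cw nD r r0; rewrite leNgt; apply/negP => h; apply: nD.
have cf : continuous (fun r => B (u + r) w - B u w - th * r).
  move=> y; apply: cvgB; last by apply: cvgM; [exact: cvg_cst|exact: cvg_id].
  apply: cvgB; last exact: cvg_cst.
  apply: (@continuous_comp _ _ _ (fun y => u + y) (fun t => B t w)); last exact: cw.
  by apply: cvgD; [exact: cvg_cst|exact: cvg_id].
by have [n [j [jn hj]]] := dyadic_witness cf r0 h; exists n => //; exists j.
Qed.

End Doob.

(** * Solutions and envelopes of a fixed path *)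


Lemma first_zero {R : realType} (f : R -> R) (p q : R) : continuous f -> p <= q ->
  0 < f p -> f q <= 0 ->
  exists s, [/\ p < s <= q, f s = 0 & forall r, p <= r < s -> 0 < f r].
Proof.
move=> cf pq fp fq.
pose S := [set r | p <= r <= q /\ forall r', p <= r' <= r -> 0 < f r'].
have Sp : S p.
  by split; [rewrite lexx pq|move=> r' /andP[h1 h2]; rewrite (_ : r' = p)//; apply/le_anti/andP].
have Sub : ubound S q by move=> r [/andP[]].
have Sh : has_sup S by split; [exists p|exists q].
set s := sup S.
have ps : p <= s by exact: sup_upper_bound.
have sq : s <= q by apply: ge_sup => //; exists p.
have below r : p <= r < s -> 0 < f r.
  move=> /andP[pr rs].
  have sr0 : 0 < s - r by rewrite subr_gt0.
  have [e [_ eS] re] := sup_adherent sr0 Sh.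
  by apply: eS; rewrite pr/=; rewrite -/s in re; lra.
have fs0 : f s <= 0.
  rewrite leNgt; apply/negP => fs.
  have /nbhs_ballP[e /= e0 eb] : \forall y \near s, 0 < f y by exact: cvgr_gt (cf s) _ fs.
  have sq' : s < q by rewrite lt_neqAle sq andbT; apply/eqP => sqE; move: fq; rewrite -sqE leNgt fs.
  pose r := Num.min q (s + e / 2).
  have sr : s < r by rewrite lt_min sq' ltrDl divr_gt0.
  suff /(sup_upper_bound Sh) : S r by rewrite -/s leNgt sr.
  split; first by rewrite ge_min lexx/= (le_trans ps (ltW sr)).
  move=> r' /andP[pr' r'r]; have [r's|sr'] := ltP r' s; first by apply: below; rewrite pr'.
  apply: eb; rewrite /ball/= distrC ger0_norm ?subr_ge0//.
  by move: r'r; rewrite le_min => /andP[_]; lra.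
have ps' : p < s.
  by rewrite lt_neqAle ps andbT; apply/eqP => sE; move: fs0; rewrite -sE leNgt fp.
exists s; split => //; first by rewrite ps' sq.
apply/le_anti; rewrite fs0/= leNgt; apply/negP => fs.
have /nbhs_ballP[e /= e0 eb] : \forall y \near s, f y < 0 by exact: cvgr_lt (cf s) _ fs.
pose r := Num.max p (s - e / 2).
have rs : r < s by rewrite gt_max ps'/= ltrBlDr ltrDl divr_gt0.
have pr : p <= r by rewrite le_max lexx.
have h1 : 0 < f r by apply: below; rewrite pr.
have : f r < 0.
  apply: eb; rewrite /ball/= ger0_norm ?subr_ge0 ?(ltW rs)//.
  have : s - e / 2 <= r by rewrite le_max lexx orbT.
  lra.
by rewrite ltNge (ltW h1).
Qed.

(** [lipschitz] speaks of all sufficiently large constants; the estimates use one explicit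
    nonnegative constant. *)
Definition bsol {R : realType} (beta : R) (b x : R -> R) : Prop :=
  [/\ exists2 K, 0 <= K & forall s t, `|x s - x t| <= K * `|s - t|,
      (forall t : R, x t < b t -> is_derive t 1 x (- beta)) &
      (forall t : R, b t < x t -> is_derive t 1 x beta)].

Lemma bsolP {R : realType} (beta : R) (b x : R -> R) :
  bifurcation_solution beta b x -> bsol beta b x.
Proof.
move=> [lx h1 h2]; split => //.
move: lx => [M [Mr lx]].
exists (Num.max 0 (M + 1)); first by rewrite le_max lexx.
move=> s t.
have M1 : M < Num.max 0 (M + 1) by rewrite lt_max ltrDl ltr01 orbT.
exact: (lx _ M1 (s, t) (conj I I)).
Qed.

Lemma lip_continuous {R : realType} (x : R -> R) (K : R) :
  (forall s t, `|x s - x t| <= K * `|s - t|) -> continuous x.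
Proof.
move=> lx t; apply/cvgrPdist_le => /= e e0.
have K0 : 0 < `|K| + 1 by rewrite ltr_wpDl.
exists (e / (`|K| + 1)); first by rewrite /= divr_gt0.
move=> s /= /ltW; rewrite ler_pdivlMr// => h.
apply: le_trans (lx t s) _; apply: le_trans h; rewrite mulrC ler_wpM2l//.
by rewrite (le_trans (ler_norm K))// lerDl.
Qed.

Section solutions.
Context {R : realType}.
Variables (beta : R) (beta0 : 0 < beta).
Implicit Types b x z : R -> R.

Lemma bsol_cont b x : bsol beta b x -> continuous x.
Proof. by move=> [[K _ lx] _ _]; exact: lip_continuous lx. Qed.

Lemma bsolN b x : bsol beta b x -> bsol beta (fun t => - b t) (fun t => - x t).
Proof.
move=> [[K K0 lx] h1 h2]; split.
- by exists K => // s t; rewrite -opprD normrN.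
- by move=> t; rewrite ltrN2 => /h2 h; apply: is_deriveN.
- move=> t; rewrite ltrN2 => /h1 h; rewrite -(opprK beta).
  exact: is_deriveN.
Qed.

Lemma above_line b x p q : bsol beta b x -> p <= q ->
  (forall s, p < s < q -> b s < x s) -> x q = x p + beta * (q - p).
Proof.
move=> sx pq h.
have [c _ e] : exists2 c, c \in `[p, q] & x q - x p = cst beta c * (q - p).
  apply: MVT_segment => //.
    by move=> s; rewrite in_itv/= => /h; case: sx => _ _; exact.
  by apply: continuous_subspaceT; exact: bsol_cont sx.
by rewrite /cst in e; lra.
Qed.

(** At a first return to [b] the solution would still be on the line of slope [beta] through
    [(p, x p)], which lies strictly above [b]. *)
Lemma escape_up b x p q : continuous b -> bsol beta b x -> b p < x p -> p <= q ->
  (forall s, p <= s <= q -> b s < x p + beta * (s - p)) ->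
  x q = x p + beta * (q - p).
Proof.
move=> cb sx xp pq h.
apply: (above_line sx pq) => s /andP[ps sq].
rewrite ltNge; apply/negP => xs.
have cf : continuous (fun t => x t - b t).
  by move=> t; apply: cvgB; [exact: (bsol_cont sx)|exact: cb].
have [||s' [/andP[ps' s's] e pos]] := first_zero cf (ltW ps); [lra|lra|].
have : x s' = x p + beta * (s' - p).
  apply: (above_line sx (ltW ps')) => r /andP[pr rs'].
  by have := pos r; rewrite (ltW pr) rs' => /(_ isT); lra.
have := h s'; rewrite (ltW ps') (le_trans s's (ltW sq)) => /(_ isT); lra.
Qed.

(** Without contact the solution stays on one side by continuity, and so is a line of slope [beta]
    or [- beta]. *)
Lemma noncontact_slope b x p q : continuous b -> bsol beta b x -> p <= q ->
  (forall s, p <= s <= q -> x s != b s) -> `|x q - x p| <= beta * (q - p).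
Proof.
move=> cb.
have main b' x' : continuous b' -> bsol beta b' x' -> p <= q ->
    (forall s, p <= s <= q -> x' s != b' s) -> b' p < x' p -> x' q - x' p = beta * (q - p).
  move=> cb' sx pq nz xp.
  rewrite (above_line sx pq); first by lra.
  move=> s /andP[ps sq]; rewrite ltNge; apply/negP => xs.
  have cf : continuous (fun t => x' t - b' t).
    by move=> t; apply: cvgB; [exact: (bsol_cont sx)|exact: cb'].
  have [||s' [/andP[ps' s's] e _]] := first_zero cf (ltW ps); [lra|lra|].
  have := nz s'; rewrite (ltW ps') (le_trans s's (ltW sq)) => /(_ isT) /eqP; apply; lra.
move=> sx pq nz.
have qp0 : 0 <= beta * (q - p) by rewrite mulr_ge0 ?subr_ge0// ltW.
have [xb|bx|e] := ltgtP (x p) (b p).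
- have cbN : continuous (fun t => - b t) by move=> t; apply: cvgN; exact: cb.
  have nzN s : p <= s <= q -> - x s != - b s by rewrite eqr_opp; exact: nz.
  have xbN : - b p < - x p by rewrite ltrN2.
  have e := main _ _ cbN (bsolN sx) pq nzN xbN.
  by rewrite -normrN ger0_norm; lra.
- by have e := main _ _ cb sx pq nz bx; rewrite ger0_norm; lra.
- by have := nz p; rewrite lexx pq => /(_ isT); rewrite e eqxx.
Qed.

(* Above a line of slope [beta] that dominates [b], a solution would never return to [b]. *)
Lemma Xstar_le b x t c : continuous b -> bsol beta b x ->
  (forall M : R, exists2 t, M < t & x t = b t) ->
  (forall r, 0 <= r -> b (t + r) <= c + beta * r) -> x t <= c.
Proof.
move=> cb sx ret hc; rewrite leNgt; apply/negP => cx.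
have [q tq xq] := ret t.
have h s : t <= s <= q -> b s < x t + beta * (s - t).
  move=> /andP[ts _]; have := hc (s - t); rewrite subr_ge0 => /(_ ts).
  by rewrite addrC subrK; lra.
have bt : b t < x t by have := h t; rewrite lexx (ltW tq) => /(_ isT); lra.
have := escape_up cb sx bt (ltW tq) h.
have := h q; rewrite lexx (ltW tq) => /(_ isT); lra.
Qed.

Lemma Xstar_ge b x t c : continuous b -> bsol beta b x ->
  (forall M : R, exists2 t, M < t & x t = b t) ->
  (forall r, 0 <= r -> c - beta * r <= b (t + r)) -> c <= x t.
Proof.
move=> cb sx ret hc; rewrite -lerN2.
apply: (@Xstar_le (fun t => - b t) (fun t => - x t)).
- by move=> s; apply: cvgN; exact: cb.
- exact: bsolN.
- by move=> M; have [s Ms e] := ret M; exists s => //; rewrite e.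
- by move=> r r0; have := hc r r0; lra.
Qed.

Lemma lipP z : beta.-lipschitz z <-> forall s t, `|z s - z t| <= beta * `|s - t|.
Proof.
split; first by move=> h s t; exact: (h (s, t) (conj I I)).
by move=> h [s t] _; exact: h.
Qed.

Lemma Zplus_ge b z : is_Zplus beta b z -> forall s t, b s - beta * `|s - t| <= z t.
Proof.
move=> [[/lipP lz bz] _] s t; have := lz s t; have := bz s.
by rewrite ler_norml => h1 /andP[h2 h3]; lra.
Qed.

(** The minimum of [z] with the cone [c + beta * |r - t|] is again a Lipschitz majorant, so
    minimality of [z] gives [z t <= c]. With [Zplus_ge] this identifies [z t] as the supremum of
    [b s - beta * |s - t|]. *)
Lemma Zplus_le b z t c : is_Zplus beta b z -> (forall s, b s - beta * `|s - t| <= c) -> z t <= c.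
Proof.
move=> [[/lipP lz bz] least] hc.
pose y r := Num.min (z r) (c + beta * `|r - t|).
suff /least/(_ t) : lipschitz_majorant beta b y.
  by rewrite /y subrr normr0 mulr0 addr0 le_min => /andP[].
split.
- apply/lipP => s r.
  have h1 : `|(c + beta * `|s - t|) - (c + beta * `|r - t|)| <= beta * `|s - r|.
    rewrite (_ : _ - _ = beta * (`|s - t| - `|r - t|)); last by ring.
    rewrite normrM (gtr0_norm beta0) ler_wpM2l ?(ltW beta0)//.
    by apply: le_trans (ler_dist_dist _ _) _; rewrite (_ : s - t - (r - t) = s - r)//; ring.
  have := lz s r; move: h1; rewrite !ler_norml /y => /andP[h1 h2] /andP[h3 h4].
  by case: (leP (z s) (c + beta * `|s - t|)) => h5;
     case: (leP (z r) (c + beta * `|r - t|)) => h6; apply/andP; split; lra.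
- move=> s; rewrite /y le_min bz/=; have := hc s; lra.
Qed.

Lemma ZplusN b z : is_Zminus beta b z -> is_Zplus beta (fun t => - b t) (fun t => - z t).
Proof.
move=> [[/lipP lz bz] most]; split.
  split; last by move=> t; rewrite lerN2.
  by apply/lipP => s t; rewrite -opprD normrN.
move=> y [/lipP ly by_] t; rewrite -lerN2 opprK; apply: (most (fun t => - y t)).
split; last by move=> s; have := by_ s; lra.
by apply/lipP => s r; rewrite -opprD normrN.
Qed.

Lemma Xstar_le_Zplus b x z : continuous b -> bsol beta b x ->
  (forall M : R, exists2 t, M < t & x t = b t) -> is_Zplus beta b z ->
  forall t, x t <= z t.
Proof.
move=> cb sx ret hz t; apply: (Xstar_le cb sx ret) => r r0.
by have := Zplus_ge hz (t + r) t; rewrite (_ : t + r - t = r) ?ger0_norm//; [lra|ring].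
Qed.

Lemma Zminus_le_Xstar b x z : continuous b -> bsol beta b x ->
  (forall M : R, exists2 t, M < t & x t = b t) -> is_Zminus beta b z ->
  forall t, z t <= x t.
Proof.
move=> cb sx ret /ZplusN hz t; apply: (Xstar_ge cb sx ret) => r r0.
by have := Zplus_ge hz (t + r) t; rewrite (_ : t + r - t = r) ?ger0_norm//; [lra|ring].
Qed.

Lemma Zdiff_le b zp zm t c : is_Zplus beta b zp -> is_Zminus beta b zm ->
  (forall s u, b s - b u - beta * `|s - t| - beta * `|u - t| <= c) -> zp t - zm t <= c.
Proof.
move=> hp /ZplusN hm h.
suff : - zm t <= c - zp t by lra.
apply: (Zplus_le hm) => u.
suff : zp t <= c + b u + beta * `|u - t| by lra.
by apply: (Zplus_le hp) => s; have := h s u; lra.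
Qed.

End solutions.

(** * Solutions are almost surely beta-Lipschitz *)


Lemma heine_segment {R : realType} (b : R -> R) (a c e : R) : continuous b -> 0 < e ->
  exists2 h, 0 < h & forall s t, a <= s <= c -> a <= t <= c -> `|s - t| <= h ->
    `|b s - b t| <= e.
Proof.
move=> cb e0; have [ac|ca] := leP a c; last first.
  by exists 1 => // s t /andP[h1 h2]; lra.
pose ok r h := 0 < h /\ forall s t, a <= s <= r -> a <= t <= r -> `|s - t| <= h ->
  `|b s - b t| <= e.
pose S := [set r | a <= r <= c /\ exists h, ok r h].
have Sa : S a.
  split; first by rewrite lexx.
  exists 1; split => // s t /andP[h1 h2] /andP[h3 h4] _.
  by rewrite (_ : s = t) ?subrr ?normr0 ?ltW//; lra.
have Sh : has_sup S by split; [exists a|exists c => r [/andP[]]].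
set m := sup S.
have am : a <= m by exact: sup_upper_bound.
have mc : m <= c by apply: ge_sup; [exists a|move=> r [/andP[]]].
have e2 : 0 < e / 2 by rewrite divr_gt0.
have /cvgrPdist_le/(_ _ e2)/nbhs_ballP[dl /= dl0 H] := cb m.
have dl2 : 0 < dl / 2 by rewrite divr_gt0.
have [r [/andP[ar rc] [h [h0 hr]]] mr] := sup_adherent dl2 Sh; rewrite -/m in mr.
have rm : r <= m by apply: sup_upper_bound => //; split; [rewrite ar|exists h].
have nearm s : m - dl < s -> s < m + dl -> `|b m - b s| <= e / 2.
  by move=> h1 h2; apply: H; rewrite /ball/= ltr_norml; apply/andP; split; lra.
have mid s t : `|b m - b s| <= e / 2 -> `|b m - b t| <= e / 2 -> `|b s - b t| <= e.
  move=> h1 h2; rewrite (_ : b s - b t = b m - b t - (b m - b s)); last by ring.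
  by apply: le_trans (ler_normB _ _) _; rewrite [leRHS]splitr lerD.
pose r' := Num.min c (m + dl / 4).
have r'c : r' <= c by rewrite ge_min lexx.
have r'm : r' <= m + dl / 4 by rewrite ge_min lexx orbT.
pose h' := Num.min h (dl / 4).
have h'h : h' <= h by rewrite ge_min lexx.
have h'd : h' <= dl / 4 by rewrite ge_min lexx orbT.
have ok' : ok r' h'.
  split; first by rewrite lt_min h0/= divr_gt0.
  move=> s t /andP[as_ sr] /andP[at_ tr] st.
  have [sr'|rs] := leP s r; have [tr'|rt] := leP t r.
  - by apply: hr; rewrite ?as_ ?at_//; lra.
  - have st' : -h' <= s - t <= h' by rewrite -ler_norml.
    by apply: mid; apply: nearm; clear - as_ sr at_ tr mr mc r'm h'd dl0 sr' rt st'; lra.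
  - have st' : -h' <= s - t <= h' by rewrite -ler_norml.
    by apply: mid; apply: nearm; clear - as_ sr at_ tr mr mc r'm h'd dl0 rs tr' st'; lra.
  - by apply: mid; apply: nearm; clear - as_ sr at_ tr mr mc r'm h'd dl0 rs rt; lra.
have mr' : m <= r' by rewrite le_min mc/=; lra.
have Sr' : S r' by split; [rewrite (le_trans am mr')|exists h'].
have r'E : r' = c.
  have := sup_upper_bound Sh Sr'; rewrite -/m /r'; case: (leP c (m + dl / 4)) => //; lra.
by rewrite -r'E; exists h'; have [] := ok'.
Qed.

Section sums.
Context {d : measure_display} {T : measurableType d} {R : realType}.
Variable P : probability T R.

Lemma Ex_sum (I : Type) (r : seq I) (f : I -> T -> R) : (forall i, itg P (f i)) ->
  itg P (fun w => \sum_(i <- r) f i w) /\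
  Ex P (fun w => \sum_(i <- r) f i w) = \sum_(i <- r) Ex P (f i).
Proof.
move=> fi; elim: r => [|i r [IH1 IH2]].
  rewrite big_nil; under eq_fun do rewrite big_nil.
  by split; [exact: itg_cst|exact: Ex_cst].
rewrite big_cons; under eq_fun do rewrite big_cons.
by split; [exact: itgD|rewrite ExD// IH2].
Qed.

Lemma markov_Ex (f : T -> R) (a : R) : itg P f -> (forall w, 0 <= f w) ->
  a * Pr P [set w | a <= f w] <= Ex P f.
Proof.
move=> fi f0.
have mA : measurable [set w | a <= f w] by apply: measurable_ge; exact: itg_mf fi.
rewrite -Ex_ind// -ExZ; last exact: itg_ind.
apply: le_Ex => //; first by apply: itgZ; exact: itg_ind.
move=> w; rewrite indicE; case: (boolP (w \in _)) => [|_]; last by rewrite mulr0.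
by rewrite inE/= mulr1.
Qed.

Lemma ae_count (I : countType) (Q : I -> T -> Prop) :
  (forall i, {ae P, forall w, Q i w}) -> {ae P, forall w i, Q i w}.
Proof.
move=> h.
pose Q' (n : nat) w := match unpickle n with Some i => Q i w | None => True end.
have : {ae P, forall w n, Q' n w}.
  apply: ae_foralln => n; rewrite /Q'; case: unpickle => [i|]; first exact: h.
  exact: aeW.
by apply: filterS => w H i; have := H (pickle i); rewrite /Q' pickleK.
Qed.

Lemma ae_small (E : set T) : measurable E -> (forall e, 0 < e -> Pr P E <= e) ->
  {ae P, forall w, ~ E w}.
Proof.
move=> mE h; exists E; split => //.
  rewrite (PrE P mE); congr EFin; apply/le_anti; rewrite Pr_ge0 andbT.
  by apply/ler_addgt0Pl => e e0; rewrite addr0 h.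
by move=> w /=; rewrite not_notE.
Qed.

End sums.

Section contact.
Context {R : realType}.
Variables (beta : R) (beta0 : 0 < beta) (b x : R -> R) (K : R).
Hypotheses (cb : continuous b) (sx : bsol beta b x) (K0 : 0 < K)
  (lx : forall s t, `|x s - x t| <= K * `|s - t|).
Variables (a L : R) (L0 : 0 < L) (i j : nat).

(** Two scales: [2 ^ j] windows of length [L / 2 ^+ j], each cut into [2 ^ i] cells of length [h];
    cell [k] of window [W] starts at [tt W k]. *)
Let h := L / 2 ^+ (i + j).
Let G := (2 ^ i)%N.
Let tt (W k : nat) := a + (W * G + k)%:R * h.
Let contact (W k : nat) := `[< exists2 s, tt W k <= s <= tt W k.+1 & x s = b s >].

Lemma ttS W k : tt W k.+1 = tt W k + h.
Proof. by rewrite /tt addnS -natr1; ring. Qed.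

Let h_gt0 : 0 < h. Proof. by rewrite divr_gt0// exprn_gt0. Qed.

(** A cell without contact contributes at most [beta * h] to the telescoping sum, a cell with
    contact at most [K * h]. *)
Lemma contact_sum : x (a + L) - x a <=
  beta * L + K * h * \sum_(W < 2 ^ j) \sum_(k < G) (contact W k)%:R.
Proof.
have step W k : x (tt W k.+1) - x (tt W k) <= beta * h + K * h * (contact W k)%:R.
  have tle : tt W k <= tt W k.+1 by rewrite ttS lerDl ltW.
  have bh : 0 <= beta * h by rewrite mulr_ge0// ltW.
  case: (boolP (contact W k)) => [_|/negP H].
    have := lx (tt W k.+1) (tt W k); rewrite ttS (_ : tt W k + h - tt W k = h); last by ring.
    by rewrite ler_norml (gtr0_norm h_gt0) mulr1 => /andP[_]; lra.
  have := noncontact_slope beta0 cb sx tle; rewrite (_ : tt W k.+1 - tt W k = h); last by rewrite ttS; ring.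
  have nz s : tt W k <= s <= tt W k.+1 -> x s != b s.
    by move=> hs; apply/eqP => e; apply: H; apply/asboolP; exists s.
  by move=> /(_ nz); rewrite ler_norml mulr0 => /andP[_]; lra.
have tel : x (a + L) - x a = \sum_(W < 2 ^ j) \sum_(k < G) (x (tt W k.+1) - x (tt W k)).
  have inner W : \sum_(k < G) (x (tt W k.+1) - x (tt W k)) = x (tt W.+1 0) - x (tt W 0).
    rewrite -(big_mkord xpredT (fun k => x (tt W k.+1) - x (tt W k))) telescope_sumr//.
    by congr (x _ - _); rewrite /tt mulSn addn0 (addnC (2 ^ i)%N).
  under eq_bigr do rewrite inner.
  rewrite -(big_mkord xpredT (fun W => x (tt W.+1 0) - x (tt W 0))) telescope_sumr//.
  rewrite /tt !addn0 mul0n mul0r addr0; congr (x _ - _); congr (_ + _).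
  by rewrite /h /G natrM !natrX exprD; field; rewrite !expf_neq0.
rewrite tel.
apply: (@le_trans _ _ (\sum_(W < 2 ^ j) \sum_(k < G) (beta * h + K * h * (contact W k)%:R))).
  by apply: ler_sum => W _; apply: ler_sum => k _; exact: step.
under eq_bigr do rewrite big_split/= sumr_const card_ord -mulr_sumr.
rewrite big_split/= sumr_const card_ord -mulr_sumr lerD2r.
rewrite -mulrnA -mulr_natr natrM /G !natrX /h exprD.
by rewrite le_eqVlt; apply/orP; left; apply/eqP; field; rewrite !expf_neq0.
Qed.

(** Between two contacts in one window [b] moves as [x] does, by at most [K] times the window
    length; passing from the contacts to the left ends of their cells costs half of that twice, by
    the oscillation hypothesis. *)
Lemma contact_pair W k k' : (W < 2 ^ j)%N -> (k < G)%N -> (k' < G)%N ->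
  (forall s t, a <= s <= a + L -> a <= t <= a + L -> `|s - t| <= h ->
    `|b s - b t| <= K * (L / 2 ^+ j) / 2) ->
  contact W k -> contact W k' ->
  `|b (tt W k) - b (tt W k')| <= 2 * K * (L / 2 ^+ j).
Proof.
move=> Wj kG k'G osc /asboolP[s hs es] /asboolP[s' hs' es'].
have GhE : G%:R * h = L / 2 ^+ j.
  by rewrite /G /h natrX exprD; field; rewrite !expf_neq0.
have base : a <= tt W 0 by rewrite /tt lerDl mulr_ge0 ?(ltW h_gt0).
have top : tt W 0 + L / 2 ^+ j <= a + L.
  rewrite -GhE /tt addn0 -addrA lerD2l -mulrDl -natrD addnC -mulSn.
  have -> : L = (2 ^ j * G)%:R * h by rewrite natrM -mulrA GhE natrX; field; rewrite expf_neq0.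
  by rewrite ler_wpM2r ?(ltW h_gt0)// ler_nat leq_mul2r Wj orbT.
have loc k0 : (k0 < G)%N -> tt W 0 <= tt W k0 /\ tt W k0.+1 <= tt W 0 + L / 2 ^+ j.
  move=> k0G; rewrite -GhE /tt addn0 !natrD !mulrDl; split.
    by rewrite addrA lerDl mulr_ge0// ltW.
  by rewrite addrA lerD2l ler_wpM2r ?(ltW h_gt0)// ler_nat.
have [l1 l2] := loc _ kG; have [l1' l2'] := loc _ k'G.
move: (ttS W k) (ttS W k') => e1 e2.
move/andP: hs => [hs1 hs2]; move/andP: hs' => [hs1' hs2'].
have o1 : `|b (tt W k) - b s| <= K * (L / 2 ^+ j) / 2.
  by apply: osc; rewrite ?ler_norml; apply/andP; split; lra.
have o2 : `|b s' - b (tt W k')| <= K * (L / 2 ^+ j) / 2.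
  by apply: osc; rewrite ?ler_norml; apply/andP; split; lra.
have o3 : `|b s - b s'| <= K * (L / 2 ^+ j).
  rewrite -es -es'; apply: le_trans (lx s s') _; rewrite ler_wpM2l ?(ltW K0)//.
  by rewrite ler_norml; apply/andP; split; lra.
rewrite (_ : b (tt W k) - b (tt W k') = (b (tt W k) - b s) + (b s - b s') + (b s' - b (tt W k'))); last by ring.
apply: le_trans (ler_normD _ _) _; apply: le_trans (lerD (ler_normD _ _) (lexx _)) _; lra.
Qed.

(** Cauchy-Schwarz over the windows in tangent form: [f ^+ 2 >= 2 * l * f - l ^+ 2], with [l] the
    assumed lower bound for the average number of contact cells per window. *)
Lemma contact_square (rho : R) : 0 <= rho ->
  rho * 2 ^+ (i + j) <= \sum_(W < 2 ^ j) \sum_(k < G) (contact W k)%:R ->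
  rho ^+ 2 * 2 ^+ j * (2 ^+ i) ^+ 2 <=
  \sum_(W < 2 ^ j) \sum_(k < G) \sum_(k' < G) ((contact W k) && (contact W k'))%:R.
Proof.
move=> rho0 hN.
pose f (W : nat) : R := \sum_(k < G) (contact W k)%:R.
have fE W : \sum_(k < G) \sum_(k' < G) ((contact W k) && (contact W k'))%:R = f W ^+ 2.
  rewrite expr2 /f mulr_suml; apply: eq_bigr => k _.
  rewrite mulr_sumr; apply: eq_bigr => k' _.
  by rewrite -natrM mulnb.
under eq_bigr do rewrite fE.
set l := rho * 2 ^+ i.
have l0 : 0 <= l by rewrite mulr_ge0// exprn_ge0.
apply: (@le_trans _ _ (\sum_(W < 2 ^ j) (2 * l * f W - l ^+ 2))); last first.
  by apply: ler_sum => W _; have := sqr_ge0 (f W - l); nra.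
rewrite sumrB -mulr_sumr sumr_const card_ord.
have : 2 * l * (rho * 2 ^+ (i + j)) <= 2 * l * \sum_(W < 2 ^ j) f W.
  by rewrite ler_wpM2l// mulr_ge0.
rewrite -(mulr_natr (l ^+ 2)) natrX /l exprD.
lra.
Qed.

End contact.

Lemma near_count {R : realType} (G D k : nat) : (0 < D)%N ->
  \sum_(k' < G) ((k < k' + D)%N && (k' < k + D)%N)%:R <= 2 * D%:R :> R.
Proof.
(* The minima count the indices below [G] that lie before the left and the right end of the range
   around [k]; with them the bound goes through by induction on [G]. *)
move=> D0; suff H : (\sum_(k' < G) ((k < k' + D) && (k' < k + D)) + minn G (k.+1 - D) <= minn G (k + D))%N.
  rewrite -natr_sum -natrM ler_nat.
  have h1 : (minn G (k + D) <= 2 * D + minn G (k.+1 - D))%N by lia.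
  by have := leq_trans H h1; rewrite leq_add2r.
elim: G => [|G IH]; first by rewrite big_ord0 !min0n.
rewrite big_ord_recr/=; move: IH; set s := (\sum_(i < G) _)%N; clearbody s => IH.
by case: (ltnP k (G + D)) => h1; case: (ltnP G (k + D)) => h2 /=; lia.
Qed.

Section contact_prob.
Context {d : measure_display} {T : measurableType d} {R : realType}.
Variables (P : probability T R) (sigma : R) (s0 : 0 < sigma) (B : R -> T -> R).
Hypothesis hB : igi P sigma B.
Variables (a L K : R) (L0 : 0 < L) (K0 : 0 < K).

Let tt (i j W k : nat) := a + (W * 2 ^ i + k)%:R * (L / 2 ^+ (i + j)).
Let Q (i j W k k' : nat) : set T :=
  [set w | `|B (tt i j W k) w - B (tt i j W k') w| <= 2 * K * (L / 2 ^+ j)].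
Let A (i j : nat) (w : T) : R :=
  \sum_(W < 2 ^ j) \sum_(k < 2 ^ i) \sum_(k' < 2 ^ i) \1_(Q i j W k k') w.
(** Bound for the probability that [B] changes by at most [2 * K] window lengths between points at
    least a fraction [2 ^- e] of a window apart. It is of the order of the square root of
    [2 ^+ e / 2 ^+ j], hence small for [e] fixed and [j] large; the closer pairs make up a fraction
    of at most [2 / 2 ^+ e]. *)
Let p (e j : nat) : R := 2 * K * (L / 2 ^+ j) / (sigma * Num.sqrt (L / 2 ^+ j / 2 ^+ e)).

Let mQ i j W k k' : measurable (Q i j W k k').
Proof.
have m1 : measurable_fun setT (fun w => 2 * K * (L / 2 ^+ j) - `|B (tt i j W k) w - B (tt i j W k') w|).
  apply: measurable_funB => //; apply: measurableT_comp => //.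
  by apply: measurable_funB; exact: igi_meas hB _.
have := measurable_ge 0 m1.
by congr measurable; apply/seteqP; split => w /=; rewrite subr_ge0.
Qed.

Let p_ge0 e j : 0 <= p e j.
Proof.
by rewrite /p divr_ge0 ?mulr_ge0 ?sqrtr_ge0 ?(ltW K0) ?(ltW s0) ?(ltW L0) ?invr_ge0 ?exprn_ge0.
Qed.

Let PrQ e i j W k k' : (e <= i)%N -> Pr P (Q i j W k k') <=
  ((k < k' + 2 ^ (i - e)) && (k' < k + 2 ^ (i - e)))%N%:R + p e j.
Proof.
move=> ei.
wlog kk' : k k' / (k <= k')%N.
  move=> H; have [kk|/ltnW kk] := leqP k k'; first exact: H.
  rewrite andbC (_ : Q i j W k k' = Q i j W k' k); first exact: H.
  by apply/seteqP; split => w /=; rewrite /Q/= distrC.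
case: (boolP (_ && _)) => H.
  by apply: le_trans (Pr_le1 P (mQ _ _ _ _ _)) _; rewrite (_ : true%:R = 1 :> R)// lerDl p_ge0.
rewrite add0r.
set D := (2 ^ (i - e))%N in H.
have D0 : (0 < D)%N by rewrite expn_gt0.
have kD : (k + D <= k')%N by move: H; rewrite negb_and -!leqNgt; lia.
set h := L / 2 ^+ (i + j).
have h0 : 0 < h by rewrite divr_gt0// exprn_gt0.
have Dh : D%:R * h = L / 2 ^+ j / 2 ^+ e.
  rewrite /D /h natrX -{2}(subnK ei) !exprD; field; rewrite !expf_neq0//.
have dtt : tt i j W k' - tt i j W k = (k' - k)%N%:R * h.
  by rewrite /tt natrB// !natrD -/h; ring.
have Dk : D%:R * h <= tt i j W k' - tt i j W k.
  by rewrite dtt ler_wpM2r ?(ltW h0)// ler_nat; lia.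
have Dh0 : 0 < D%:R * h by rewrite mulr_gt0// ltr0n.
have lt : tt i j W k < tt i j W k' by rewrite -subr_gt0 (lt_le_trans Dh0).
have sq0 : 0 < sigma * Num.sqrt (D%:R * h) by rewrite mulr_gt0// sqrtr_gt0.
have sqle : sigma * Num.sqrt (D%:R * h) <= sigma * Num.sqrt (tt i j W k' - tt i j W k).
  by rewrite ler_wpM2l ?(ltW s0)// ler_wsqrtr.
have z0 : 0 <= 2 * K * (L / 2 ^+ j).
  by rewrite !mulr_ge0 ?(ltW K0)// ?(ltW L0)// invr_ge0 exprn_ge0.
have := gaussian_small (lt_le_trans sq0 sqle) (igi_law hB lt) z0.
rewrite (_ : [set w | _] = Q i j W k k'); last first.
  by apply/seteqP; split => w /=; rewrite /Q/= distrC.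
move=> h1; apply: le_trans h1 _; rewrite /p -Dh ler_wpM2l//.
by rewrite lef_pV2 ?posrE// (lt_le_trans sq0 sqle).
Qed.

Let ExA e i j : (e <= i)%N -> itg P (A i j) /\
  Ex P (A i j) <= 2 ^+ j * (2 ^+ i) ^+ 2 * (2 / 2 ^+ e + p e j).
Proof.
move=> ei.
have i1 W k := Ex_sum (index_enum 'I_(2 ^ i)) (fun k' : 'I__ => itg_ind P (mQ i j W k k')).
have i2 W := Ex_sum (index_enum 'I_(2 ^ i)) (fun k : 'I__ => (i1 W k).1).
have i3 := Ex_sum (index_enum 'I_(2 ^ j)) (fun W : 'I__ => (i2 W).1).
split; first exact: i3.1.
rewrite [leLHS]i3.2.
have row W k : Ex P (fun w => \sum_(k' < 2 ^ i) \1_(Q i j W k k') w) <=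
    2 ^+ i * (2 / 2 ^+ e + p e j).
  rewrite (i1 W k).2.
  apply: (@le_trans _ _ (\sum_(k' < 2 ^ i)
     (((k < k' + 2 ^ (i - e)) && (k' < k + 2 ^ (i - e)))%N%:R + p e j))).
    by apply: ler_sum => k' _; rewrite Ex_ind//; exact: PrQ.
  rewrite big_split/= sumr_const card_ord -(mulr_natl (p e j)) natrX.
  apply: (@le_trans _ _ (2 * (2 ^ (i - e))%:R + 2 ^+ i * p e j)).
    by rewrite lerD2r near_count// expn_gt0.
  rewrite mulrDr lerD2r natrX -{2}(subnK ei) exprD.
  by rewrite le_eqVlt; apply/orP; left; apply/eqP; field; rewrite expf_neq0.
apply: (@le_trans _ _ (\sum_(W < 2 ^ j) \sum_(k < 2 ^ i) (2 ^+ i * (2 / 2 ^+ e + p e j)))).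
  by apply: ler_sum => W _; rewrite (i2 W).2; apply: ler_sum => k _; exact: row.
rewrite !sumr_const !card_ord -(mulr_natl (_ *+ 2 ^ i)) -(mulr_natl _ (2 ^ i)%N) !natrX.
by rewrite le_eqVlt; apply/orP; left; apply/eqP; ring.
Qed.

Let Bad (rho : R) (j i0 : nat) : set T :=
  \bigcap_(i in [set i | (i0 <= i)%N]) [set w | rho ^+ 2 * 2 ^+ j * (2 ^+ i) ^+ 2 <= A i j w].

Let mBad rho j i0 : measurable (Bad rho j i0).
Proof.
apply: bigcap_measurable => [|i _]; first by exists i0 => /=.
by apply: measurable_ge; exact: itg_mf (ExA j (leq0n i)).1.
Qed.

Let PrBad rho j e : 0 < rho -> Pr P (\bigcup_i0 Bad rho j i0) <= (2 / 2 ^+ e + p e j) / rho ^+ 2.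
Proof.
move=> r0.
have bnd i0 : Pr P (Bad rho j i0) <= (2 / 2 ^+ e + p e j) / rho ^+ 2.
  pose i := maxn e i0.
  have [iA EA] := ExA j (leq_maxl e i0); rewrite -/i in iA EA.
  have A0 w : 0 <= A i j w.
    by apply: sumr_ge0 => W _; apply: sumr_ge0 => k _; apply: sumr_ge0 => k' _; rewrite indicE.
  set c := rho ^+ 2 * 2 ^+ j * (2 ^+ i) ^+ 2.
  have c0 : 0 < 2 ^+ j * (2 ^+ i) ^+ 2 :> R by rewrite mulr_gt0// !exprn_gt0.
  have := le_trans (markov_Ex c iA A0) EA => M.
  have : Pr P (Bad rho j i0) <= Pr P [set w | c <= A i j w].
    apply: le_Pr => //; first by apply: measurable_ge; exact: itg_mf iA.
    by move=> w /(_ i); apply; rewrite /= leq_maxr.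
  move=> h1; apply: le_trans h1 _.
  rewrite ler_pdivlMr ?exprn_gt0// -(ler_pM2l c0); apply: le_trans M.
  by rewrite le_eqVlt; apply/orP; left; apply/eqP; rewrite /c; ring.
have mU : measurable (\bigcup_i0 Bad rho j i0) by exact: bigcupT_measurable.
have nd : nondecreasing_seq (Bad rho j).
  move=> m n mn; apply/subsetPset => w H i /= ni; apply: H => /=.
  exact: leq_trans ni.
rewrite -lee_fin -PrE//.
have cv := @nondecreasing_cvg_mu _ _ _ P _ (mBad rho j) mU nd.
rewrite -(cvg_lim _ cv)//; apply: lime_le; first by apply/cvg_ex; eexists; exact: cv.
by apply: nearW => n /=; rewrite (PrE P (mBad rho j n)) lee_fin.
Qed.

(** The order of quantifiers matters: [j] comes first, and then [i] must be available beyond any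
    bound, since the cells have to be finer than a modulus of continuity that depends on the path
    and on [j]. Hence the bad event is that the count is large for all [i] from some point on. *)
Lemma pair_count_small (rho : R) : 0 < rho ->
  {ae P, forall w, exists j, forall i0, exists2 i, (i0 <= i)%N &
     A i j w < rho ^+ 2 * 2 ^+ j * (2 ^+ i) ^+ 2}.
Proof.
move=> r0.
have mU j : measurable (\bigcup_i0 Bad rho j i0) by exact: bigcupT_measurable.
have mI : measurable (\bigcap_j \bigcup_i0 Bad rho j i0) by exact: bigcapT_measurable.
have : {ae P, forall w, ~ (\bigcap_j \bigcup_i0 Bad rho j i0) w}.
  apply: ae_small => // eta eta0.
  have r20 : 0 < rho ^+ 2 by rewrite exprn_gt0.
  (* Both terms in the bound of [PrBad] are made at most [et], and [2 * et / rho ^+ 2 = eta]. *)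
  pose et := eta * rho ^+ 2 / 2.
  have et0 : 0 < et by rewrite divr_gt0// mulr_gt0.
  have archi (y : R) : exists n : nat, y <= 2 ^+ n.
    exists (Num.truncn `|y|).+1.
    have /Num.Theory.truncn_itv/andP[_ h] := normr_ge0 y.
    apply: le_trans (ler_norm y) _; apply: le_trans (ltW h) _.
    by rewrite -natrX ler_nat ltnW// ltn_expl.
  have [e he] := archi (2 / et).
  have e2 : 2 / 2 ^+ e <= et.
    by rewrite ler_pdivrMr ?exprn_gt0// mulrC -ler_pdivrMr.
  have [j hj] := archi (4 * K ^+ 2 * 2 ^+ e * L / (et ^+ 2 * sigma ^+ 2)).
  have pe : p e j <= et.
    rewrite -(@ler_pXn2r _ 2)// ?nnegrE ?(ltW et0)//.
    have l0 : 0 < L / 2 ^+ j / 2 ^+ e by rewrite !divr_gt0// exprn_gt0.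
    rewrite /p expr_div_n exprMn [(sigma * _) ^+ 2]exprMn sqr_sqrtr ?(ltW l0)//.
    have tj : 0 < 2 ^+ j :> R by rewrite exprn_gt0.
    have te : 0 < 2 ^+ e :> R by rewrite exprn_gt0.
    rewrite (_ : _ / _ = 4 * K ^+ 2 * 2 ^+ e * L / (sigma ^+ 2 * 2 ^+ j)); last first.
      by field; rewrite !gt_eqF.
    rewrite ler_pdivrMr ?mulr_gt0 ?exprn_gt0//.
    by move: hj; rewrite ler_pdivrMr ?mulr_gt0 ?exprn_gt0//; lra.
  apply: (@le_trans _ _ (Pr P (\bigcup_i0 Bad rho j i0))).
    by apply: le_Pr => // w; apply.
  apply: le_trans (PrBad j e r0) _.
  by rewrite ler_pdivrMr//; rewrite /et in e2 pe; lra.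
apply: filterS => w H; apply: contrapT => nex; apply: H => j _.
apply: contrapT => nb; apply: nex; exists j => i0; apply: contrapT => ni; apply: nb.
exists i0 => // i /= i0i; rewrite leNgt; apply/negP => h; apply: ni; exists i => //.
Qed.

End contact_prob.

Section beta_lipschitz.
Context {d : measure_display} {T : measurableType d} {R : realType}.
Variables (P : probability T R) (sigma : R) (s0 : 0 < sigma).
Variables (beta : R) (beta0 : 0 < beta).

(* The slope of x is unconstrained where x = b. If such contacts filled a positive fraction rho of
   [a, a + L], then for every i, j the windows of length L / 2 ^ j would contain at least
   rho^2 2 ^ j 4 ^ i pairs of contact cells, hence as many pairs at which b differs by at most K times
   the window length; for Brownian motion the expected number of such pairs is too small. *)
Lemma ae_slope_le (B : R -> T -> R) : igi P sigma B ->
  {ae P, forall w x, bsol beta (fun t => B t w) x ->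
     forall s t, s <= t -> x t - x s <= beta * (t - s)}.
Proof.
move=> hB.
(* One null set must serve all solutions [x] of a path, whatever their Lipschitz constants; so the
   condition on the path is imposed for rational end points, integer [K], and [rho] the inverse of
   an integer. *)
pose I := (rat * rat * nat * nat)%type.
pose Q (r : I) (w : T) := let a : R := ratr r.1.1.1 in let L := ratr r.1.1.2 - a in
  let K : R := r.1.2.+1%:R in let rho : R := r.2.+1%:R^-1 in 0 < L ->
  exists j, forall i0, exists2 i, (i0 <= i)%N &
   \sum_(W < 2 ^ j) \sum_(k < 2 ^ i) \sum_(k' < 2 ^ i)
     \1_[set w | `|B (a + (W * 2 ^ i + k)%:R * (L / 2 ^+ (i + j))) w -
                   B (a + (W * 2 ^ i + k')%:R * (L / 2 ^+ (i + j))) w| <= 2 * K * (L / 2 ^+ j)] w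
   < rho ^+ 2 * 2 ^+ j * (2 ^+ i) ^+ 2.
have aeQ : {ae P, forall w r, Q r w}.
  apply: ae_count => -[[[a c] K] q]; rewrite /Q/=.
  have [L0|L0] := ltP 0 (ratr c - ratr a : R); last first.
    exact: aeW.
  have r0 : 0 < q.+1%:R^-1 :> R by rewrite invr_gt0 ltr0n.
  have K0 : 0 < K.+1%:R :> R by rewrite ltr0n.
  by apply: filterS (pair_count_small s0 hB (ratr a) L0 K0 r0) => w h _.
apply: filterS2 aeQ (igi_cont hB) => w Qw cw x sx.
set b := fun t => B t w.
have [[K' K'0 lx'] _ _] := sx.
pose k0 := Num.truncn K'; pose K : R := k0.+1%:R.
have K0 : 0 < K by rewrite ltr0n.
have lx s t : `|x s - x t| <= K * `|s - t|.
  apply: le_trans (lx' s t) _; rewrite ler_wpM2r//.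
  by have /Num.Theory.truncn_itv/andP[_ /ltW] := K'0.
have rat_slope (a c : rat) : (ratr a : R) < ratr c ->
    x (ratr c) - x (ratr a) <= beta * (ratr c - ratr a).
  move=> ac; set L := ratr c - ratr a : R.
  have L0 : 0 < L by rewrite subr_gt0.
  have -> : ratr c = ratr a + L :> R by rewrite /L addrC subrK.
  apply/ler_addgt0Pl => e e0.
  (* With [rho] the inverse of [q + 1], contact cells in proportion [rho] raise [x] by at most
     [K * L * rho <= e]. *)
  pose q := Num.truncn (K * L / e).
  have KLe : 0 <= K * L / e by rewrite divr_ge0 ?mulr_ge0// ltW.
  have /Num.Theory.truncn_itv/andP[_ q1] := KLe; rewrite -/q in q1.
  have q0 : 0 < q.+1%:R :> R by rewrite ltr0n.
  have rle : K * L * q.+1%:R^-1 <= e.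
    by rewrite ler_pdivrMr// -ler_pdivrMl// mulrC ltW.
  have [j Hj] := Qw (a, c, k0, q) L0; rewrite /= -/L -/K in Hj.
  have w0 : 0 < K * (L / 2 ^+ j) / 2.
    by rewrite divr_gt0// mulr_gt0// divr_gt0// exprn_gt0.
  have [h0 h00 osc] := @heine_segment _ b (ratr a) (ratr a + L) _ cw w0.
  pose i0 := (Num.truncn (L / h0)).+1.
  have Lh0 : 0 <= L / h0 by rewrite divr_ge0// ltW.
  have /Num.Theory.truncn_itv/andP[_ i01] := Lh0; rewrite -/i0 in i01.
  have [i i0i HA] := Hj i0.
  have hh0 : L / 2 ^+ (i + j) <= h0.
    rewrite ler_pdivrMr ?exprn_gt0// -ler_pdivrMl// mulrC.
    apply: le_trans (ltW i01) _; rewrite -natrX ler_nat.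
    by apply: leq_trans i0i _; apply: leq_trans (leq_addr j i) _; rewrite ltnW// ltn_expl.
  have := @contact_sum _ _ beta0 b x K cw sx lx (ratr a) L L0 i j.
  set N := \sum_(_ < _) _ => cs.
  have Nle : N <= q.+1%:R^-1 * 2 ^+ (i + j).
    rewrite leNgt; apply/negP => /ltW Nge.
    have qi0 : 0 <= q.+1%:R^-1 :> R by rewrite invr_ge0 ltW.
    have := contact_square qi0 Nge; rewrite leNgt => /negP; apply.
    apply: le_lt_trans HA; apply: ler_sum => W _; apply: ler_sum => k _; apply: ler_sum => k' _.
    case: (boolP (_ && _)) => [/andP[ck ck']|_]; last by rewrite indicE.
    rewrite indicE mem_set//=.
    apply: (@contact_pair _ b x K K0 lx (ratr a) L L0 i j W k k') => //.
    by move=> s t hs ht st; apply: osc => //; exact: le_trans st hh0.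
  have h20 : 0 < 2 ^+ (i + j) :> R by rewrite exprn_gt0.
  have : K * (L / 2 ^+ (i + j)) * N <= K * L * q.+1%:R^-1.
    apply: (@le_trans _ _ (K * (L / 2 ^+ (i + j)) * (q.+1%:R^-1 * 2 ^+ (i + j)))).
      by rewrite ler_wpM2l// mulr_ge0 ?(ltW K0)// divr_ge0 ?(ltW L0)// ltW.
    by rewrite le_eqVlt; apply/orP; left; apply/eqP; field; rewrite !gt_eqF.
  move=> l; apply: le_trans cs _; rewrite [leRHS]addrC lerD2l.
  exact: le_trans l rle.
move=> s t st; apply/ler_addgt0Pl => e e0.
(* Rational end points just outside [[s, t]], at most [e'] away, cost
   [2 * K * e' + 2 * beta * e' = e]. *)
have C0 : 0 < 2 * K + 2 * beta by rewrite addr_gt0// mulr_gt0.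
set e' := e / (2 * K + 2 * beta).
have e'0 : 0 < e' by rewrite divr_gt0.
have [a ha] : exists a : rat, ratr a \in `]s - e', s[.
  by apply: rat_in_itvoo; rewrite ltrBlDr ltrDl.
have [c hc] : exists c : rat, ratr c \in `]t, t + e'[.
  by apply: rat_in_itvoo; rewrite ltrDl.
move: ha hc; rewrite !in_itv/= => /andP[a1 a2] /andP[c1 c2].
have := rat_slope a c (lt_le_trans a2 (le_trans st (ltW c1))).
have := lx t (ratr c); have := lx (ratr a) s.
rewrite !ler_norml => /andP[_ h1] /andP[_ h2] h3.
have eE : e = 2 * K * e' + 2 * beta * e' by rewrite /e' -mulrDl mulrC divfK// gt_eqF.
have l1 : K * `|t - ratr c| <= K * e'.
  by rewrite ler_wpM2l ?(ltW K0)// ler_norml; apply/andP; split; lra.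
have l2 : K * `|ratr a - s| <= K * e'.
  by rewrite ler_wpM2l ?(ltW K0)// ler_norml; apply/andP; split; lra.
have l3 : beta * (ratr c - ratr a) <= beta * (t - s + 2 * e').
  by rewrite ler_wpM2l ?(ltW beta0)//; lra.
lra.
Qed.

Lemma ae_beta_lipschitz (B : R -> T -> R) : igi P sigma B ->
  {ae P, forall w x, bsol beta (fun t => B t w) x ->
     forall s t, `|x s - x t| <= beta * `|s - t|}.
Proof.
move=> hB; apply: filterS2 (ae_slope_le hB) (ae_slope_le (igiN s0 hB)) => w h1 h2 x sx.
have main s t : s <= t -> `|x s - x t| <= beta * `|s - t|.
  move=> st; have := h1 x sx s t st; have := h2 _ (bsolN sx) s t st.
  rewrite (ler0_norm (_ : s - t <= 0)) ?subr_le0// => l1 l2.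
  by rewrite ler_norml; apply/andP; split; lra.
move=> s t; have [st|/ltW ts] := leP s t; first exact: main.
by rewrite distrC (distrC s); exact: main.
Qed.

End beta_lipschitz.

(** * Mean of the maximum *)


Section indep_expectation.
Context {d : measure_display} {T : measurableType d} {R : realType}.
Variable P : probability T R.

Lemma eq_law_Ex (U U' : T -> R) (f : R -> R) :
  measurable_fun setT U -> measurable_fun setT U' ->
  (forall A, measurable A -> P (U @^-1` A) = P (U' @^-1` A)) ->
  measurable_fun setT f -> (forall x, 0 <= f x) ->
  Ex P (fun w => f (U w)) = Ex P (fun w => f (U' w)).
Proof.
move=> mU mU' UU' mf f0.
have [mu muE] := law_ex P mU.
have muE' A : measurable A -> P (U' @^-1` A) = mu A by move=> mA; rewrite -UU'// muE.
have mfE : measurable_fun setT (fun x => (f x)%:E) by exact/measurable_EFinP.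
have f0' x : (0 <= (f x)%:E)%E by rewrite lee_fin.
by rewrite /Ex /Rintegral (integral_law mU muE mfE f0') (integral_law mU' muE' mfE f0').
Qed.

Definition indep_rv (U V : T -> R) : Prop := forall A B, measurable A -> measurable B ->
  P (U @^-1` A `&` V @^-1` B) = (P (U @^-1` A) * P (V @^-1` B))%E.

Lemma indep_ExM_norm (U V : T -> R) : itg P U -> itg P V -> indep_rv U V ->
  itg P (fun w => `|U w| * `|V w|) /\
  Ex P (fun w => `|U w| * `|V w|) = Ex P (fun w => `|U w|) * Ex P (fun w => `|V w|).
Proof.
move=> iU iV UV.
have mU := itg_mf iU; have mV := itg_mf iV.
have [mu muE] := law_ex P mU; have [nu nuE] := law_ex P mV.
have mn : measurable_fun setT (fun x : R => (`|x|%R)%:E).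
  by apply/measurable_EFinP; exact: normr_measurable.
apply: ge0_itg.
- by apply: measurable_funM; exact: measurableT_comp.
- by move=> w; rewrite mulr_ge0.
pose h (x : R * R) : \bar R := (`|x.1| * `|x.2|)%:E.
have mh : measurable_fun setT h.
  by apply/measurable_EFinP; apply: measurable_funM; exact: measurableT_comp.
have h0 x : (0 <= h x)%E by rewrite lee_fin mulr_ge0.
rewrite (@indep_integral _ _ _ P U V mu nu h mU mV _ mh h0); last first.
  by move=> A B mA mB; rewrite UV// muE// nuE.
transitivity (\int[nu]_y ((Ex P (fun w => `|U w|))%:E * `|y|%:E))%E.
  apply: eq_integral => y _; rewrite /h/=.
  under eq_integral do rewrite EFinM muleC.
  rewrite ge0_integralZl//.
  rewrite muleC -(integral_law mU muE mn)//.
  by rewrite (ExE (itg_norm iU)).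
rewrite ge0_integralZl//; last by rewrite lee_fin Ex_ge0.
by rewrite -(integral_law mV nuE mn)// (ExE (itg_norm iV)) EFinM.
Qed.

Lemma indep_ExM (U V : T -> R) : itg P U -> itg P V -> indep_rv U V ->
  itg P (fun w => U w * V w) /\ Ex P (fun w => U w * V w) = Ex P U * Ex P V.
Proof.
move=> iU iV UV.
pose f (x : R) := Num.max x 0.
have f0 x : 0 <= f x by rewrite le_max lexx orbT.
have fN x : x = f x - f (- x).
  by rewrite /f; case: (leP x 0); case: (leP (- x) 0); lra.
have mf : measurable_fun setT f by exact: measurable_maxr.
have pos (W : T -> R) : itg P W -> itg P (fun w => f (W w)).
  move=> iW; apply: itg_le (itg_norm iW); first by apply: (measurableT_comp mf); exact: itg_mf iW.
  by move=> w; rewrite /f; case: (leP (W w) 0) => h; rewrite ?normr0.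
have mfN : measurable_fun setT (fun x : R => f (- x)) by exact: measurableT_comp mf (@oppr_measurable _ _).
have pre (g g' : R -> R) : measurable_fun setT g -> measurable_fun setT g' ->
    indep_rv (fun w => g (U w)) (fun w => g' (V w)).
  move=> mg mg' A B mA mB.
  have mgA : measurable (g @^-1` A) by have := mg measurableT A mA; rewrite setTI.
  have mgB : measurable (g' @^-1` B) by have := mg' measurableT B mB; rewrite setTI.
  exact: (UV _ _ mgA mgB).
have key (g g' : R -> R) : measurable_fun setT g -> measurable_fun setT g' ->
    (forall x, 0 <= g x) -> (forall x, 0 <= g' x) ->
    itg P (fun w => g (U w)) -> itg P (fun w => g' (V w)) ->
    itg P (fun w => g (U w) * g' (V w)) /\
    Ex P (fun w => g (U w) * g' (V w)) = Ex P (fun w => g (U w)) * Ex P (fun w => g' (V w)).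
  move=> mg mg' g0 g'0 i1 i2; have := indep_ExM_norm i1 i2 (pre _ _ mg mg').
  do ?[under eq_fun do rewrite (ger0_norm (g0 _)) (ger0_norm (g'0 _))].
  rewrite (_ : (fun w => `|g (U w)|) = (fun w => g (U w))); last first.
    by apply/funext => w; rewrite ger0_norm.
  by rewrite (_ : (fun w => `|g' (V w)|) = (fun w => g' (V w)))//; apply/funext => w; rewrite ger0_norm.
have f0N x : 0 <= f (- x) by [].
have iU1 := pos _ iU; have iU2 := pos _ (itgN iU).
have iV1 := pos _ iV; have iV2 := pos _ (itgN iV).
have [j1 e1] := key _ _ mf mf f0 f0 iU1 iV1.
have [j2 e2] := key _ _ mf mfN f0 f0N iU1 iV2.
have [j3 e3] := key _ _ mfN mf f0N f0 iU2 iV1.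
have [j4 e4] := key _ _ mfN mfN f0N f0N iU2 iV2.
have -> : (fun w => U w * V w) = (fun w => (f (U w) * f (V w) - f (U w) * f (- V w)) -
   (f (- U w) * f (V w) - f (- U w) * f (- V w))).
  by apply/funext => w; rewrite {1}(fN (U w)) {1}(fN (V w)); ring.
split; first by apply: itgB; apply: itgB.
rewrite !ExB//; try by apply: itgB.
rewrite e1 e2 e3 e4.
have -> : Ex P U = Ex P (fun w => f (U w)) - Ex P (fun w => f (- U w)).
  by rewrite -ExB//; congr Ex; apply/funext => w; exact: fN.
have -> : Ex P V = Ex P (fun w => f (V w)) - Ex P (fun w => f (- V w)).
  by rewrite -ExB//; congr Ex; apply/funext => w; exact: fN.
by ring.
Qed.

Lemma le_Pr_ae (A C : set T) : measurable A -> measurable C ->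
  {ae P, forall w, A w -> C w} -> Pr P A <= Pr P C.
Proof.
move=> mA mC AC.
have -> : Pr P C = Pr P (A `|` C).
  rewrite /Pr (@ae_eq_Pr _ _ _ P C (A `|` C))//; first exact: measurableU.
  by apply: filterS AC => w h; split => [|[]]; [right|exact: h|].
by apply: le_Pr => //; exact: measurableU.
Qed.

Lemma Ex_ccdf (f : T -> R) : measurable_fun setT f -> (forall w, 0 <= f w) ->
  (\int[P]_w (f w)%:E = \int[lebesgue_measure]_(r in `[0%R, +oo[) P [set w | (r < f w)%R])%E.
Proof.
move=> mf f0; pose m := isMeasurableFun.Build _ _ T R f mf.
pose X : {RV P >-> R} := HB.pack f m.
have := @ge0_expectation_ccdf _ _ _ P X f0; rewrite unlock => ->.
apply: eq_integral => r _; rewrite /ccdf /distribution/= /pushforward.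
by congr (P _); apply/seteqP; split => w /=; rewrite in_itv/= andbT.
Qed.

End indep_expectation.

Section kingman.
Context {d : measure_display} {T : measurableType d} {R : realType}.
Variables (P : probability T R) (sigma : R) (s0 : 0 < sigma) (B : R -> T -> R).
Hypothesis hB : igi P sigma B.
Variables (beta : R) (beta0 : 0 < beta).

Let lam := 2 * beta / sigma ^+ 2.
Let lam0 : 0 < lam. Proof. by rewrite divr_gt0 ?mulr_gt0 ?exprn_gt0. Qed.
Let lind (h : R) := chain (lindG beta h) h B.

Let mlind h k u : 0 < h -> measurable_fun setT (lind h k u).
Proof. by move=> h0; apply: (chain_mfun hB) => //; exact: measurable_lindG. Qed.

Let lind2 h k u : 0 < h -> itg2 P (lind h k u) /\ Ex P (fun w => lind h k u w ^+ 2) <=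
  8 / lam ^+ 2 * (1 * expR (lam / 2) / (1 - expR (- (lam / 2)))).
Proof.
move=> h0; apply: tail_itg2 => //; first exact: mlind.
move=> x x0; rewrite mul1r; under eq_set do rewrite ger0_norm ?lind_ge0//.
exact: (lind_tail s0 hB beta0 k u x h0).
Qed.

(* Stationarity of M -> max 0 (M + xi - beta h) in its first two moments (Kingman's argument). *)
Lemma kingman_step (h c : R) : 0 < h -> h <= 1 -> 0 < c -> exists n, forall u,
  (sigma ^+ 2 - h - c * (beta + 1) - (768 * sigma ^+ 4 + 8 * beta ^+ 4) * h / c ^+ 2) / (2 * beta)
    <= Ex P (lind h n u).
Proof.
move=> h0 h1 c0.
have p4 (x : R) : x ^+ 4 = (x ^+ 2) ^+ 2 by rewrite -exprM.
set C := 8 / lam ^+ 2 * (1 * expR (lam / 2) / (1 - expR (- (lam / 2)))).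
have lawn n u u' := chain_law hB h0 (measurable_lindG beta h) n u u'.
pose a n := Ex P (lind h n 0); pose q n := Ex P (fun w => lind h n 0 w ^+ 2).
have aE n u : Ex P (lind h n u) = a n.
  have e v : Ex P (lind h n v) = Ex P (fun w => `|lind h n v w|).
    by congr Ex; apply/funext => w; rewrite ger0_norm// lind_ge0.
  rewrite /a !e; apply: (eq_law_Ex (f := fun x => `|x|)) => //.
  - exact: mlind.
  - exact: mlind.
  - by move=> A mA; exact: lawn.
have qE n u : Ex P (fun w => lind h n u w ^+ 2) = q n.
  apply: (eq_law_Ex (f := fun x => x ^+ 2)) => //.
  - exact: mlind.
  - exact: mlind.
  - by move=> A mA; exact: lawn.
  - by move=> x; rewrite sqr_ge0.
have a_nd n : a n <= a n.+1.
  apply: le_Ex; [apply: itg2_itg; exact: (lind2 _ _ h0).1..|].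
  by move=> w; exact: lind_nd.
have q_nd n : q n <= q n.+1.
  apply: le_Ex; [exact: (lind2 _ _ h0).1.2..|].
  by move=> w; rewrite ler_pXn2r ?nnegrE ?lind_ge0// lind_nd.
have qC n : q n <= C by exact: (lind2 _ _ h0).2.
have aC n : a n <= 1 + C.
  have := qC n; suff : a n <= 1 + q n by lra.
  rewrite -[X in X + _](Ex_cst P) -ExD; [|exact: itg_cst|exact: (lind2 _ _ h0).1.2].
  apply: le_Ex; [exact: itg2_itg (lind2 _ _ h0).1|apply: itgD; [exact: itg_cst|exact: (lind2 _ _ h0).1.2]|].
  by move=> w; have := sqr_ge0 (lind h n 0 w - 1); nra.
(* Both sequences increase and are bounded through the uniform tail, so not every step can gain
   [h ^+ 2]. At such an [n] the first two moments are stationary up to [h ^+ 2]. *)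
have [n hn] : exists n, a n.+1 + q n.+1 <= a n + q n + h ^+ 2.
  apply: contrapT => nex.
  have grow n : n%:R * h ^+ 2 <= a n + q n.
    elim: n => [|n IH].
      rewrite mul0r addr_ge0//; apply: Ex_ge0 => w; [exact: lind_ge0|exact: sqr_ge0].
    rewrite -natr1 mulrDl mul1r; apply: (@le_trans _ _ (a n + q n + h ^+ 2)).
      by rewrite lerD2r.
    by rewrite leNgt; apply/negP => /ltW lt; apply: nex; exists n.
  have h20 : 0 < h ^+ 2 by rewrite exprn_gt0.
  have C0 : 0 <= (1 + 2 * C + 1) / h ^+ 2.
    have := Ex_ge0 P (fun w => sqr_ge0 (lind h 0 0 w)); have := qC 0%N; rewrite /q => l1 l2.
    by rewrite divr_ge0 ?ltW//; lra.
  have /Num.Theory.truncn_itv/andP[_ n1] := C0.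
  set n := (Num.truncn _).+1 in n1.
  have := grow n; have := aC n; have := qC n; move: n1; rewrite ltr_pdivrMr//; lra.
have hna : a n.+1 <= a n + h ^+ 2 by have := q_nd n; lra.
have hnq : q n.+1 <= q n + h ^+ 2 by have := a_nd n; lra.
exists n => u; rewrite aE {u}.
pose M := lind h n (0 + h); pose xi w := B (0 + h) w - B 0 w.
pose Y w := M w + (xi w - beta * h).
(* [N] is the part cut off at 0: the new value is [Y + N] and its square is [Y ^+ 2 - N ^+ 2]. The
   first identity gives a mean of [N] close to [beta * h]; the second expresses [2 * beta * h] times
   the mean of [M] as [sigma ^+ 2 * h] minus the mean of [N ^+ 2], up to order [h ^+ 2]. *)
pose N w := Num.max 0 (- Y w).
have lt : 0 < 0 + h by rewrite add0r.
have gxi := igi_law hB lt; rewrite subr0 {1}add0r -/xi in gxi.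
have sh0 : 0 < sigma * Num.sqrt h by rewrite mulr_gt0// sqrtr_gt0.
have i2M : itg2 P M := (lind2 n (0 + h) h0).1.
have i2xi : itg2 P xi by exact: gaussian_itg2 sh0 gxi.
have i2z : itg2 P (fun w => xi w - beta * h) by apply: itg2B => //; exact: itg2_cst.
have i2Y : itg2 P Y by exact: itg2D.
have i2N : itg2 P N.
  apply: (itg2_le _ _ i2Y); first by apply: measurable_maxr => //; apply: measurableT_comp => //; exact: i2Y.1.
  by move=> w; rewrite /N; case: (leP 0 (- Y w)) => hY; rewrite ?normr0// normrN.
have i2L := (lind2 n.+1 0 h0).1.
have LE w : lind h n.+1 0 w = Num.max 0 (Y w).
  by rewrite /lind chainS /lindG/= /Y; congr (Num.max 0 _); rewrite /M /lind /xi; lra.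
have ind : indep_rv P M xi.
  move=> A A' mA mA'.
  rewrite (chain_indep hB h0 (measurable_lindG beta h) n 0 mA mA').
  by rewrite (gxi.2 _ mA').
have [iMx EMx] := indep_ExM (itg2_itg i2M) (itg2_itg i2xi) ind.
have Exi : Ex P xi = 0 by exact: Ex_V gxi.
have Exi2 : Ex P (fun w => xi w ^+ 2) = sigma ^+ 2 * h.
  by rewrite (Ex_V2 sh0 gxi) exprMn sqr_sqrtr// ltW.
have EN : Ex P N = a n.+1 - a n + beta * h.
  have -> : N = (fun w => lind h n.+1 0 w - Y w).
    by apply/funext => w; rewrite LE /N; case: (leP 0 (- Y w)); case: (leP 0 (Y w)); lra.
  rewrite ExB; [|exact: itg2_itg|exact: itg2_itg].
  rewrite /Y ExD; [|exact: itg2_itg|exact: itg2_itg].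
  rewrite ExB; [|exact: itg2_itg|exact: itg_cst].
  by rewrite Ex_cst Exi /M !aE; lra.
have EN2 : Ex P (fun w => N w ^+ 2) = q n + sigma ^+ 2 * h + beta ^+ 2 * h ^+ 2 - 2 * beta * h * a n - q n.+1.
  have -> : (fun w => N w ^+ 2) = (fun w => Y w ^+ 2 - lind h n.+1 0 w ^+ 2).
    apply/funext => w; rewrite LE /N; case: (leP 0 (- Y w)); case: (leP 0 (Y w)) => h2 h3; rewrite ?sqrrN; try lra.
    have -> : Y w = 0 by lra.
    by lra.
  rewrite ExB; [|exact: i2Y.2|exact: i2L.2].
  rewrite qE; congr (_ - _).
  have -> : (fun w => Y w ^+ 2) = (fun w => (M w ^+ 2 + xi w ^+ 2) + (beta ^+ 2 * h ^+ 2 +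
     (2 * (M w * xi w) + (- (2 * beta * h) * M w + - (2 * beta * h) * xi w)))).
    by apply/funext => w; rewrite /Y; ring.
  have iM := itg2_itg i2M; have ix := itg2_itg i2xi.
  have j1 := itgZ (- (2 * beta * h)) iM; have j2 := itgZ (- (2 * beta * h)) ix.
  have j3 := itgZ 2 iMx; have j4 := itgD j1 j2; have j5 := itgD j3 j4.
  have j6 := itgD (itg_cst P (beta ^+ 2 * h ^+ 2)) j5.
  have j7 := itgD i2M.2 i2xi.2.
  rewrite (ExD j7 j6) (ExD i2M.2 i2xi.2) (ExD (itg_cst P _) j5) (ExD j3 j4) (ExD j1 j2).
  by rewrite Ex_cst !ExZ// EMx Exi Exi2 /M qE aE; ring.
have i4 : itg P (fun w => xi w ^+ 4).
  by apply: itg_le (itg_poly sh0 gxi 4) => [|w]; [apply: measurable_funX; exact: gxi.1|rewrite normrX].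
(* The mean of [N ^+ 2] must be negligible against [h]. Where [N <= c] it is at most [c * N], of
   mean about [c * beta * h]; elsewhere [N ^+ 2 <= N ^+ 4 / c ^+ 2] and [N <= |xi| + beta * h],
   which is of order [h ^+ 2 / c ^+ 2] in the mean. *)
have N2le : Ex P (fun w => N w ^+ 2) <= c * Ex P N + (8 / c ^+ 2 * Ex P (fun w => xi w ^+ 4) + 8 * beta ^+ 4 * h ^+ 4 / c ^+ 2).
  rewrite -(ExZ c (itg2_itg i2N)) -(ExZ (8 / c ^+ 2) i4) -[8 * beta ^+ 4 * _ / _](Ex_cst P).
  have k1 := itgZ (8 / c ^+ 2) i4; have k2 := itg_cst P (8 * beta ^+ 4 * h ^+ 4 / c ^+ 2).
  have k3 := itgD k1 k2; have k4 := itgZ c (itg2_itg i2N).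
  rewrite -(ExD k1 k2) -(ExD k4 k3); apply: le_Ex; [exact: i2N.2|exact: itgD|].
  move=> w.
  have N0 : 0 <= N w by rewrite /N le_max lexx.
  have c20 : 0 < c ^+ 2 by rewrite exprn_gt0.
  have ge4 (y : R) : 0 <= y ^+ 4 by rewrite exprn_even_ge0.
  have r0 : 0 <= 8 / c ^+ 2 * xi w ^+ 4 + 8 * beta ^+ 4 * h ^+ 4 / c ^+ 2.
    apply: addr_ge0; first by rewrite mulr_ge0// divr_ge0// ltW.
    have b4 := ge4 beta; have h4 := ge4 h.
    by apply: divr_ge0; [rewrite mulr_ge0// mulr_ge0|exact: ltW].
  have [Nc|cN] := leP (N w) c.
    have : N w ^+ 2 <= c * N w by rewrite expr2 ler_wpM2r.
    lra.
  have Nz : N w <= `|xi w| + beta * h.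
    have M0 : 0 <= M w by exact: lind_ge0.
    have bh : 0 <= beta * h by rewrite mulr_ge0// ltW.
    rewrite /N /Y ge_max; have := ler_norm (- xi w); rewrite normrN => l1.
    by have l2 := normr_ge0 (xi w); apply/andP; split; lra.
  have N4 : N w ^+ 4 <= 8 * xi w ^+ 4 + 8 * beta ^+ 4 * h ^+ 4.
    have : N w ^+ 4 <= (`|xi w| + beta * h) ^+ 4.
      by rewrite ler_pXn2r// nnegrE// (le_trans N0).
    have -> : xi w ^+ 4 = `|xi w| ^+ 4 by rewrite -normrX ger0_norm.
    move: (`|xi w|) => y.
    set z := beta * h => l.
    have -> : 8 * beta ^+ 4 * h ^+ 4 = 8 * z ^+ 4 by rewrite /z exprMn; ring.
    apply: le_trans l _.
    have sq (p r : R) : (p + r) ^+ 2 <= 2 * p ^+ 2 + 2 * r ^+ 2.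
      by have := sqr_ge0 (p - r); nra.
    have -> : 8 * y ^+ 4 + 8 * z ^+ 4 = 2 * (2 * y ^+ 2) ^+ 2 + 2 * (2 * z ^+ 2) ^+ 2 by ring.
    apply: le_trans (sq _ _); rewrite p4.
    by rewrite ler_pXn2r ?nnegrE ?sqr_ge0// addr_ge0// mulr_ge0// sqr_ge0.
  have : N w ^+ 2 * c ^+ 2 <= N w ^+ 4.
    rewrite p4 (expr2 (N w ^+ 2)) ler_wpM2l ?sqr_ge0// ler_pXn2r ?nnegrE ?(ltW c0)//.
    exact: ltW.
  move=> l1; apply: (@le_trans _ _ (8 / c ^+ 2 * xi w ^+ 4 + 8 * beta ^+ 4 * h ^+ 4 / c ^+ 2)); last first.
    by rewrite lerDr mulr_ge0// ltW.
  rewrite (_ : _ + _ = (8 * xi w ^+ 4 + 8 * beta ^+ 4 * h ^+ 4) / c ^+ 2); last by field; rewrite gt_eqF.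
  by rewrite ler_pdivlMr// (le_trans l1).
have E4 := Ex_V4 sh0 gxi.
have s4 : (sigma * Num.sqrt h) ^+ 4 = sigma ^+ 4 * h ^+ 2.
  by rewrite exprMn (p4 (Num.sqrt h)) sqr_sqrtr// ltW.
rewrite s4 in E4; rewrite EN EN2 in N2le.
have c20 : 0 < c ^+ 2 by rewrite exprn_gt0.
have h20 : 0 <= h ^+ 2 by rewrite sqr_ge0.
have h4 : h ^+ 4 <= h ^+ 2.
  by rewrite (p4 h) expr2 ler_piMr// exprn_ile1// ltW.
have F1 : 8 / c ^+ 2 * Ex P (fun w => xi w ^+ 4) <= 768 * sigma ^+ 4 * h ^+ 2 / c ^+ 2.
  rewrite mulrAC ler_pM2r ?invr_gt0//; lra.
have b4 : 0 <= beta ^+ 4 by rewrite exprn_even_ge0.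
have F2 : 8 * beta ^+ 4 * h ^+ 4 / c ^+ 2 <= 8 * beta ^+ 4 * h ^+ 2 / c ^+ 2.
  by rewrite ler_pM2r ?invr_gt0// ler_wpM2l// mulr_ge0.
have F3 : c * (a n.+1 - a n + beta * h) <= c * (h * (1 + beta)).
  by rewrite ler_pM2l//; nra.
rewrite ler_pdivrMr ?mulr_gt0// -(ler_pM2r h0).
have -> : (sigma ^+ 2 - h - c * (beta + 1) - (768 * sigma ^+ 4 + 8 * beta ^+ 4) * h / c ^+ 2) * h
  = sigma ^+ 2 * h - h ^+ 2 - c * (h * (1 + beta)) - (768 * sigma ^+ 4 * h ^+ 2 / c ^+ 2 + 8 * beta ^+ 4 * h ^+ 2 / c ^+ 2).
  by field; rewrite gt_eqF.
have b2 : 0 <= beta ^+ 2 * h ^+ 2 by rewrite mulr_ge0// sqr_ge0.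
lra.
Qed.

Lemma kingman_lb (eps : R) : 0 < eps -> exists h n, 0 < h /\
  forall u, sigma ^+ 2 / (2 * beta) - eps <= Ex P (lind h n u).
Proof.
(* [c * (beta + 1)] equals [beta * eps] and [h * (1 + K)] will be at most that; together they use up
   the admissible error [2 * beta * eps]. *)
move=> e0; pose c := beta * eps / (beta + 1).
have b1 : 0 < beta + 1 by rewrite addr_gt0.
have c0 : 0 < c by rewrite divr_gt0// mulr_gt0.
pose K := (768 * sigma ^+ 4 + 8 * beta ^+ 4) / c ^+ 2.
have K0 : 0 <= K.
  apply: divr_ge0; last exact: sqr_ge0.
  by apply: addr_ge0; (apply: mulr_ge0; first exact: ler0n); apply: exprn_ge0; exact: ltW.
have K1 : 0 < 1 + K by lra.
have be0 : 0 < beta * eps by rewrite mulr_gt0.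
pose h := Num.min 1 (beta * eps / (1 + K)).
have h0 : 0 < h by rewrite lt_min ltr01 divr_gt0.
have h1 : h <= 1 by rewrite ge_min lexx.
have hK : h * (1 + K) <= beta * eps by rewrite -ler_pdivlMr// ge_min lexx orbT.
have [n hn] := kingman_step h0 h1 c0.
exists h, n; split => // u; apply: le_trans (hn u).
rewrite ler_pdivlMr ?mulr_gt0// mulrBl divfK ?mulf_neq0 ?gt_eqF//.
have -> : (768 * sigma ^+ 4 + 8 * beta ^+ 4) * h / c ^+ 2 = h * K.
  by rewrite /K [RHS]mulrA [h * _]mulrC.
have -> : c * (beta + 1) = beta * eps by rewrite /c divfK// gt_eqF.
lra.
Qed.

End kingman.

(** * Mean of the envelopes *)


Lemma integral_expR_decay {R : realType} (l : R) : 0 < l ->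
  (\int[lebesgue_measure]_(r in `[0%R, +oo[) (expR (- l * r))%:E = (l^-1)%:E)%E.
Proof.
move=> l0; have := integral_exponential_pdf l0.
have e0 r : (0 <= (expR (- l * r))%:E)%E by rewrite lee_fin expR_ge0.
have me : measurable_fun (`[0%R, +oo[%classic : set R) (fun r : R => (expR (- l * r))%:E).
  apply/measurable_EFinP; apply: (measurableT_comp (@measurable_expR R)).
  exact: measurable_funM.
have -> : (fun x : R => (exponential_pdf l x)%:E) =
    (fun x : R => (l%:E * (expR (- l * x))%:E)%E) \_ `[0%R, +oo[.
  apply/funext => x; rewrite /exponential_pdf !patchE; case: ifP => //.
rewrite -integral_mkcond ge0_integralZl//; last by rewrite lee_fin ltW.
set I := integral _ _ _ => h.
have I0 : (0 <= I)%E by apply: integral_ge0.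
have If : I \is a fin_num.
  rewrite ge0_fin_numE// ltNge leye_eq; apply/negP => /eqP Iy.
  by move: h; rewrite Iy gt0_muley ?lte_fin.
rewrite -(fineK If) -EFinM in h *; case: h => h.
by rewrite -[X in X%:E](mulKf (lt0r_neq0 l0)) h mulr1.
Qed.

Section mean_majorant.
Context {d : measure_display} {T : measurableType d} {R : realType}.
Variables (P : probability T R) (sigma : R) (s0 : 0 < sigma).
Variables (beta : R) (beta0 : 0 < beta).

Let lam := 2 * beta / sigma ^+ 2.
Let lam0 : 0 < lam. Proof. by rewrite divr_gt0 ?mulr_gt0 ?exprn_gt0. Qed.

Lemma Dev_sub (B : R -> T -> R) u x y : x <= y -> Dev B beta u y `<=` Dev B beta u x.
Proof.
move=> xy w [n _ [j [jn h]]]; exists n => //; exists j; split => //.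
exact: le_lt_trans xy h.
Qed.

Lemma Pr_Dev_measurable (B : R -> T -> R) u : igi P sigma B ->
  measurable_fun (`[0%R, +oo[%classic : set R) (fun r : R => Pr P (Dev B beta u r)).
Proof.
move=> hB; apply: nonincreasing_measurable => // x y xy.
by apply: le_Pr; [exact: (Dev_measurable hB)|exact: (Dev_measurable hB)|exact: Dev_sub].
Qed.

(** The exponential tail bounds the integral by [lam^-1]. Conversely every Lindley recursion lies
    below the maximum over all times, and by [kingman_lb] its mean comes arbitrarily close to
    [lam^-1]. *)
Lemma integral_Dev (B : R -> T -> R) u : igi P sigma B ->
  (\int[lebesgue_measure]_(r in `[0%R, +oo[) (Pr P (Dev B beta u r))%:E = (lam^-1)%:E)%E.
Proof.
move=> hB; apply/eqP; rewrite eq_le; apply/andP; split.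
  rewrite -(integral_expR_decay lam0); apply: ge0_le_integral => //.
  - by move=> x _; rewrite lee_fin Pr_ge0.
  - by apply/measurable_EFinP; exact: Pr_Dev_measurable.
  - apply/measurable_EFinP; apply: measurableT_comp => //; exact: measurable_funM.
  - by move=> x _; rewrite lee_fin; exact: (Dev_tail s0 hB).
apply/lee_addgt0Pr => e e0.
have [h [n [h0 hn]]] := kingman_lb s0 hB beta0 e0.
have mL : measurable_fun setT (chain (lindG beta h) h B n u).
  by apply: (chain_mfun hB) => //; exact: measurable_lindG.
have iL : itg P (chain (lindG beta h) h B n u).
  apply: itg2_itg; apply: (tail_itg2 (C := 1) mL lam0 ler01 _).1 => x x0; rewrite mul1r.
  under eq_set do rewrite ger0_norm ?lind_ge0//.
  exact: (lind_tail s0 hB beta0 n u x h0).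
rewrite -leeBlDr// -EFinB.
have -> : lam^-1 = sigma ^+ 2 / (2 * beta) by rewrite /lam invf_div.
apply: (@le_trans _ _ (Ex P (chain (lindG beta h) h B n u))%:E); first by rewrite lee_fin.
rewrite -(ExE iL) (Ex_ccdf P mL); last by move=> w; exact: lind_ge0.
have mlt r : measurable [set w | r < chain (lindG beta h) h B n u w].
  have := mL measurableT _ (measurable_itv `]r, +oo[); rewrite setTI.
  by congr measurable; apply/seteqP; split => w /=; rewrite in_itv/= andbT.
under eq_integral do rewrite (PrE P (mlt _)).
apply: ge0_le_integral => //.
- by move=> x _; rewrite lee_fin Pr_ge0.
- apply/measurable_EFinP; apply: nonincreasing_measurable => // x y xy.
  by apply: le_Pr => // w /=; exact: le_lt_trans.
- by apply/measurable_EFinP; exact: Pr_Dev_measurable.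
move=> x; rewrite /= in_itv/= andbT => x0; rewrite lee_fin; apply: le_Pr_ae => //.
  exact: (Dev_measurable hB).
apply: filterS (igi_cont hB) => w cw lt; apply: contrapT => nD.
have := Dev_path cw nD => hp; move: lt; apply/negP; rewrite -leNgt.
exact: lind_le.
Qed.

(** With [E r = expR (- lam * r)], [F1 * F2 <= E ^+ 2], while [E <= 1] gives
    [E ^+ 2 - F1 * F2 <= (E - F1) + (E - F2)], whose integral is 0. So [F1 * F2] has the integral
    [1 / (2 * lam)] of [E ^+ 2], to be subtracted from [2 / lam]. *)
Lemma integral_Dev_union (F1 F2 : R -> R) :
  measurable_fun (`[0%R, +oo[%classic : set R) F1 -> measurable_fun (`[0%R, +oo[%classic : set R) F2 ->
  (forall r, 0 <= r -> 0 <= F1 r <= expR (- lam * r)) ->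
  (forall r, 0 <= r -> 0 <= F2 r <= expR (- lam * r)) ->
  (\int[lebesgue_measure]_(r in `[0%R, +oo[) (F1 r)%:E = (lam^-1)%:E)%E ->
  (\int[lebesgue_measure]_(r in `[0%R, +oo[) (F2 r)%:E = (lam^-1)%:E)%E ->
  (\int[lebesgue_measure]_(r in `[0%R, +oo[) (1 - (1 - F1 r) * (1 - F2 r))%:E =
    (3 / 2 * lam^-1)%:E)%E.
Proof.
move=> m1 m2 b1 b2 i1 i2; set D := `[0%R, +oo[%classic : set R.
have mD : measurable D by exact: measurable_itv.
have D0 r : D r -> 0 <= r by rewrite /D/= in_itv/= andbT.
have e1 r : 0 <= r -> 0 <= expR (- lam * r) <= 1.
  by move=> r0; rewrite expR_ge0 expR_le1 mulNr oppr_le0 mulr_ge0// ltW.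
have E := integral_expR_decay lam0.
have lam20 : 0 < 2 * lam by rewrite mulr_gt0.
have E2 := integral_expR_decay lam20.
have me (l : R) : measurable_fun D (fun r : R => expR (- l * r)).
  by apply: measurableT_comp => //; exact: measurable_funM.
have add (f g : R -> R) : measurable_fun D f -> measurable_fun D g ->
    (forall r, 0 <= r -> 0 <= f r) -> (forall r, 0 <= r -> 0 <= g r) ->
    (\int[lebesgue_measure]_(r in D) (f r + g r)%:E =
     \int[lebesgue_measure]_(r in D) (f r)%:E + \int[lebesgue_measure]_(r in D) (g r)%:E)%E.
  move=> mf mg f0 g0; under eq_integral do rewrite EFinD.
  apply: ge0_integralD => //; try exact/measurable_EFinP.
  - by move=> r /D0 r0; rewrite lee_fin f0.
  - by move=> r /D0 r0; rewrite lee_fin g0.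
have le (f g : R -> R) : measurable_fun D f -> measurable_fun D g ->
    (forall r, 0 <= r -> 0 <= f r) -> (forall r, 0 <= r -> f r <= g r) ->
    (\int[lebesgue_measure]_(r in D) (f r)%:E <= \int[lebesgue_measure]_(r in D) (g r)%:E)%E.
  move=> mf mg f0 fg; apply: ge0_le_integral => //; try exact/measurable_EFinP.
  - by move=> r /D0 r0; rewrite lee_fin f0.
  - by move=> r /D0 r0; rewrite lee_fin fg.
have F10 r : 0 <= r -> 0 <= F1 r by move=> /b1/andP[].
have F20 r : 0 <= r -> 0 <= F2 r by move=> /b2/andP[].
have m12 : measurable_fun D (fun r => F1 r * F2 r) by exact: measurable_funM.
have F120 r : 0 <= r -> 0 <= F1 r * F2 r by move=> r0; rewrite mulr_ge0// ?F10 ?F20.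
pose G r := 1 - (1 - F1 r) * (1 - F2 r).
have mG : measurable_fun D G.
  apply: measurable_funB => //; apply: measurable_funM; exact: measurable_funB.
have G0 r : 0 <= r -> 0 <= G r.
  move=> r0; have := b1 r r0; have := b2 r r0; have := e1 r r0; rewrite /G.
  by move=> /andP[? ?] /andP[? ?] /andP[? ?]; nra.
set I := (\int[lebesgue_measure]_(r in D) (F1 r * F2 r)%:E)%E.
have S1 : (\int[lebesgue_measure]_(r in D) (G r)%:E + I = (lam^-1 + lam^-1)%:E)%E.
  rewrite -add// EFinD -[in X in (X + _)%E]i1 -i2 -add//.
  by apply: eq_integral => r _; congr EFin; rewrite /G; ring.
have sqe r : expR (- (2 * lam) * r) = expR (- lam * r) * expR (- lam * r).
  by rewrite -expRD; congr expR; ring.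
have Iup : (I <= ((2 * lam)^-1)%:E)%E.
  rewrite -E2; apply: le => // r r0; rewrite sqe.
  by have /andP[? ?] := b1 r r0; have /andP[? ?] := b2 r r0; exact: ler_pM.
have Ilo : (((2 * lam)^-1)%:E + (lam^-1 + lam^-1)%:E <= I + (lam^-1 + lam^-1)%:E)%E.
  rewrite -{1}E2 EFinD -{1}i1 -{1}i2 -{1}E -[in X in (_ <= _ + (_ + X))%E]E.
  rewrite -!add//; try by move=> r r0; rewrite ?addr_ge0 ?expR_ge0 ?F10 ?F20.
  - apply: le.
    + by apply: measurable_funD => //; exact: measurable_funD.
    + by apply: measurable_funD => //; exact: measurable_funD.
    + by move=> r r0; rewrite !addr_ge0 ?expR_ge0 ?F10 ?F20.
    + move=> r r0; rewrite sqe.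
      by have /andP[? ?] := b1 r r0; have /andP[? ?] := b2 r r0; have /andP[? ?] := e1 r r0; nra.
  - exact: measurable_funD.
  - exact: measurable_funD.
have If : I \is a fin_num.
  rewrite ge0_fin_numE; first by rewrite (le_lt_trans Iup)// ltry.
  by apply: integral_ge0 => r /D0 r0; rewrite lee_fin F120.
have IE : I = ((2 * lam)^-1)%:E.
  apply/eqP; rewrite eq_le Iup/=.
  by move: Ilo; rewrite leeD2rE.
rewrite -/G; move: S1; rewrite IE; set J := integral _ _ _ => S1.
have -> : J = ((lam^-1 + lam^-1)%:E - ((2 * lam)^-1)%:E)%E by rewrite -S1 addeK.
rewrite -EFinB; congr EFin; field; exact: lt0r_neq0.
Qed.

Lemma mean_Zplus (B : R -> T -> R) (z : R -> T -> R) (t : R) : igi P sigma B ->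
  measurable_fun setT (z t) ->
  {ae P, forall w, is_Zplus beta (B^~ w) (z^~ w)} ->
  (\int[P]_w (z t w - B t w)%:E = (3 / 2 * lam^-1)%:E)%E.
Proof.
move=> hB mz hz.
have hB' := igi_rev s0 hB; set B' := fun t => B (- t) in hB'.
(* The positive part agrees with [z t w - B t w] almost surely and is nonnegative everywhere, as the
   tail formula requires. *)
pose f w := Num.max 0 (z t w - B t w).
have mf : measurable_fun setT f.
  by apply: measurable_maxr => //; apply: measurable_funB => //; exact: (igi_meas hB).
have f0 w : 0 <= f w by rewrite le_max lexx.
pose D1 r := Dev B beta t r; pose D2 r := Dev B' beta (- t) r.
have mD1 r : measurable (D1 r) by exact: (Dev_measurable hB).
have mD2 r : measurable (D2 r) by exact: (Dev_measurable hB').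
transitivity (\int[P]_w (f w)%:E)%E.
  apply: ae_eq_integral => //.
  - by apply/measurable_EFinP; apply: measurable_funB => //; exact: (igi_meas hB).
  - exact/measurable_EFinP.
  apply: filterS hz => w [[_ h] _] _; rewrite /f; case: leP => //.
  by rewrite subr_lt0 ltNge h.
rewrite (Ex_ccdf P mf f0).
(* Up to a null set, the majorant exceeds [B t] by more than [r] exactly when the drifted maximum
   does so in one of the two directions of time, and these two events are independent. *)
have U r : 0 <= r -> P [set w | r < f w] = (1 - (1 - Pr P (D1 r)) * (1 - Pr P (D2 r)))%:E.
  move=> r0; transitivity (P (D1 r `|` D2 r)).
    apply: ae_eq_Pr => //.
    - have := mf measurableT _ (measurable_itv `]r, +oo[); rewrite setTI.
      by congr measurable; apply/seteqP; split => w /=; rewrite in_itv/= andbT.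
    - exact: measurableU.
    apply: filterS2 hz (igi_cont hB) => w hw cw.
    have cw' : continuous (B'^~ w).
      by move=> x; apply: (continuous_comp (g := B^~ w)); [exact: opp_continuous|exact: cw].
    split.
      apply: contraPP => /not_orP[n1 n2]; apply/negP; rewrite -leNgt /f ge_max r0/=.
      rewrite lerBlDr; apply: (Zplus_le beta0 hw) => s; rewrite lerBlDr.
      have p1 := Dev_path cw n1; have p2 := Dev_path cw' n2.
      have [ts|st] := leP t s.
        have := p1 (s - t); rewrite subr_ge0 (_ : t + (s - t) = s); [move=> /(_ ts)|ring].
        by rewrite ger0_norm ?subr_ge0//; lra.
      have := p2 (t - s); rewrite subr_ge0 /B' opprK (_ : - (- t + (t - s)) = s); [move=> /(_ (ltW st))|ring].
      rewrite ltr0_norm ?subr_lt0//; lra.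
    rewrite /f [X in _ -> X]/= lt_max; move=> [] [n _ [j [jn h]]]; apply/orP; right.
      have := Zplus_ge hw (t + j%:R * 2 ^- n) t.
      have q0 : 0 <= j%:R * 2 ^- n :> R by rewrite mulr_ge0// invr_ge0 exprn_ge0.
      move: (j%:R * 2 ^- n) q0 h => q q0 h.
      by rewrite (_ : t + q - t = q) ?ger0_norm//; [lra|ring].
    have := Zplus_ge hw (- (- t + j%:R * 2 ^- n)) t.
    have q0 : 0 <= j%:R * 2 ^- n :> R by rewrite mulr_ge0// invr_ge0 exprn_ge0.
    move: (j%:R * 2 ^- n) q0 h => q q0; rewrite /B' (opprK t) => h.
    by rewrite (_ : - (- t + q) - t = - q) ?normrN ?ger0_norm//; [lra|ring].
  rewrite PrE; last exact: measurableU.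
  congr EFin.
  have -> : Pr P (D1 r `|` D2 r) = 1 - Pr P (~` D2 r `&` ~` D1 r).
    rewrite (_ : ~` D2 r `&` ~` D1 r = ~` (D1 r `|` D2 r)); last by rewrite setCU setIC.
    by rewrite PrC; [lra|exact: measurableU].
  have ind : P (~` D2 r `&` ~` D1 r) = (P (~` D2 r) * P (~` D1 r))%E.
    apply: (igi_indep hB (b := t)).
      apply: sigmaC; apply: (@incs_sub _ _ _ B [set u | - t <= - u] [set u | u <= t]).
        by move=> u /=; rewrite lerN2.
      exact: (@incs_rev _ _ _ B [set u | - t <= u] _ (@Dev_meas_wrt _ _ _ B' beta (- t) r)).
    by apply: sigmaC; exact: Dev_meas_wrt.
  have : (Pr P (~` D2 r `&` ~` D1 r))%:E = (Pr P (~` D2 r) * Pr P (~` D1 r))%:E.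
    by rewrite EFinM -!PrE ?ind//; try exact: measurableC; apply: measurableI; exact: measurableC.
  by move=> [->]; rewrite !PrC// mulrC.
transitivity (\int[lebesgue_measure]_(r in `[0%R, +oo[) (1 - (1 - Pr P (D1 r)) * (1 - Pr P (D2 r)))%:E)%E.
  by apply: eq_integral => r; rewrite inE/= in_itv/= andbT => r0; rewrite U.
apply: integral_Dev_union.
- exact: (Pr_Dev_measurable t hB).
- exact: (Pr_Dev_measurable (- t) hB').
- by move=> r r0; rewrite Pr_ge0 (Dev_tail s0 hB).
- by move=> r r0; rewrite Pr_ge0 (Dev_tail s0 hB').
- exact: integral_Dev.
- exact: integral_Dev.
Qed.

End mean_majorant.

(** * Logarithmic upper bound *)


Lemma limsup_eq {R : realType} (F : set_system R) (g : R -> R) (c : R) :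
  (forall c', c < c' -> F [set t | g t <= c']) ->
  (forall c', c' < c -> forall V, F V -> exists2 t, V t & c' <= g t) ->
  limf_esup (fun t => (g t)%:E) F = c%:E.
Proof.
move=> up lo; apply/eqP; rewrite eq_le limf_esupE; apply/andP; split.
  apply/lee_addgt0Pr => e e0.
  have ce : c < c + e by rewrite ltrDl.
  apply: (@le_trans _ _ (ereal_sup ((fun t => (g t)%:E) @` [set t | g t <= c + e]))).
    by apply: ereal_inf_lbound; exists [set t | g t <= c + e] => //; exact: up.
  by apply: ge_ereal_sup => _ [t /= gt <-]; rewrite -EFinD lee_fin.
apply: le_ereal_inf_tmp => _ [V FV <-].
apply/lee_subgt0Pr => e e0.
have ce : c - e < c by rewrite ltrBlDr ltrDl.
have [t Vt ct] := lo _ ce _ FV.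
by apply: le_ereal_sup_tmp; exists (g t)%:E; [exists t|rewrite -EFinB lee_fin].
Qed.

Lemma limsup_log_pinfty {R : realType} (f : R -> R) (c : R) :
  (forall c', c < c' -> exists T0, forall t, T0 <= t -> f t <= c' * ln t) ->
  (forall c', c' < c -> forall T0, exists2 t, T0 <= t & c' * ln t <= f t) ->
  limf_esup (fun t => (f t / ln t)%:E) (pinfty_nbhs R) = c%:E.
Proof.
move=> up lo; apply: limsup_eq => c' cc'.
  have [T0 h] := up _ cc'.
  exists (Num.max T0 1); split; first exact: num_real.
  move=> t; rewrite gt_max => /andP[Tt t1] /=.
  by rewrite ler_pdivrMr ?ln_gt0// h// ltW.
move=> V [M [_ MV]].
have [t] := lo _ cc' (Num.max (M + 1) 2); rewrite ge_max => /andP[Mt t2] ht.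
exists t; first by apply: MV; lra.
by rewrite ler_pdivlMr ?ln_gt0//; lra.
Qed.

Lemma limsup_log_ninfty {R : realType} (f : R -> R) (c : R) :
  (forall c', c < c' -> exists T0, forall t, T0 <= t -> f (- t) <= c' * ln t) ->
  (forall c', c' < c -> forall T0, exists2 t, T0 <= t & c' * ln t <= f (- t)) ->
  limf_esup (fun t => (f t / ln `|t|)%:E) (ninfty_nbhs R) = c%:E.
Proof.
move=> up lo; apply: limsup_eq => c' cc'.
  have [T0 h] := up _ cc'.
  exists (- Num.max T0 1); split; first exact: num_real.
  move=> t; rewrite ltrNr gt_max => /andP[Tt t1] /=.
  have nt : `|t| = - t by rewrite ltr0_norm//; lra.
  by rewrite nt ler_pdivrMr ?ln_gt0// -{1}(opprK t) h// ltW.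
move=> V [M [_ MV]].
have [t] := lo _ cc' (Num.max (- M + 1) 2); rewrite ge_max => /andP[Mt t2] ht.
exists (- t); first by apply: MV; lra.
by rewrite normrN ger0_norm ?ler_pdivlMr ?ln_gt0//; lra.
Qed.

Lemma ln_leB1 {R : realType} (x : R) : 0 < x -> ln x <= x - 1.
Proof.
move=> x0; have := @le_ln1Dx R (x - 1); rewrite (_ : 1 + (x - 1) = x); last by ring.
by apply; lra.
Qed.

Lemma sum_inv_pow {R : realType} (p : R) : 1 < p ->
  exists C, forall n, \sum_(k < n) expR (- p * ln k.+1%:R) <= C.
Proof.
move=> p1; set q := p - 1; have q0 : 0 < q by rewrite subr_gt0.
exists (1 + q^-1) => -[|n].
  by rewrite big_ord0 addr_ge0// invr_ge0 ltW.
(* The subtracted term carries the induction: it is the discrete form of comparing the sum with the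
   integral of [x] to the power [- p]. *)
suff : \sum_(k < n.+1) expR (- p * ln k.+1%:R) <= 1 + q^-1 - q^-1 * expR (- q * ln n.+1%:R).
  have : 0 <= q^-1 * expR (- q * ln n.+1%:R) by rewrite mulr_ge0 ?expR_ge0// invr_ge0 ltW.
  lra.
elim: n => [|n IH]; first by rewrite big_ord_recr big_ord0/= ln1 !mulr0 expR0; lra.
rewrite big_ord_recr/=.
have n0 : 0 < n.+1%:R :> R by rewrite ltr0n.
have n10 : 0 < n.+2%:R :> R by rewrite ltr0n.
set a := expR (- q * ln n.+2%:R).
have a0 : 0 < a by exact: expR_gt0.
have e1 : expR (- p * ln n.+2%:R) = a / n.+2%:R.
  rewrite -{2}[n.+2%:R](@lnK R) ?posrE// -expRN -expRD; congr expR; rewrite /q; ring.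
have l1 : n.+2%:R^-1 <= ln n.+2%:R - ln n.+1%:R :> R.
  have : ln (n.+1%:R / n.+2%:R) <= n.+1%:R / n.+2%:R - 1 :> R.
    by apply: ln_leB1; rewrite divr_gt0.
  rewrite ln_div ?posrE// => h.
  have : n.+1%:R / n.+2%:R = 1 - n.+2%:R^-1 :> R.
    by rewrite -{1}[n.+1%:R](addrK 1) natr1 mulrBl divff ?gt_eqF// mul1r.
  move=> e3; rewrite e3 addrAC subrr sub0r in h.
  by rewrite -lerN2 opprB.
have e2 : a * (1 + q * n.+2%:R^-1) <= expR (- q * ln n.+1%:R).
  have -> : expR (- q * ln n.+1%:R) = a * expR (q * (ln n.+2%:R - ln n.+1%:R)).
    by rewrite -expRD; congr expR; ring.
  rewrite ler_pM2l//; apply: le_trans (expR_ge1Dx _); rewrite lerD2l.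
  by rewrite ler_wpM2l// ltW.
have : q^-1 * (a * (1 + q * n.+2%:R^-1)) <= q^-1 * expR (- q * ln n.+1%:R).
  by rewrite ler_wpM2l// invr_ge0 ltW.
rewrite e1 (_ : q^-1 * (a * (1 + q * n.+2%:R^-1)) = q^-1 * a + a / n.+2%:R); last first.
  by field; rewrite !gt_eqF.
move=> h; apply: le_trans (lerD IH (lexx _)) _; rewrite -addrA lerD2l.
move: h; move: (q^-1 * expR _) (q^-1 * a) (a / _) => x y z; lra.
Qed.

Lemma ln_le_lin {R : realType} (e : R) : 0 < e -> exists C, forall t, 0 < t -> ln t <= e * t + C.
Proof.
move=> e0; exists (- 1 - ln e) => t t0.
have := ln_leB1 (mulr_gt0 e0 t0); rewrite lnM ?posrE//; lra.
Qed.

Section borel_cantelli.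
Context {d : measure_display} {T : measurableType d} {R : realType}.
Variables (P : probability T R).

Lemma BC1 (A : nat -> set T) (C : R) : (forall k, measurable (A k)) ->
  (forall n, \sum_(k < n) Pr P (A k) <= C) ->
  {ae P, forall w, exists N, forall k, (N <= k)%N -> ~ A k w}.
Proof.
move=> mA hC.
exists (lim_sup_set A); split.
- by apply: bigcap_measurable => // n _; apply: bigcup_measurable => k _.
- apply: lim_sup_set_cvg0 => //.
  apply: (@le_lt_trans _ _ C%:E); last exact: ltry.
  apply: lime_le; first exact: is_cvg_nneseries.
  apply: nearW => n; rewrite big_mkord.
  have -> : (\sum_(k < n) P (A k) = (\sum_(k < n) Pr P (A k))%:E)%E.
    by rewrite -sumEFin; apply: eq_bigr => k _; rewrite PrE.
  by rewrite lee_fin.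
- move=> w /= h n _; apply: contrapT => hn; apply: h; exists n => k nk Ak.
  by apply: hn; exists k.
Qed.

Variables (sigma : R) (s0 : 0 < sigma).

(** The level [c * ln (k + 1)] is exceeded with probability at most [k + 1] to the power
    [- 2 * th * c / sigma ^+ 2], which is summable. *)
Lemma ev_Dev (B : R -> T -> R) (u : nat -> R) (th c : R) : igi P sigma B -> 0 < th ->
  1 < 2 * th / sigma ^+ 2 * c ->
  {ae P, forall w, exists N, forall k, (N <= k)%N -> forall r, 0 <= r ->
     B (u k + r) w - B (u k) w - th * r <= c * ln k.+1%:R}.
Proof.
move=> hB th0 hc.
have [C hC] := sum_inv_pow hc.
have bc := @BC1 (fun k => Dev B th (u k) (c * ln k.+1%:R)) C _ _.
have {bc} : {ae P, forall w, exists N, forall k, (N <= k)%N -> ~ Dev B th (u k) (c * ln k.+1%:R) w}.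
  apply: bc; first by move=> k; exact: (Dev_measurable hB).
  move=> n; apply: le_trans (hC n); apply: ler_sum => k _.
  apply: le_trans (Dev_tail s0 hB _ _ th0) _.
  by rewrite ler_expR mulrA !mulNr.
apply: filterS2 (igi_cont hB) => w cw [N hN]; exists N => k /hN nD.
exact: Dev_path.
Qed.

End borel_cantelli.

Section upper_path.
Context {R : realType}.

(** Bounding the rise to [s] and the fall to [u] separately from [t] would cost two full logarithms.
    To pay only [c1 + c3] with [c3] small, the path is compared with its value at the integer [k]
    just before [u]: the rise from [k] costs [c1], and the fall from [k] to [u] lasts less than one
    unit of time, so a steep slope [th] with a small coefficient suffices. For [u] farther than
    [t / 2] from [t] the spare slope [beta / 2] beats every logarithm. *)
Lemma upper_path (beta c1 c2 c3 th : R) (b : R -> R) (N : nat) :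
  0 < beta -> 0 <= c1 -> 0 <= c2 -> 0 <= c3 ->
  (forall k, (N <= k)%N -> forall s, b s - b k%:R - beta * `|s - k%:R| <= c1 * ln k.+1%:R) ->
  (forall k, (N <= k)%N -> forall s, b k%:R - b s - beta / 2 * `|s - k%:R| <= c2 * ln k.+1%:R) ->
  (forall k, (N <= k)%N -> forall s, k%:R <= s -> b k%:R - b s - th * (s - k%:R) <= c3 * ln k.+1%:R) ->
  0 < th ->
  forall c, c1 + c3 < c -> exists T0, forall t, T0 <= t -> forall s u,
    b s - b u - beta * `|s - t| - beta * `|u - t| <= c * ln t.
Proof.
move=> b0 c10 c20 c30 h1 h2 h3 th0 c hc.
pose D := c - (c1 + c3); have D0 : 0 < D by rewrite subr_gt0.
pose A := c1 + c2; have A0 : 0 <= A by rewrite addr_ge0.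
have e0 : 0 < beta / 8 / (A + 1) by rewrite !divr_gt0// ltr_wpDl.
have [C hC] := ln_le_lin e0.
(* [T1] lets [D * ln t] absorb the bounded terms when [u] is near [t]; [T2] lets [beta / 8 * t]
   absorb them when [u] is far. *)
pose T1 := expR ((c1 + c3 + beta + th) / D).
pose T2 := (A * (1 + C) + 2 * beta) * 8 / beta.
exists (Num.max (2 * (N%:R + 2)) (Num.max T1 T2)) => t; rewrite !ge_max => /and3P[tN tT1 tT2] s u.
have N0 : 0 <= N%:R :> R by exact: ler0n.
have t4 : 4 <= t by lra.
have t0 : 0 < t by lra.
have ln2 : ln (2 * t) <= 1 + ln t.
  rewrite lnM ?posrE// lerD2r; have := @le_ln1Dx R 1; rewrite (_ : 1 + 1 = 2)//; apply; lra.
have lnt0 : 0 <= ln t by rewrite ln_ge0//; lra.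
have ks (k : nat) (v : R) : k%:R <= v -> v + 1 <= 2 * t -> ln k.+1%:R <= 1 + ln t.
  move=> kv vt; apply: le_trans ln2; rewrite ler_ln ?posrE ?ltr0n//; last by lra.
  by rewrite -natr1; lra.
have tri (x y z : R) : `|x - z| <= `|x - y| + `|y - z|.
  by rewrite (le_trans _ (ler_normD _ _))// addrA subrK.
have [near|far] := leP `|u - t| (t / 2).
  have /andP[nu1 nu2] : t / 2 <= u <= 3 / 2 * t.
    by move: near; rewrite ler_norml => /andP[? ?]; apply/andP; split; lra.
  have u0 : 0 <= u by lra.
  have /Num.Theory.truncn_itv/andP[k1 k2] := u0.
  set k := Num.truncn u in k1 k2.
  have Nk : (N <= k)%N by rewrite -ltnS -(ltr_nat R); lra.
  have l := ks k u k1 ltac:(lra).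
  have a1 := h1 k Nk s; have a3 := h3 k Nk u k1.
  rewrite -natr1 in k2.
  have dk : `|u - k%:R| <= 1 by rewrite ger0_norm ?subr_ge0//; lra.
  have t1 := tri s t k%:R; have t2 := tri t u k%:R; rewrite (distrC t u) in t2.
  have m1 : beta * `|s - k%:R| <= beta * (`|s - t| + `|u - t| + 1).
    by rewrite ler_pM2l//; clear -t1 t2 dk; lra.
  have m3 : th * (u - k%:R) <= th by rewrite ler_piMr ?(ltW th0)//; clear -k2; lra.
  have m4 : (c1 + c3) * ln k.+1%:R <= (c1 + c3) * (1 + ln t) by rewrite ler_wpM2l// addr_ge0.
  have m5 : c1 + c3 + beta + th <= D * ln t.
    rewrite mulrC -ler_pdivrMr// -(expRK (_ / D)) ler_ln ?posrE ?expR_gt0//.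
  rewrite /D in m5; clear -a1 a3 m1 m3 m4 m5; lra.
have t0' := ltW t0.
have /Num.Theory.truncn_itv/andP[k1 k2] := t0'.
set k := Num.truncn t in k1 k2.
have Nk : (N <= k)%N by rewrite -ltnS -(ltr_nat R); lra.
have l := ks k t k1 ltac:(lra).
rewrite -natr1 in k2.
have a1 := h1 k Nk s; have a2 := h2 k Nk u.
have dk : `|t - k%:R| <= 1 by rewrite ger0_norm ?subr_ge0//; lra.
have t1 := tri s t k%:R; have t2 := tri u t k%:R.
have m1 : beta * `|s - k%:R| <= beta * (`|s - t| + 1) by rewrite ler_pM2l//; clear -t1 dk; lra.
have m2 : beta / 2 * `|u - k%:R| <= beta / 2 * (`|u - t| + 1) by rewrite ler_pM2l ?divr_gt0//; clear -t2 dk; lra.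
have m3 : A * ln k.+1%:R <= A * (1 + ln t) by rewrite ler_wpM2l.
have m4 : A * ln t <= beta / 8 * t + A * C.
  have := hC t t0 => h; have : A * ln t <= A * (beta / 8 / (A + 1) * t + C) by rewrite ler_wpM2l.
  suff : A * (beta / 8 / (A + 1) * t) <= beta / 8 * t by rewrite mulrDr; clear; lra.
  rewrite mulrA ler_pM2r// mulrCA ler_piMr ?divr_ge0 ?(ltW b0)//.
  by rewrite ler_pdivrMr ?mul1r ?ltr_wpDl//; clear -A0; lra.
have m5 : A * (1 + C) + 2 * beta <= beta / 8 * t.
  by move: tT2; rewrite /T2 ler_pdivrMr//; lra.
have m6 : beta / 2 * (t / 2) <= beta / 2 * `|u - t| by rewrite ler_pM2l ?divr_gt0// ltW.
have m7 : 0 <= c * ln t by rewrite mulr_ge0//; clear -hc c10 c30; lra.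
rewrite /A in m3 m4 m5; clear -b0 a1 a2 m1 m2 m3 m4 m5 m6 m7; lra.
Qed.

End upper_path.

Section upper.
Context {d : measure_display} {T : measurableType d} {R : realType}.
Variables (P : probability T R) (sigma : R) (s0 : 0 < sigma).
Variables (beta : R) (beta0 : 0 < beta).

Lemma ae_upper (B : R -> T -> R) : igi P sigma B ->
  {ae P, forall w, forall c, sigma ^+ 2 / (2 * beta) < c -> exists T0, forall t, T0 <= t ->
    forall s u, B s w - B u w - beta * `|s - t| - beta * `|u - t| <= c * ln t}.
Proof.
move=> hB; set il := sigma ^+ 2 / (2 * beta).
have s20 : 0 < sigma ^+ 2 by rewrite exprn_gt0.
have il0 : 0 < il by rewrite divr_gt0// mulr_gt0.
have hBr := igi_rev s0 hB; have hN := igiN s0 hB; have hNr := igiN s0 hBr.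
pose e (m : nat) : R := m.+1%:R^-1.
have e0 m : 0 < e m by rewrite invr_gt0 ltr0n.
(* This slope makes the exponent [2 * th / sigma ^+ 2 * e] equal to 2, above the threshold 1 of
   [ev_Dev]; so does the coefficient [2 * sigma ^+ 2 / beta] for slope [beta / 2] in [p2]. *)
pose th m := sigma ^+ 2 / e m.
have th0 m : 0 < th m by rewrite divr_gt0.
have p1 m : 1 < 2 * beta / sigma ^+ 2 * (il + e m).
  rewrite mulrDr (_ : _ * il = 1); last by rewrite /il; field; rewrite !gt_eqF.
  by rewrite ltrDl mulr_gt0// divr_gt0// mulr_gt0.
have b20 : 0 < beta / 2 by rewrite divr_gt0.
have p2 : 1 < 2 * (beta / 2) / sigma ^+ 2 * (2 * sigma ^+ 2 / beta).
  rewrite (_ : _ * _ = 2) ?ltr1n//; field; rewrite !gt_eqF//.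
have p3 m : 1 < 2 * th m / sigma ^+ 2 * e m.
  rewrite (_ : _ * _ = 2) ?ltr1n// /th; field; rewrite !gt_eqF//.
have u1 : {ae P, forall w m, exists N, forall k, (N <= k)%N -> forall r, 0 <= r ->
     B (k%:R + r) w - B k%:R w - beta * r <= (il + e m) * ln k.+1%:R}.
  by apply: ae_count => m; exact: (ev_Dev s0 (fun k => k%:R) hB beta0 (p1 m)).
have u2 : {ae P, forall w m, exists N, forall k, (N <= k)%N -> forall r, 0 <= r ->
     B (- (- k%:R + r)) w - B (- (- k%:R)) w - beta * r <= (il + e m) * ln k.+1%:R}.
  by apply: ae_count => m; exact: (ev_Dev s0 (fun k => - k%:R) hBr beta0 (p1 m)).
have u3 := ev_Dev s0 (fun k => k%:R) hN b20 p2.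
have u4 := ev_Dev s0 (fun k => - k%:R) hNr b20 p2.
have u5 : {ae P, forall w m, exists N, forall k, (N <= k)%N -> forall r, 0 <= r ->
     - B (k%:R + r) w - - B k%:R w - th m * r <= e m * ln k.+1%:R}.
  by apply: ae_count => m; exact: (ev_Dev s0 (fun k => k%:R) hN (th0 m) (p3 m)).
apply: filterS2 (filterI u1 u2) (filterI (filterI u3 u4) u5) => w [v1 v2] [[[N3 v3] [N4 v4]] v5].
move=> c hc.
have dc : 0 < (c - il) / 2 by rewrite divr_gt0// subr_gt0.
have ic : 0 <= ((c - il) / 2)^-1 by rewrite invr_ge0 ltW.
have /Num.Theory.truncn_itv/andP[_ k2] := ic.
set m := Num.truncn _ in k2.
have em : e m < (c - il) / 2 by rewrite /e -(invrK ((c - il) / 2)) ltf_pV2 ?posrE ?invr_gt0 ?ltr0n.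
have [N1 {}v1] := v1 m; have [N2 {}v2] := v2 m; have [N5 {}v5] := v5 m.
pose N := maxn N1 (maxn N2 (maxn N3 (maxn N4 N5))).
apply: (@upper_path _ beta (il + e m) (2 * sigma ^+ 2 / beta) (e m) (th m) (B^~ w) N) => //.
- by rewrite addr_ge0// ltW.
- by rewrite divr_ge0 ?mulr_ge0// ltW.
- exact: ltW.
- move=> k; rewrite /N !geq_max => /and5P[n1 n2 n3 n4 n5] s; have [ks|sk] := leP k%:R s.
    have := v1 k n1 (s - k%:R); rewrite subr_ge0 => /(_ ks).
    by rewrite (_ : k%:R + (s - k%:R) = s) ?ger0_norm ?subr_ge0//; ring.
  have := v2 k n2 (k%:R - s); rewrite subr_ge0 => /(_ (ltW sk)).
  rewrite (_ : - (- k%:R + (k%:R - s)) = s) ?opprK ?ltr0_norm ?subr_lt0 ?opprB//; ring.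
- move=> k; rewrite /N !geq_max => /and5P[n1 n2 n3 n4 n5] s; have [ks|sk] := leP k%:R s.
    have := v3 k n3 (s - k%:R); rewrite subr_ge0 => /(_ ks).
    by rewrite (_ : k%:R + (s - k%:R) = s) ?ger0_norm ?subr_ge0//; [lra|ring].
  have := v4 k n4 (k%:R - s); rewrite subr_ge0 => /(_ (ltW sk)).
  by rewrite (_ : - (- k%:R + (k%:R - s)) = s) ?opprK ?ltr0_norm ?subr_lt0 ?opprB//; [lra|ring].
- move=> k; rewrite /N !geq_max => /and5P[n1 n2 n3 n4 n5] s ks.
  have := v5 k n5 (s - k%:R); rewrite subr_ge0 => /(_ ks).
  by rewrite (_ : k%:R + (s - k%:R) = s) ?ger0_norm ?subr_ge0//; [lra|ring].
- lra.
Qed.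

End upper.

(** * Logarithmic lower bound *)


(** The solution climbs at most [y] while [b] climbs [2 * y], so it is overtaken. It then falls at
    speed [beta] under a path that falls at speed at most [beta / 2] and gives up at most half of
    its lead [h]. *)
Lemma lower_path {R : realType} (beta y h L u : R) (b x : R -> R) :
  0 < beta -> 0 < h -> 0 <= y -> 0 <= L -> continuous b -> bsol beta b x ->
  (forall s t, `|x s - x t| <= beta * `|s - t|) ->
  2 * y <= b (u + y / beta) - b u ->
  beta + h <= b (u + y / beta + 1) - b (u + y / beta) ->
  (forall r, 0 <= r <= L -> - (b (u + y / beta + 1 + r) - b (u + y / beta + 1)) - beta / 2 * r <= h / 2) ->
  x u <= b u + y ->
  beta * L / 2 <= b (u + y / beta + 1 + L) - x (u + y / beta + 1 + L).
Proof.
move=> b0 h0 y0 L0 cb sx lx e1 e2 e3 xu.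
set v := u + y / beta + 1.
have xv : x v <= b v - h.
  have := lx (u + y / beta) u; rewrite (_ : u + y / beta - u = y / beta); last by ring.
  rewrite (ger0_norm (divr_ge0 y0 (ltW b0))) (_ : beta * (y / beta) = y); last by field; rewrite gt_eqF.
  move=> /ler_normlW l1.
  have := lx v (u + y / beta); rewrite /v (_ : u + y / beta + 1 - (u + y / beta) = 1); last by ring.
  rewrite normr1 mulr1 => /ler_normlW l2; lra.
have cNb : continuous (fun t => - b t) by move=> t; apply: cvgN; exact: cb.
have := @escape_up _ beta (fun t => - b t) (fun t => - x t) v (v + L) cNb (bsolN sx).
have -> : v + L - v = L by ring.
move=> h1.
have {h1} : - x (v + L) = - x v + beta * L.
  apply: h1; [lra|lra|].
  move=> s /andP[vs sL].
  have := e3 (s - v); rewrite -/v (_ : v + (s - v) = s); last by ring.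
  have r0 : 0 <= s - v by rewrite subr_ge0.
  have -> : 0 <= s - v <= L by apply/andP; split; lra.
  move=> /(_ isT).
  have : 0 <= beta * (s - v) by rewrite mulr_ge0// ltW.
  lra.
have := e3 L; rewrite -/v L0 lexx => /(_ isT).
lra.
Qed.

Lemma side_range {R : realType} (sg : bool) (M t : R) : 0 <= M ->
  (if sg then M else - (2 * M)) <= t -> t <= (if sg then M else - (2 * M)) + M ->
  M <= `|t| <= 2 * M /\ t = if sg then `|t| else - `|t|.
Proof.
move=> M0; case: sg => t1 t2.
  by rewrite ger0_norm; [split => //; apply/andP; split|]; lra.
by rewrite ler0_norm ?opprK; [split => //; apply/andP; split|]; lra.
Qed.

Lemma ln_range {R : realType} (M t : R) : 1 <= M -> M <= t <= 2 * M -> 0 <= ln t <= 1 + ln M.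
Proof.
move=> M1 /andP[t1 t2]; have M0 : 0 < M by lra.
rewrite ln_ge0/=; last by lra.
apply: (@le_trans _ _ (ln (2 * M))); first by rewrite ler_ln ?posrE//; lra.
by rewrite lnM ?posrE// lerD2r; have := @le_ln1Dx R 1; rewrite (_ : 1 + 1 = 2)//; apply; lra.
Qed.

Section lower_event.
Context {d : measure_display} {T : measurableType d} {R : realType}.
Variables (P : probability T R) (sigma : R) (s0 : 0 < sigma).
Variables (beta : R) (beta0 : 0 < beta).
Variables (B : R -> T -> R) (hB : igi P sigma B).

Lemma PrI_igi (b : R) A C : incs B [set t | t <= b] A -> incs B [set t | b <= t] C ->
  Pr P (A `&` C) = Pr P A * Pr P C.
Proof.
move=> hA hC; have mA := incs_measurable (igi_meas hB) hA; have mC := incs_measurable (igi_meas hB) hC.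
apply: EFin_inj; rewrite EFinM -!PrE//; last exact: measurableI.
exact: (igi_indep hB hA hC).
Qed.

Lemma incsW (I J : set R) A : incs B I A -> I `<=` J -> incs B J A.
Proof. by move=> h IJ; exact: (incs_sub IJ h). Qed.

Lemma igi_step (u r : R) : 0 < r -> gaussian P (sigma * Num.sqrt r) (fun w => B (u + r) w - B u w).
Proof.
move=> r0; have ur : u < u + r by rewrite ltrDl.
by have := igi_law hB ur; rewrite (_ : u + r - u = r)//; ring.
Qed.

(* The minimum with [L] keeps the event in the sigma-algebra of [v, v + L]. *)
Definition dip (h v L : R) : set T := \bigcup_n \bigcup_j
  [set w | h / 2 < - (B (v + Num.min (j%:R * 2 ^- n) L) w - B v w) - beta / 2 * Num.min (j%:R * 2 ^- n) L].

Lemma dip_incs h v L : 0 <= L -> incs B [set t | v <= t <= v + L] (dip h v L).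
Proof.
move=> L0; apply: sigma_bigcup => n; apply: sigma_bigcup => j.
set q := Num.min _ _.
have q0 : 0 <= q by rewrite le_min L0 mulr_ge0// invr_ge0 exprn_ge0.
have qL : q <= L by rewrite ge_min lexx orbT.
rewrite (_ : [set w | _] = [set w | B (v + q) w - B v w < - (h / 2) - beta / 2 * q]); last first.
  by apply/seteqP; split => w /=; lra.
by apply: sigma_lt; apply: incs_inc => /=; apply/andP; split; lra.
Qed.

Lemma dip_path h v L w : continuous (B^~ w) -> 0 <= L -> ~ dip h v L w ->
  forall r, 0 <= r <= L -> - (B (v + r) w - B v w) - beta / 2 * r <= h / 2.
Proof.
move=> cw L0 nD r /andP[r0 rL]; rewrite leNgt; apply/negP => lt; apply: nD.
pose f r := - (B (v + Num.min r L) w - B v w) - beta / 2 * Num.min r L.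
have cm : continuous (fun r : R => Num.min r L).
  by move=> y; apply: continuous_min; [exact: cvg_id|exact: cvg_cst].
have cf : continuous f.
  move=> y; apply: cvgB; last by apply: cvgM; [exact: cvg_cst|exact: cm].
  apply: cvgN; apply: cvgB; last exact: cvg_cst.
  apply: (continuous_comp (f := fun r : R => v + Num.min r L) (g := B^~ w)); last exact: cw.
  by apply: cvgD; [exact: cvg_cst|exact: cm].
have fr : h / 2 < f r by rewrite /f min_l.
have [n [j [_ hj]]] := dyadic_witness cf r0 fr.
by exists n => //; exists j.
Qed.

Lemma dip_prob h v L : 0 <= L -> Pr P (dip h v L) <= expR (- (beta / sigma ^+ 2 * (h / 2))).
Proof.
move=> L0; have hN := igiN s0 hB; have b20 : 0 < beta / 2 by rewrite divr_gt0.
have -> : - (beta / sigma ^+ 2 * (h / 2)) = - (2 * (beta / 2) / sigma ^+ 2) * (h / 2) by field; rewrite gt_eqF.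
apply: le_trans (Dev_tail s0 hN v (h / 2) b20).
apply: le_Pr_ae => //; [exact: (incs_measurable (igi_meas hB) (@dip_incs h v L L0))|exact: (Dev_measurable hN)|].
apply: filterS (igi_cont hN) => w cw [n _ [j _ /= lt]]; apply: contrapT => nD.
have := Dev_path cw nD; move: lt; set q := Num.min _ _ => lt.
have q0 : 0 <= q by rewrite le_min L0 mulr_ge0// invr_ge0 exprn_ge0.
by move=> /(_ q q0); lra.
Qed.

(* B climbs twice as fast as a solution can, gets [h] ahead of it, and then stays above its descending
   continuation until time [L]: a solution below B u + y at time u ends up far below B. *)
Definition jump (u y h L : R) : set T :=
  [set w | 2 * y <= B (u + y / beta) w - B u w] `&`
  [set w | beta + h <= B (u + y / beta + 1) w - B (u + y / beta) w] `&`
  ~` dip h (u + y / beta + 1) L.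

Lemma jump_incs u y h L : 0 <= y -> 0 <= L ->
  incs B [set t | u <= t <= u + y / beta + 1 + L] (jump u y h L).
Proof.
move=> y0 L0; have yb : 0 <= y / beta by rewrite divr_ge0// ltW.
apply: sigmaI; first apply: sigmaI.
- by apply: sigma_ge; apply: incs_inc => /=; apply/andP; split; lra.
- by apply: sigma_ge; apply: incs_inc => /=; apply/andP; split; lra.
- apply: sigmaC; apply: (@incsW _ _ _ (@dip_incs h (u + y / beta + 1) L L0)) => t /= /andP[? ?].
  by apply/andP; split; lra.
Qed.

(** To gain [y] on a line of slope [beta] within time [r], the path must rise by [y + beta * r], at
    Gaussian cost [(y + beta * r) ^+ 2 / (2 * sigma ^+ 2 * r)]. The minimum is at [r = y / beta],
    with rise [2 * y] and cost [lam * y], the rate of the upper bound. The other two parts of a jump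
    have probabilities bounded below. *)
Lemma jump_prob : exists h c : R, [/\ 0 < h, 0 < c & forall u y L, 1 <= y -> 0 <= L ->
  c * expR (- (2 * beta / sigma ^+ 2) * y) / y <= Pr P (jump u y h L)].
Proof.
have s20 : 0 < sigma ^+ 2 by rewrite exprn_gt0.
set lam := 2 * beta / sigma ^+ 2; have lam0 : 0 < lam by rewrite divr_gt0// mulr_gt0.
(* Chosen so that the bound of [dip_prob] is exactly [1 / 2]. *)
pose h := 2 * sigma ^+ 2 * ln 2 / beta.
have h0 : 0 < h by rewrite divr_gt0// !mulr_gt0// ln_gt0// ltr1n.
pose c2 := (3 * sigma)^-1 * expR (- ((beta + h + 1) ^+ 2 / (2 * sigma ^+ 2))).
have c20 : 0 < c2 by rewrite mulr_gt0 ?expR_gt0// invr_gt0 mulr_gt0.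
pose sb := Num.sqrt beta^-1.
have sb0 : 0 < sb by rewrite sqrtr_gt0 invr_gt0.
pose c1 := (3 * (sigma * sb))^-1 * expR (- (2 * lam)).
have c10 : 0 < c1 by rewrite mulr_gt0 ?expR_gt0// invr_gt0 !mulr_gt0.
exists h, (c1 * c2 / 2); split => //; first by rewrite divr_gt0// mulr_gt0.
move=> u y L y1 L0; have y0 : 0 < y by lra.
have yb : 0 < y / beta by rewrite divr_gt0.
set A1 := [set w | 2 * y <= B (u + y / beta) w - B u w].
set A2 := [set w | beta + h <= B (u + y / beta + 1) w - B (u + y / beta) w].
have g1 : gaussian P (sigma * Num.sqrt (y / beta)) (fun w => B (u + y / beta) w - B u w).
  exact: igi_step.
have g2 : gaussian P sigma (fun w => B (u + y / beta + 1) w - B (u + y / beta) w).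
  by have := igi_step (u + y / beta) ltr01; rewrite sqrtr1 mulr1.
have yb' := ltW yb.
have -> : Pr P (jump u y h L) = Pr P A1 * Pr P A2 * Pr P (~` dip h (u + y / beta + 1) L).
  rewrite /jump -/A1 -/A2 (@PrI_igi (u + y / beta + 1)).
  - congr (_ * _); apply: (@PrI_igi (u + y / beta)); apply: sigma_ge; apply: incs_inc => /=; lra.
  - by apply: sigmaI; apply: sigma_ge; apply: incs_inc => /=; lra.
  - apply: sigmaC; apply: (@incsW _ _ _ (@dip_incs h (u + y / beta + 1) L L0)) => t /= /andP[//].
have p1 : c1 * expR (- lam * y) / y <= Pr P A1.
  have ss : 0 < sigma * Num.sqrt (y / beta) by rewrite mulr_gt0// sqrtr_gt0.
  apply: le_trans (gaussian_tail_ge ss g1 _); last by rewrite mulr_ge0// ltW.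
  rewrite exprMn (sqr_sqrtr yb') sqrtrM ?(ltW y0)// -/sb.
  set r := Num.sqrt y.
  have r0 : 0 < r by rewrite sqrtr_gt0.
  have ry : r <= y.
    have r2 : r ^+ 2 = y by rewrite sqr_sqrtr// ltW.
    have r1 : 1 <= r by rewrite -(@ler_pXn2r _ 2) ?nnegrE ?(ltW r0)// expr1n r2.
    by rewrite -r2 expr2 ler_peMl// ltW.
  rewrite /c1 -[_ * expR _ * expR _]mulrA -expRD mulrAC.
  rewrite (_ : 1 / (3 * (sigma * (r * sb))) = (3 * (sigma * sb))^-1 / r); last first.
    by field; rewrite !gt_eqF.
  apply: ler_pM; rewrite ?expR_ge0 ?mulr_ge0 ?invr_ge0 ?mulr_ge0 ?(ltW s0) ?(ltW sb0) ?(ltW y0)//.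
    rewrite ler_pM2l ?invr_gt0 ?mulr_gt0// lef_pV2 ?posrE//.
  rewrite ler_expR.
  (* The [+ 1] of [gaussian_tail_ge] changes the exponent by at most [2 * lam], which is part of
     [c1]. *)
  have -> : - (2 * y + 1) ^+ 2 / (2 * (sigma ^+ 2 * (y / beta))) = - (lam * y + lam + lam / (4 * y)).
    by rewrite /lam; field; rewrite !gt_eqF.
  have : lam / (4 * y) <= lam by rewrite ler_pdivrMr ?mulr_gt0// ler_peMr ?(ltW lam0)//; lra.
  lra.
have p2 : c2 <= Pr P A2.
  have bh : 0 <= beta + h by apply: addr_ge0; exact: ltW.
  by have := gaussian_tail_ge s0 g2 bh; rewrite /c2 div1r mulNr.
have p3 : 2^-1 <= Pr P (~` dip h (u + y / beta + 1) L).
  have md : measurable (dip h (u + y / beta + 1) L).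
    exact: (incs_measurable (igi_meas hB) (@dip_incs h (u + y / beta + 1) L L0)).
  rewrite PrC//; suff : Pr P (dip h (u + y / beta + 1) L) <= 2^-1 by lra.
  have e2 : expR (- (beta / sigma ^+ 2 * (h / 2))) = 2^-1 :> R.
    rewrite (_ : beta / sigma ^+ 2 * (h / 2) = ln 2) ?expRN ?lnK ?posrE ?ltr0n//.
    by rewrite /h; field; rewrite !gt_eqF.
  by rewrite -e2; exact: dip_prob.
have p10 : 0 <= c1 * expR (- lam * y) / y.
  by apply: divr_ge0; [apply: mulr_ge0; [exact: ltW|exact: expR_ge0]|exact: ltW].
have := ler_pM (mulr_ge0 p10 (ltW c20)) _ (ler_pM p10 (ltW c20) p1 p2) p3.
rewrite invr_ge0 ler0n => /(_ isT); apply: le_trans.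
rewrite le_eqVlt; apply/orP; left; apply/eqP; ring.
Qed.

Lemma no_jump_measurable (a l y h L : R) (N : nat) : 0 <= y -> 0 <= L -> y / beta + 1 + L <= l ->
  incs B [set t | t <= a + N%:R * l]
    [set w | forall i, (i < N)%N -> ~ jump (a + i%:R * l) y h L w].
Proof.
move=> y0 L0 hl.
have l0 : 0 <= l by apply: le_trans hl; rewrite addr_ge0// addr_ge0// divr_ge0// ltW.
rewrite (_ : [set w | _] = \bigcap_i (if (i < N)%N then ~` jump (a + i%:R * l) y h L else setT)).
  apply: sigma_bigcap => i; case: ifP => iN; last exact: sigmaT.
  apply: sigmaC; apply: (@incsW _ _ _ (@jump_incs (a + i%:R * l) y h L y0 L0)) => t /= /andP[_ ht].
  apply: (le_trans ht); apply: (@le_trans _ _ (a + i.+1%:R * l)).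
    by rewrite -natr1 mulrDl mul1r; lra.
  by rewrite lerD2l ler_wpM2r// ler_nat.
apply/seteqP; split => w /= hw i.
  by move=> _; case: ifP => // iN; exact: hw.
by move=> iN; have := hw i I; rewrite iN.
Qed.

Lemma no_jump_prob (a l y h L p : R) (N : nat) : 0 <= y -> 0 <= L -> y / beta + 1 + L <= l ->
  0 <= p -> p <= 1 -> (forall u, p <= Pr P (jump u y h L)) ->
  Pr P [set w | forall i, (i < N)%N -> ~ jump (a + i%:R * l) y h L w] <= (1 - p) ^+ N.
Proof.
move=> y0 L0 hl p0 p1 hp; elim: N => [|N IH].
  by rewrite expr0 Pr_le1//; apply: (incs_measurable (igi_meas hB) (@no_jump_measurable a l y h L 0 y0 L0 hl)).
have mj u : measurable (jump u y h L) by exact: (incs_measurable (igi_meas hB) (@jump_incs u y h L y0 L0)).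
rewrite (_ : [set w | _] = [set w | forall i, (i < N)%N -> ~ jump (a + i%:R * l) y h L w] `&`
   ~` jump (a + N%:R * l) y h L).
  rewrite (@PrI_igi (a + N%:R * l)).
  - rewrite exprSr; apply: ler_pM; rewrite ?Pr_ge0// PrC//; have := hp (a + N%:R * l); lra.
  - exact: no_jump_measurable.
  - apply: sigmaC; apply: (@incsW _ _ _ (@jump_incs (a + N%:R * l) y h L y0 L0)) => t /= /andP[//].
apply/seteqP; split => w /=.
  by move=> hw; split; [move=> i iN; apply: hw; exact: ltnW|exact: hw].
by move=> [hw hN] i; rewrite ltnS leq_eqVlt => /orP[/eqP->//|]; exact: hw.
Qed.

(* e^(y / kap) / y disjoint blocks are available below level e^(y / kap), each successful with
   probability of order e^(- 2 beta y / sigma^2) / y. *)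
Lemma ae_jump (kap : R) (a : R -> R) : 0 < kap -> kap < sigma ^+ 2 / (2 * beta) ->
  exists2 h, 0 < h & forall K, 0 < K -> {ae P, forall w m0, exists m u,
    [/\ (m0 <= m)%N, a (expR (m%:R / kap)) <= u,
        u + (m%:R / beta + 1 + K * m%:R) <= a (expR (m%:R / kap)) + expR (m%:R / kap) &
        jump u m%:R h (K * m%:R) w]}.
Proof.
move=> k0 kil; have [h [c [h0 c0 hc]]] := jump_prob; exists h => // K K0.
have s20 : 0 < sigma ^+ 2 by rewrite exprn_gt0.
set lam := 2 * beta / sigma ^+ 2 in hc; have lam0 : 0 < lam by rewrite divr_gt0// mulr_gt0.
(* Exponential rate of the expected number of jumps among the blocks; positive because
   [kap < 1 / lam]. *)
pose g := kap^-1 - lam.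
have g0 : 0 < g.
  rewrite subr_gt0 -[lam]invrK ltf_pV2 ?posrE ?invr_gt0//.
  by rewrite /lam invf_div.
pose M (m : nat) := expR (m%:R / kap); pose l (m : nat) := m%:R / beta + 1 + K * m%:R.
pose N m := Num.truncn (M m / l m).
pose NE m := [set w | forall i, (i < N m)%N -> ~ jump (a (M m) + i%:R * l m) m%:R h (K * m%:R) w].
have Km m : 0 <= K * m%:R by rewrite mulr_ge0// ltW.
have mb m : 0 <= m%:R / beta by rewrite divr_ge0// ltW.
have l0 m : 0 < l m by rewrite ltr_wpDr// ltr_wpDl.
have mNE m : measurable (NE m).
  exact: (incs_measurable (igi_meas hB) (@no_jump_measurable (a (M m)) (l m) m%:R h (K * m%:R) (N m) _ (Km m) (lexx _))).
have small e m0 : 0 < e -> exists2 m, (m0 <= m)%N & Pr P (NE m) <= e.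
  move=> e0; pose K2 := beta^-1 + 1 + K.
  have K20 : 0 < K2 by rewrite addr_gt0// addr_gt0// invr_gt0.
  (* By [(g / 3 * m) ^+ 3 <= expR (g * m)], the expected number, of order [expR (g * m) / m ^+ 2],
     grows at least linearly in [m], with factor [r]. *)
  pose r := c / K2 * (g / 3) ^+ 3.
  have r0 : 0 < r by rewrite mulr_gt0 ?exprn_gt0 ?divr_gt0.
  have er : 0 <= (e^-1 + c) / r by rewrite divr_ge0 ?addr_ge0 ?invr_ge0// ltW.
  have /Num.Theory.truncn_itv/andP[_ k2] := er.
  set k := (Num.truncn _).+1 in k2.
  exists (k + m0)%N; first by rewrite leq_addl.
  set m := (k + m0)%N.
  have m1 : (1 <= m)%N by rewrite /m /k addSn.
  have m1' : 1 <= m%:R :> R by rewrite ler1n.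
  have m0' : 0 < m%:R :> R by rewrite ltr0n.
  pose p := c * expR (- lam * m%:R) / m%:R.
  have p0 : 0 < p by rewrite divr_gt0// mulr_gt0// expR_gt0.
  have pj u : p <= Pr P (jump u m%:R h (K * m%:R)) by apply: hc.
  have p1 : p <= 1.
    apply: le_trans (pj 0) _; apply: Pr_le1.
    exact: (incs_measurable (igi_meas hB) (@jump_incs 0 m%:R h (K * m%:R) (ltW m0') (Km m))).
  apply: le_trans (@no_jump_prob (a (M m)) (l m) m%:R h (K * m%:R) p (N m) (ltW m0') (Km m) (lexx _) (ltW p0) p1 pj) _.
  have pc : p <= c.
    rewrite ler_pdivrMr// ler_pM2l// (@le_trans _ _ 1)// expR_le1 mulNr oppr_le0.
    by rewrite mulr_ge0// ltW.
  have pN : e^-1 <= p * (N m)%:R.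
    have Ml : 0 <= M m / l m by rewrite divr_ge0 ?expR_ge0// ltW.
    have /Num.Theory.truncn_itv/andP[_ n2] := Ml.
    rewrite -/(N m) -natr1 in n2.
    have q1 : p * (M m / l m) <= p * (N m)%:R + p.
      have : p * (M m / l m) <= p * ((N m)%:R + 1) by rewrite ler_pM2l// ltW.
      by rewrite mulrDr mulr1.
    have q2 : r * m%:R <= p * (M m / l m).
      have lK : l m <= K2 * m%:R.
        by rewrite /l /K2 2!mulrDl mul1r lerD2r [_ / beta]mulrC lerD2l.
      have q3 : p * (M m / (K2 * m%:R)) <= p * (M m / l m).
        by rewrite ler_pM2l// ler_pM2l ?expR_gt0// lef_pV2 ?posrE// mulr_gt0.
      apply: le_trans q3.
      have -> : p * (M m / (K2 * m%:R)) = c / K2 * (expR (g * m%:R) / m%:R ^+ 2).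
        have -> : expR (g * m%:R) = expR (- lam * m%:R) * M m.
          by rewrite /M -expRD; congr expR; rewrite /g; ring.
        by rewrite /p; field; rewrite !gt_eqF.
      rewrite /r -mulrA ler_pM2l ?divr_gt0// ler_pdivlMr ?exprn_gt0//.
      have -> : g * m%:R = 3%:R * (g / 3 * m%:R) by field.
      rewrite expRM_natl (_ : (g / 3) ^+ 3 * m%:R * m%:R ^+ 2 = (g / 3 * m%:R) ^+ 3); last by ring.
      rewrite ler_pXn2r ?nnegrE ?expR_ge0 ?mulr_ge0 ?divr_ge0 ?(ltW g0)//.
      by apply: le_trans (expR_ge1Dx _); rewrite lerDr.
    have q4 : e^-1 + c <= r * m%:R.
      rewrite mulrC -ler_pdivrMr//; apply: le_trans (ltW k2) _; rewrite ler_nat /m leq_addr//.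
    lra.
  apply: (@le_trans _ _ (expR (- p) ^+ N m)).
    by rewrite lerXn2r ?nnegrE ?expR_ge0 ?subr_ge0// expR_ge1Dx.
  rewrite -expRM_natl mulrN expRN mulrC -[leRHS]invrK lef_pV2 ?posrE ?invr_gt0 ?expR_gt0//.
  by apply: le_trans pN (le_trans _ (expR_ge1Dx _)); rewrite lerDr.
apply: ae_count => m0.
have : {ae P, forall w, ~ (\bigcap_m (if (m0 <= m)%N then NE m else setT)) w}.
  apply: ae_small.
    by apply: bigcapT_measurable => m; case: ifP.
  move=> e e0; have [m mm hm] := small e m0 e0; apply: le_trans hm; apply: le_Pr => //.
    by apply: bigcapT_measurable => k; case: ifP.
  by move=> w /(_ m I); rewrite mm.
apply: filterS => w nE; apply: contrapT => nex; apply: nE => m _; case: ifP => // mm i iN jm.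
apply: nex; exists m, (a (M m) + i%:R * l m); split => //.
  by rewrite lerDl mulr_ge0// ltW.
rewrite -/(l m) -addrA lerD2l -{2}[l m]mul1r -mulrDl natr1.
apply: (@le_trans _ _ ((N m)%:R * l m)); first by rewrite ler_wpM2r ?(ltW (l0 m))// ler_nat.
have Ml : 0 <= M m / l m by rewrite divr_ge0 ?expR_ge0// ltW.
by have /Num.Theory.truncn_itv/andP[n1 _] := Ml; rewrite -ler_pdivlMr.
Qed.

End lower_event.

Section lower.
Context {d : measure_display} {T : measurableType d} {R : realType}.
Variables (P : probability T R) (sigma : R) (s0 : 0 < sigma).
Variables (beta : R) (beta0 : 0 < beta).
Variables (B : R -> T -> R) (hB : igi P sigma B).

Lemma ae_upper_norm :
  {ae P, forall w, forall c, sigma ^+ 2 / (2 * beta) < c -> exists T0, forall t, T0 <= `|t| ->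
    forall s u, B s w - B u w - beta * `|s - t| - beta * `|u - t| <= c * ln `|t|}.
Proof.
apply: filterS2 (ae_upper s0 beta0 hB) (ae_upper s0 beta0 (igi_rev s0 hB)) => w h1 h2 c hc.
have [T1 H1] := h1 c hc; have [T2 H2] := h2 c hc.
exists (Num.max T1 T2) => t; rewrite ge_max => /andP[t1 t2] s u.
have [t0|t0] := leP 0 t.
  by move: t1 t2; rewrite ger0_norm// => t1 t2; exact: H1.
move: t1 t2; rewrite ltr0_norm// => t1 t2.
have := H2 _ t2 (- s) (- u); rewrite !opprK.
have e (v : R) : `|- v + t| = `|v - t| by rewrite -normrN; congr (`|_|); ring.
by rewrite !e.
Qed.

(** A solution less than [y] above [B] at the start of a jump would end farther below [B] than
    [ae_upper_norm] permits. So [x u - B u >= y = kap * ln M] at a time comparable with [M]. All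
    solutions are covered outside one null set; applied to [- B] and [- x], the statement gives the
    opposite sign. *)
Lemma ae_lower (sg : bool) :
  {ae P, forall w x, bsol beta (B^~ w) x -> (forall M : R, exists2 t, M < t & x t = B t w) ->
    forall c, c < sigma ^+ 2 / (2 * beta) -> forall T0, exists2 t, T0 <= t &
     c * ln t <= x (if sg then t else - t) - B (if sg then t else - t) w}.
Proof.
set il := sigma ^+ 2 / (2 * beta).
have s20 : 0 < sigma ^+ 2 by rewrite exprn_gt0.
have il0 : 0 < il by rewrite divr_gt0// mulr_gt0.
pose kap (j : nat) := il * (1 - j.+2%:R^-1).
have j2 (j : nat) : j.+2%:R^-1 <= 2^-1 :> R by rewrite lef_pV2 ?posrE ?ltr0n// ler_nat.
have j20 (j : nat) : 0 < j.+2%:R^-1 :> R by rewrite invr_gt0 ltr0n.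
have kap0 j : 0 < kap j by rewrite mulr_gt0// subr_gt0; apply: le_lt_trans (j2 j) _; lra.
have kapl j : kap j < il by rewrite gtr_pMr// gtrBl.
pose C := 2 * il.
(* The final gap [beta * (K * y) / 2] then exceeds the allowance [C * (1 + y / kap)] by at least
   [y]. *)
pose K j := 2 * (C * (1 + (kap j)^-1) + 1) / beta.
have K0 j : 0 < K j.
  have C0 : 0 <= C by rewrite mulr_ge0// ltW.
  have k1 : 0 <= 1 + (kap j)^-1 by rewrite addr_ge0// invr_ge0 ltW.
  by rewrite divr_gt0// mulr_gt0// ltr_wpDl// mulr_ge0.
pose a (M : R) := if sg then M else - (2 * M).
have hj : {ae P, forall w j, exists2 h, 0 < h & forall m0, exists m u,
    [/\ (m0 <= m)%N, a (expR (m%:R / kap j)) <= u,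
        u + (m%:R / beta + 1 + K j * m%:R) <= a (expR (m%:R / kap j)) + expR (m%:R / kap j) &
        jump beta B u m%:R h (K j * m%:R) w]}.
  apply: ae_count => j; have [h h0 hh] := ae_jump s0 beta0 hB a (kap0 j) (kapl j).
  by apply: filterS (hh (K j) (K0 j)) => w H; exists h.
apply: filterS3 (igi_cont hB) (ae_beta_lipschitz s0 beta0 hB) (filterI hj ae_upper_norm).
move=> w cw lip [{}hj up] x sx ret c hc T0.
have [C0 hC0] : exists T0, forall t, T0 <= `|t| ->
    forall s u, B s w - B u w - beta * `|s - t| - beta * `|u - t| <= C * ln `|t|.
  by apply: up; rewrite /C -/il; lra.
have [j cj] : exists j, c < kap j.
  have e0 : 0 < (il - c) / il by rewrite divr_gt0// subr_gt0.
  have ei : 0 <= ((il - c) / il)^-1 by rewrite invr_ge0 ltW.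
  have /Num.Theory.truncn_itv/andP[_ k2] := ei; set j := Num.truncn _ in k2.
  exists j; have : j.+2%:R^-1 < (il - c) / il.
    rewrite -(invrK ((il - c) / il)) ltf_pV2 ?posrE ?invr_gt0 ?ltr0n//.
    by apply: lt_trans k2 _; rewrite ltr_nat.
  by rewrite ltr_pdivlMr// /kap mulrBr mulr1 [il * _]mulrC => h3; rewrite ltrBrDr -ltrBrDl.
have [h h0 {}hj] := hj j.
set k := kap j in cj hj; have k0 : 0 < k by exact: kap0.
(* Lower bounds for [y]: the second puts [M] beyond [T0] and [C0], the third makes [y] at least
   [Num.max 0 c * (1 + y / k)], which dominates [c * ln |u|]. *)
pose Q := Num.max 1 (Num.max (k * Num.max T0 C0) (Num.max 0 c / (1 - Num.max 0 c / k))).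
have Q0 : 0 <= Q by rewrite le_max ler01.
have /Num.Theory.truncn_itv/andP[_ m2] := Q0.
set m0 := (Num.truncn Q).+1 in m2.
have [m [u [mm au ua [[J1 J2] J3]]]] := hj m0.
set y : R := m%:R in au ua J1 J2 J3.
have yQ : Q <= y by rewrite (le_trans (ltW m2))// ler_nat.
have y1 : 1 <= y by apply: le_trans yQ; rewrite le_max lexx.
have y0 : 0 <= y by lra.
set M := expR (y / k) in au ua.
have lMk : ln M = y / k by rewrite /M expRK.
have M0 : 0 < M by exact: expR_gt0.
have yk0 : 0 <= y / k by rewrite divr_ge0// ltW.
have M1 : 1 <= M by have := expR_ge1Dx (y / k); rewrite -/M; lra.
have TM : Num.max T0 C0 <= M.
  have : k * Num.max T0 C0 <= y.
    by apply: le_trans yQ; rewrite le_max; apply/orP; right; rewrite le_max lexx.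
  by rewrite mulrC -ler_pdivlMr// => h1; apply: (le_trans h1); have := expR_ge1Dx (y / k); rewrite -/M; lra.
have KL : 0 <= K j * y by rewrite mulr_ge0// ltW.
have yb : 0 <= y / beta by rewrite divr_ge0// ltW.
have rng t : a M <= t -> t <= a M + M -> M <= `|t| <= 2 * M /\ t = if sg then `|t| else - `|t|.
  exact: side_range (ltW M0).
have lnr (t : R) : M <= `|t| <= 2 * M -> 0 <= ln `|t| <= 1 + y / k.
  by rewrite -lMk; exact: ln_range.
have uM : u <= a M + M by clear -ua yb KL; lra.
have [ru tu] := rng u au uM.
have /andP[lu0 lu] := lnr u ru.
have xu : B u w + y <= x u.
  rewrite leNgt; apply/negP => lt.
  have := lower_path (y := y) (h := h) (L := K j * y) (u := u) beta0 h0 y0 KL cw sx (lip x sx) J1 J2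
    (dip_path cw KL J3) (ltW lt).
  set t := u + y / beta + 1 + K j * y => low.
  have [rt tt] : M <= `|t| <= 2 * M /\ t = if sg then `|t| else - `|t| by apply: rng; rewrite /t; clear -au ua yb KL; lra.
  have /andP[lt0 lt1] := lnr t rt.
  have : B t w - C * ln `|t| <= x t.
    apply: (Xstar_ge cw sx ret) => r r0.
    have := hC0 t _ t (t + r); rewrite subrr normr0 mulr0 subr0 (_ : t + r - t = r); last by ring.
    rewrite (ger0_norm r0) => hh.
    have : B t w - B (t + r) w - beta * r <= C * ln `|t|.
      by apply: hh; move: TM rt; rewrite ge_max => /andP[_ h1] /andP[h2 _]; exact: le_trans h2.
    clear; lra.
  have C00 : 0 <= C by rewrite mulr_ge0// ltW.
  have : C * ln `|t| <= C * (1 + y / k) by rewrite ler_wpM2l.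
  have : C * (1 + y / k) <= C * ((1 + k^-1) * y).
    by rewrite ler_wpM2l// mulrDl mul1r [k^-1 * _]mulrC lerD2r.
  have eK : beta * (K j * y) / 2 = C * ((1 + k^-1) * y) + y.
    by rewrite /K -/k; field; rewrite !gt_eqF.
  move: low; rewrite eK; move: (C * _) (C * _) (C * _) (x t) (B t w) => q1 q2 q3 q4 q5.
  clear -y1; lra.
exists `|u|.
  move: TM ru; rewrite ge_max => /andP[h1 _] /andP[h2 _]; exact: le_trans h2.
rewrite -tu.
have yc : Num.max 0 c * (1 + y / k) <= y.
  have c0 : 0 <= Num.max 0 c by rewrite le_max lexx.
  have ck : Num.max 0 c < k by rewrite gt_max k0.
  have e0 : 0 < 1 - Num.max 0 c / k by rewrite subr_gt0 ltr_pdivrMr// mul1r.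
  have : Num.max 0 c / (1 - Num.max 0 c / k) <= y.
    by apply: le_trans yQ; rewrite le_max; apply/orP; right; rewrite le_max lexx orbT.
  rewrite ler_pdivrMr//; set z := Num.max 0 c => hz.
  have -> : z * (1 + y / k) = z + y * (z / k) by field; rewrite gt_eqF.
  clear -hz; lra.
have : c * ln `|u| <= Num.max 0 c * (1 + y / k).
  apply: (@le_trans _ _ (Num.max 0 c * ln `|u|)).
    by rewrite ler_wpM2r// le_max lexx orbT.
  by rewrite ler_wpM2l// le_max lexx.
clear -yc xu; lra.
Qed.

End lower.

(** * Euler scheme for a fixed path *)


Section euler.
Context {R : realType}.
Variables (beta : R) (beta0 : 0 < beta).

(* One step backwards in time of X - B: X moves towards B at speed [beta]. *)
Definition eulerG (h : R) (x : R * R) : R :=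
  (if 0 < x.1 then x.1 - beta * h else x.1 + beta * h) + x.2.

(** The path version of [chain], with a free terminal value [v] so that runs over consecutive
    stretches can be joined. *)
Fixpoint euler (h : R) (b : R -> R) (k : nat) (v u : R) : R :=
  if k is k'.+1 then eulerG h (euler h b k' v (u + h), b (u + h) - b u) else v.

Lemma eulerS h b k v u :
  euler h b k.+1 v u = eulerG h (euler h b k v (u + h), b (u + h) - b u).
Proof. by []. Qed.

Lemma euler_add h b k l v u : euler h b (k + l) v u = euler h b k (euler h b l v (u + k%:R * h)) u.
Proof.
elim: k u => [|k IH] u; first by rewrite mul0r addr0.
rewrite addSn !eulerS IH; congr (eulerG h (euler h b k (euler h b l v _) _, _)).
by rewrite -natr1; ring.
Qed.

Lemma measurable_eulerG h : measurable_fun setT (eulerG h).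
Proof.
apply: measurable_funD => //.
apply: (measurable_fun_ifT (f := fun x : R * R => 0 < x.1)).
- exact: measurable_fun_ltr.
- exact: measurable_funB.
- exact: measurable_funD.
Qed.

Variables (b x : R -> R).
Hypotheses (cb : continuous b) (sx : bsol beta b x).

Lemma bsol_step_down p q c : p <= q -> (forall r, p <= r <= q -> b r <= c) -> c < x p ->
  x q = x p + beta * (q - p).
Proof.
move=> pq bc cx; apply: (escape_up cb sx) => // [|s /andP[ps sq]].
  by apply: le_lt_trans cx; apply: bc; rewrite lexx.
apply: (@le_lt_trans _ _ c); first by apply: bc; rewrite ps.
by apply: (lt_le_trans cx); rewrite lerDl mulr_ge0 ?(ltW beta0)// subr_ge0.
Qed.

Hypothesis lx : forall s t, `|x s - x t| <= beta * `|s - t|.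

(** Errors do not accumulate. Backwards in time both [x - b] and the scheme are drawn towards 0 at
    speed [beta]: clearly on the same side they move in parallel, on opposite sides they approach
    each other, and within the resolution of one step their distance is at most [eta + beta * h]. *)
Lemma euler_err h eta m k v u : 0 <= h -> 0 <= eta -> eta + beta * h <= m ->
  (forall i, (i < k)%N -> forall r, 0 <= r <= h ->
     `|b (u + i%:R * h + r) - b (u + i%:R * h + h)| <= eta) ->
  `|x (u + k%:R * h) - b (u + k%:R * h) - v| <= m ->
  `|x u - b u - euler h b k v u| <= m.
Proof.
move=> h0 eta0 em; elim: k u => [|k IH] u osc hx; first by rewrite mul0r addr0 in hx.
have {IH} := IH (u + h) _ _.
rewrite (_ : u + h + k%:R * h = u + k.+1%:R * h); last by rewrite -natr1; ring.
move=> /(_ _ hx) IH.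
have {}IH : `|x (u + h) - b (u + h) - euler h b k v (u + h)| <= m.
  apply: IH => i ik r hr; have := osc i.+1 ik r hr.
  by rewrite (_ : u + i.+1%:R * h = u + h + i%:R * h)//; rewrite -natr1; ring.
have {}osc r : u <= r <= u + h -> b (u + h) - eta <= b r <= b (u + h) + eta.
  move=> /andP[r1 r2]; have := osc 0%N isT (r - u).
  rewrite mul0r addr0 (_ : u + (r - u) = r); last by ring.
  have -> : 0 <= r - u <= h by apply/andP; split; lra.
  by move=> /(_ isT); rewrite ler_norml => /andP[? ?]; apply/andP; split; lra.
rewrite eulerS /eulerG/=; move: (euler h b k v (u + h)) IH => e IH.
have uh : u <= u + h by rewrite lerDl.
have := lx (u + h) u; rewrite (_ : u + h - u = h); last by ring.
rewrite (ger0_norm h0) ler_norml => /andP[l1 l2].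
move: IH; rewrite !ler_norml => /andP[i1 i2].
case: ifPn => [e0|]; last rewrite -leNgt => e0; apply/andP; split; try lra.
- have [hi|lo] := ltP (b (u + h) + eta) (x u); last by lra.
  have := bsol_step_down uh (fun r hr => proj2 (andP (osc r hr))) hi.
  by rewrite (_ : u + h - u = h); [lra|ring].
- have [lo|hi] := ltP (x u) (b (u + h) - eta); last by lra.
  have cNb : continuous (fun t => - b t) by move=> t; apply: cvgN; exact: cb.
  have := @escape_up _ beta (fun t => - b t) (fun t => - x t) u (u + h) cNb (bsolN sx).
  rewrite (_ : u + h - u = h); last by ring.
  have bu : b (u + h) - eta <= b u by have /andP[] := osc u ltac:(by rewrite lexx).
  move=> H; have : - x (u + h) = - x u + beta * h.
    apply: H => //; first by lra.
    move=> s /andP[s1 s2]; have o0 : u <= s <= u + h by rewrite s1.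
    have /andP[w1 w2] := osc s o0.
    have : 0 <= beta * (s - u) by rewrite mulr_ge0 ?(ltW beta0)// subr_ge0.
    lra.
  lra.
Qed.

End euler.

Section pin.
Context {R : realType}.
Variables (beta : R) (beta0 : 0 < beta) (b x : R -> R).

(** While [b] stays within [c] of [a], the position [b + euler] is drawn to [a] by [beta * h] per
    step until it enters a band of half-width [c + beta * h]. The larger of the shrinking distance
    and this half-width is what a step preserves as a bound. *)
Lemma euler_pin h a c H k v u : 0 <= h -> 0 <= c ->
  (forall r, u <= r <= u + k%:R * h -> `|b r - a| <= c) ->
  `|b (u + k%:R * h) + v - a| <= H -> H <= beta * (k%:R * h) + c ->
  `|b u + euler beta h b k v u - a| <= c + beta * h.
Proof.
move=> h0 c0 bc hH hk.
have bh : 0 <= beta * h by rewrite mulr_ge0// ltW.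
suff : `|b u + euler beta h b k v u - a| <= Num.max (H - beta * (k%:R * h)) (c + beta * h).
  by move/le_trans; apply; rewrite ge_max lexx andbT; lra.
elim: k u bc hH {hk} => [|k IH] u bc hH; first by rewrite mul0r mulr0 subr0 addr0 in hH *; rewrite le_max hH.
have uk : u + h + k%:R * h = u + k.+1%:R * h by rewrite -natr1; ring.
have kh : 0 <= k%:R * h by rewrite mulr_ge0.
have {IH} := IH (u + h); rewrite uk => /(_ _ hH) IH.
have {}IH : `|b (u + h) + euler beta h b k v (u + h) - a| <= Num.max (H - beta * (k%:R * h)) (c + beta * h).
  by apply: IH => r /andP[r1 r2]; apply: bc; apply/andP; split; lra.
have := bc (u + h); rewrite -uk.
have -> : u <= u + h <= u + h + k%:R * h by apply/andP; split; lra.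
move=> /(_ isT); rewrite eulerS /eulerG/=; move: (euler beta h b k v (u + h)) IH => e.
have -> : beta * (k.+1%:R * h) = beta * (k%:R * h) + beta * h by rewrite -natr1; ring.
rewrite !le_max !ler_norml => /orP IH /andP[c1 c2]; case: ifPn => [e0|]; last rewrite -leNgt => e0.
- have [ea|ea] := leP a (b (u + h) + e).
    case: IH => /andP[i1 i2]; last by apply/orP; right; apply/andP; split; lra.
    have [z|z] := leP (b (u + h) + e - a) (c + beta * h + beta * h); last first.
      by apply/orP; left; apply/andP; split; lra.
    by apply/orP; right; apply/andP; split; lra.
  by apply/orP; right; apply/andP; split; lra.
- have [ea|ea] := leP (b (u + h) + e) a.
    case: IH => /andP[i1 i2]; last by apply/orP; right; apply/andP; split; lra.
    have [z|z] := leP (a - (b (u + h) + e)) (c + beta * h + beta * h); last first.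
      by apply/orP; left; apply/andP; split; lra.
    by apply/orP; right; apply/andP; split; lra.
  by apply/orP; right; apply/andP; split; lra.
Qed.

Hypotheses (cb : continuous b) (sx : bsol beta b x).

(** If [x u > a + c], the solution runs away along a line of slope [beta] and ends above
    [a + c + beta * S]; symmetrically below. *)
Lemma bsol_pin a c S u : 0 <= S -> 0 <= c -> (forall r, u <= r <= u + S -> `|b r - a| <= c) ->
  `|x (u + S) - a| <= beta * S + c -> `|x u - a| <= c.
Proof.
move=> S0 c0 bc; rewrite ler_norml => /andP[x1 x2].
have uS : u <= u + S by rewrite lerDl.
have bc' r : u <= r <= u + S -> a - c <= b r <= a + c.
  by move=> /bc; rewrite ler_norml => /andP[? ?]; apply/andP; split; lra.
rewrite ler_norml; apply/andP; split.
  rewrite leNgt; apply/negP => lt.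
  have cNb : continuous (fun t => - b t) by move=> t; apply: cvgN; exact: cb.
  have := @bsol_step_down _ beta beta0 (fun t => - b t) (fun t => - x t) cNb (bsolN sx) u (u + S) (- a + c) uS.
  rewrite (_ : u + S - u = S); last by ring.
  move=> h; have : - x (u + S) = - x u + beta * S.
    by apply: h; [move=> r /bc' /andP[? ?]; lra|lra].
  lra.
rewrite leNgt; apply/negP => lt.
have ax : a + c < x u by lra.
have := bsol_step_down beta0 cb sx uS (fun r hr => proj2 (andP (bc' r hr))) ax.
rewrite (_ : u + S - u = S); last by ring.
lra.
Qed.

Hypothesis lx : forall s t, `|x s - x t| <= beta * `|s - t|.

(* One flat stretch of [b] forces both [x] and the Euler path next to [b]; after that they stay close. *)
Lemma euler_close h c eta H N j J u : 0 < h -> 0 <= c -> 0 <= eta -> eta + beta * h <= H ->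
  2 * H + c <= beta * (N%:R * h) -> (j < J)%N ->
  (forall i, (i < J * N)%N -> forall r, 0 <= r <= h ->
     `|b (u + i%:R * h + r) - b (u + i%:R * h + h)| <= eta) ->
  (forall r, 0 <= r <= N%:R * h ->
     `|b (u + j%:R * (N%:R * h) + r) - b (u + j%:R * (N%:R * h))| <= c) ->
  `|x (u + j.+1%:R * (N%:R * h)) - b (u + j.+1%:R * (N%:R * h))| <= H ->
  `|x (u + J%:R * (N%:R * h)) - b (u + J%:R * (N%:R * h))| <= H ->
  `|x u - b u - euler beta h b (J * N) 0 u| <= 2 * c + eta + beta * h.
Proof.
move=> h0 c0 eta0 etaH HS jJ osc flat xj xJ.
have h0' := ltW h0; have bh : 0 <= beta * h by rewrite mulr_ge0// ltW.
set v := u + j%:R * (N%:R * h).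
set S := N%:R * h in HS flat xj xJ v *.
have S0 : 0 <= S by rewrite mulr_ge0.
have JE : (J * N = j * N + (N + (J - j.+1) * N))%N by rewrite addnA -mulSnr -mulnDl subnKC.
have vj : u + (j * N)%:R * h = v by rewrite natrM -mulrA.
have vj1 : v + S = u + j.+1%:R * S by rewrite /v -natr1; ring.
rewrite JE euler_add vj euler_add -/S.
set e1 := euler _ _ _ ((J - j.+1) * N) _ _.
have E1 : `|x (v + S) - b (v + S) - e1| <= H.
  apply: (euler_err beta0 cb sx lx h0' eta0 etaH).
    move=> i iN r hr; have := osc (j.+1 * N + i)%N _ r hr.
    have -> : u + (j.+1 * N + i)%:R * h = v + S + i%:R * h.
      by rewrite vj1 natrD natrM /S; ring.
    by apply; rewrite -[J in (_ < J * N)%N](subnKC jJ) mulnDl ltn_add2l.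
  have -> : v + S + ((J - j.+1) * N)%:R * h = u + J%:R * S.
    by rewrite vj1 natrM natrB//; rewrite /S; ring.
  by rewrite subr0.
set e2 := euler _ _ _ N _ _.
have flat' r : v <= r <= v + S -> `|b r - b v| <= c.
  move=> /andP[r1 r2]; have := flat (r - v).
  rewrite -/v (_ : v + (r - v) = r); last by ring.
  by apply; apply/andP; split; lra.
have bvS : `|b (v + S) - b v| <= c by apply: flat'; apply/andP; split; lra.
rewrite -vj1 in xj.
have nrm (y m : R) : `|y| <= m -> - m <= y /\ y <= m by rewrite ler_norml => /andP[].
have [a1 a2] := nrm _ _ xj; have [a3 a4] := nrm _ _ bvS; have [a5 a6] := nrm _ _ E1.
have Xv : `|x v - b v| <= c.
  apply: (bsol_pin S0 c0 flat'); rewrite ler_norml; apply/andP; split; lra.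
have Ev : `|b v + e2 - b v| <= c + beta * h.
  apply: (@euler_pin h (b v) c (2 * H + c) N) => //.
    by rewrite -/S ler_norml; apply/andP; split; lra.
  by rewrite -/S; lra.
have m0 : eta + beta * h <= 2 * c + eta + beta * h by lra.
apply: (euler_err beta0 cb sx lx h0' eta0 m0).
  move=> i iN; apply: osc; apply: (leq_trans iN); rewrite leq_mul2r; apply/orP; right; exact: ltnW.
have [? ?] := nrm _ _ Xv; have [? ?] := nrm _ _ Ev.
rewrite vj ler_norml; apply/andP; split; lra.
Qed.

End pin.

(** * Flat stretches of Brownian motion *)


Lemma exprn_small {R : realType} (k e : R) : 0 < k -> k <= 1 -> 0 < e -> exists J, (1 - k) ^+ J <= e.
Proof.
move=> k0 k1 e0; have ke : 0 <= (k * e)^-1 by rewrite invr_ge0 mulr_ge0// ltW.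
have /Num.Theory.truncn_itv/andP[_ n1] := ke; set n := (Num.truncn _).+1 in n1; exists n.
have n0 : 0 < n%:R * k by rewrite mulr_gt0// ltr0n.
apply: (@le_trans _ _ (expR (- k) ^+ n)).
  by rewrite lerXn2r ?nnegrE ?expR_ge0 ?subr_ge0// expR_ge1Dx.
rewrite -expRM_natl mulrN expRN -[leRHS]invrK lef_pV2 ?posrE ?invr_gt0 ?expR_gt0//.
apply: (@le_trans _ _ (n%:R * k)); last by apply: le_trans (expR_ge1Dx _); rewrite lerDr.
by rewrite -ler_pdivrMr// -invfM mulrC ltW// mulrC.
Qed.

Section events.
Context {d : measure_display} {T : measurableType d} {R : realType}.
Variables (P : probability T R).

Lemma Pr_exists_lt (A : nat -> set T) (n : nat) (q : R) : (forall i, measurable (A i)) ->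
  (forall i, Pr P (A i) <= q) ->
  measurable [set w | exists2 i, (i < n)%N & A i w] /\
  Pr P [set w | exists2 i, (i < n)%N & A i w] <= n%:R * q.
Proof.
move=> mA hq; elim: n => [|n [mI hI]].
  have -> : [set w | exists2 i, (i < 0)%N & A i w] = set0.
    by apply/seteqP; split => w // [].
  by rewrite mul0r /Pr measure0.
have -> : [set w | exists2 i, (i < n.+1)%N & A i w] = [set w | exists2 i, (i < n)%N & A i w] `|` A n.
  apply/seteqP; split => w /=.
    by move=> [i]; rewrite ltnS leq_eqVlt => /orP[/eqP->|iN] Ai; [right|left; exists i].
  by move=> [[i iN Ai]|An]; [exists i => //; exact: ltnW|exists n].
split; first exact: measurableU.
by apply: le_trans (PrU P mI (mA n)) _; rewrite -natr1 mulrDl mul1r lerD.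
Qed.

Lemma Pr_diff_ge (A C : set T) : measurable A -> measurable C ->
  Pr P A - Pr P C <= Pr P (A `&` ~` C).
Proof.
move=> mA mC; rewrite lerBlDr.
have mD : measurable (A `&` ~` C) by apply: measurableI => //; exact: measurableC.
apply: le_trans (PrU P mD mC); apply: le_Pr => //; first exact: measurableU.
by move=> w Aw; have [Cw|nC] := pselect (C w); [right|left].
Qed.

End events.

Section tube.
Context {d : measure_display} {T : measurableType d} {R : realType}.
Variables (P : probability T R) (sigma : R) (s0 : 0 < sigma).
Variables (B : R -> T -> R) (hB : igi P sigma B).

(** [dip] allows a fall of [c / 2] plus a drift; with slope parameter [c / dl] the drift adds at
    most [c / 2] over time [dl], so outside both events the path moves by at most [c]. *)
Definition swing (c dl a : R) : set T :=
  dip (c / dl) B c a dl `|` dip (c / dl) (fun t w => - B t w) c a dl.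

Lemma swing_incs c dl a : 0 <= dl -> incs B [set t | a <= t <= a + dl] (swing c dl a).
Proof.
move=> d0; apply: sigmaU; first exact: dip_incs.
exact: (incsN (@dip_incs _ _ _ (c / dl) (fun t w => - B t w) c a dl d0)).
Qed.

Lemma swing_measurable c dl a : 0 <= dl -> measurable (swing c dl a).
Proof. by move=> d0; exact: (incs_measurable (igi_meas hB) (@swing_incs c dl a d0)). Qed.

Lemma swing_path c dl a w : continuous (B^~ w) -> 0 < c -> 0 < dl -> ~ swing c dl a w ->
  forall r, 0 <= r <= dl -> `|B (a + r) w - B a w| <= c.
Proof.
move=> cw c0 d0 /not_orP[n1 n2] r hr.
have cN : continuous (fun t => - B t w) by move=> t; apply: cvgN; exact: cw.
have := dip_path cw (ltW d0) n1 hr; have := @dip_path _ _ _ (c / dl) (fun t w => - B t w) c a dl w cN (ltW d0) n2 r hr.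
have : c / dl / 2 * r <= c / 2.
  rewrite mulrAC ler_pM2r// mulrAC ler_pdivrMr// ler_pM2l//; by case/andP: hr.
by rewrite ler_norml => h1 h2 h3; apply/andP; split; lra.
Qed.

Lemma swing_prob c dl a : 0 < c -> 0 < dl ->
  Pr P (swing c dl a) <= 2 * expR (- (c ^+ 2 / (2 * sigma ^+ 2 * dl))).
Proof.
move=> c0 d0; have cd : 0 < c / dl by rewrite divr_gt0.
have d0' := ltW d0.
have -> : c ^+ 2 / (2 * sigma ^+ 2 * dl) = c / dl / sigma ^+ 2 * (c / 2) by field; rewrite !gt_eqF.
apply: le_trans (PrU P _ _) _.
- exact: (incs_measurable (igi_meas hB) (@dip_incs _ _ _ (c / dl) B c a dl d0')).
- exact: (incs_measurable (igi_meas (igiN s0 hB)) (@dip_incs _ _ _ (c / dl) (fun t w => - B t w) c a dl d0')).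
rewrite mulrDl mul1r; apply: lerD; first exact: (dip_prob s0 cd hB).
exact: (dip_prob s0 cd (igiN s0 hB)).
Qed.

(* The increment over each short step is asked to push against the current displacement,
   so the displacement at the grid times never leaves [- c / 2, c / 2]. *)
Fixpoint tube (c dl v : R) (k : nat) : set T :=
  if k is k'.+1 then
    let a := v + k'%:R * dl in
    (tube c dl v k' `&` [set w | B a w - B v w <= 0]) `&`
      ([set w | 0 <= B (a + dl) w - B a w] `&` ~` swing (c / 2) dl a) `|`
    (tube c dl v k' `&` [set w | 0 < B a w - B v w]) `&`
      ([set w | B (a + dl) w - B a w <= 0] `&` ~` swing (c / 2) dl a)
  else setT.

Lemma tube_incs c dl v k : 0 <= dl -> incs B [set t | v <= t <= v + k%:R * dl] (tube c dl v k).
Proof.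
move=> d0; elim: k => [|k IH]; first exact: sigmaT.
set a := v + k%:R * dl.
have kd : 0 <= k%:R * dl by rewrite mulr_ge0.
have e : v + k.+1%:R * dl = a + dl by rewrite /a -natr1; ring.
have va : v <= a by rewrite /a lerDl.
have sw : incs B [set t | v <= t <= v + k.+1%:R * dl] (~` swing (c / 2) dl a).
  apply: sigmaC; apply: (@incsW _ _ _ _ _ _ _ (@swing_incs (c / 2) dl a d0)) => t /= /andP[? ?].
  by rewrite e; apply/andP; split; lra.
have {}IH : incs B [set t | v <= t <= v + k.+1%:R * dl] (tube c dl v k).
  by apply: (@incsW _ _ _ _ _ _ _ IH) => t /= /andP[? ?]; rewrite e /a; apply/andP; split; lra.
have i1 : meas_wrt (incgen B [set t | v <= t <= v + k.+1%:R * dl]) (fun w => B a w - B v w).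
  by apply: incs_inc => /=; rewrite e; apply/andP; split; lra.
have i2 : meas_wrt (incgen B [set t | v <= t <= v + k.+1%:R * dl]) (fun w => B (a + dl) w - B a w).
  by apply: incs_inc => /=; rewrite e; apply/andP; split; lra.
apply: sigmaU; apply: sigmaI; apply: sigmaI => //.
- exact: sigma_le.
- exact: sigma_ge.
- exact: sigma_gt.
- exact: sigma_le.
Qed.

(** A step directed against the displacement and of size at most [c / 2] keeps it in
    [[- c / 2, c / 2]] at the grid times; within a step it can grow by another [c / 2]. *)
Lemma tube_path c dl v k w : continuous (B^~ w) -> 0 < c -> 0 < dl -> tube c dl v k w ->
  `|B (v + k%:R * dl) w - B v w| <= c / 2 /\
  forall r, 0 <= r <= k%:R * dl -> `|B (v + r) w - B v w| <= c.
Proof.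
move=> cw c0 d0; elim: k => [_|k IH].
  rewrite mul0r addr0 subrr normr0; split; first by rewrite divr_ge0// ltW.
  move=> r hr; have -> : r = 0 by apply/le_anti; rewrite andbC.
  by rewrite addr0 subrr normr0 ltW.
rewrite /=; set a := v + k%:R * dl => H.
have e : v + k.+1%:R * dl = a + dl by rewrite /a -natr1; ring.
have c20 : 0 < c / 2 by rewrite divr_gt0.
have dd : 0 <= dl <= dl by rewrite lexx ltW.
have [tk [ns hsgn]] : tube c dl v k w /\ (~ swing (c / 2) dl a w /\
   (B a w - B v w <= 0 <= B (a + dl) w - B a w \/ B (a + dl) w - B a w <= 0 <= B a w - B v w)).
  case: H => -[[tk h1] [h2 ns]]; split => //; split => //; [left|right].
    by rewrite h1 h2.
  by rewrite h2 ltW.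
have [I1 I2] := IH tk.
have sw := swing_path cw c20 d0 ns.
have end1 := sw dl dd.
have nrm (y m : R) : `|y| <= m -> - m <= y /\ y <= m by rewrite ler_norml => /andP[].
have [a1 a2] := nrm _ _ I1; have [a3 a4] := nrm _ _ end1.
split.
  by rewrite e ler_norml; case: hsgn => /andP[b1 b2]; apply/andP; clear -a1 a2 a3 a4 b1 b2; split; lra.
move=> r /andP[r0 r1]; have [rk|kr] := leP r (k%:R * dl); first by apply: I2; rewrite r0.
have := sw (r - k%:R * dl); rewrite (_ : a + (r - k%:R * dl) = v + r); last by rewrite /a; ring.
have -> : 0 <= r - k%:R * dl <= dl.
  by move: r1; rewrite -natr1 mulrDl mul1r => r1; apply/andP; split; lra.
move=> /(_ isT) /nrm[a5 a6]; rewrite ler_norml; apply/andP; clear -a1 a2 a5 a6; split; lra.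
Qed.

(** The prescribed sign has probability at least [1 / 2] and a swing at most [1 / 4], so each step
    succeeds with probability at least [1 / 4], independently of the past. *)
Lemma tube_prob c dl v k : 0 < c -> 0 < dl ->
  2 * expR (- ((c / 2) ^+ 2 / (2 * sigma ^+ 2 * dl))) <= 1 / 4 ->
  (1 / 4) ^+ k <= Pr P (tube c dl v k).
Proof.
move=> c0 d0 hq; have c20 : 0 < c / 2 by rewrite divr_gt0.
have d0' := ltW d0.
elim: k => [|k IH]; first by rewrite expr0 /= /Pr probability_setT.
have it := @tube_incs c dl v k d0'.
rewrite [tube _ _ _ _]/=; set a := v + k%:R * dl in it *.
set Tk := tube c dl v k in IH it *.
have va : v <= a by rewrite /a lerDl mulr_ge0.
have iT : incs B [set t | t <= a] Tk by apply: (@incsW _ _ _ _ _ _ _ it) => t /= /andP[].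
set N := [set w | B a w - B v w <= 0]; set Z := [set w | 0 < B a w - B v w].
have mia : meas_wrt (incgen B [set t | t <= a]) (fun w => B a w - B v w) by apply: incs_inc => /=.
have iN : incs B [set t | t <= a] (Tk `&` N) by apply: sigmaI => //; exact: sigma_le.
have iZ : incs B [set t | t <= a] (Tk `&` Z) by apply: sigmaI => //; exact: sigma_gt.
set Ep := [set w | 0 <= B (a + dl) w - B a w]; set En := [set w | B (a + dl) w - B a w <= 0].
set W := swing (c / 2) dl a.
have mib : meas_wrt (incgen B [set t | a <= t]) (fun w => B (a + dl) w - B a w).
  by apply: incs_inc => /=; lra.
have iW : incs B [set t | a <= t] (~` W).
  by apply: sigmaC; apply: (@incsW _ _ _ _ _ _ _ (@swing_incs (c / 2) dl a d0')) => t /= /andP[].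
have iEp : incs B [set t | a <= t] (Ep `&` ~` W) by apply: sigmaI => //; exact: sigma_ge.
have iEn : incs B [set t | a <= t] (En `&` ~` W) by apply: sigmaI => //; exact: sigma_le.
have mm (I : set R) A : incs B I A -> measurable A by exact: (incs_measurable (igi_meas hB)).
have mW : measurable W by exact: swing_measurable.
have Wq : Pr P W <= 1 / 4 by apply: le_trans hq; exact: swing_prob.
have g := igi_step hB a d0.
have sd0 : 0 < sigma * Num.sqrt dl by rewrite mulr_gt0// sqrtr_gt0.
have pE : 1 / 4 <= Pr P (Ep `&` ~` W).
  have mE : measurable Ep by exact: measurable_ge g.1.
  have := Pr_diff_ge P mE mW; have := gaussian_ge0 sd0 g; rewrite -/Ep; lra.
have pEn : 1 / 4 <= Pr P (En `&` ~` W).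
  have En' : En = [set w | 0 <= - (B (a + dl) w - B a w)].
    by apply/seteqP; split => w /=; rewrite oppr_ge0.
  have gN := gaussianN sd0 g.
  have mE : measurable En by rewrite En'; exact: measurable_ge gN.1.
  have := Pr_diff_ge P mE mW; have := gaussian_ge0 sd0 gN; rewrite -En'; lra.
rewrite PrUD; last 3 first.
- exact: measurableI (mm _ _ iN) (mm _ _ iEp).
- exact: measurableI (mm _ _ iZ) (mm _ _ iEn).
- by apply/seteqP; split => w //= [[[_ h1] _] [[_ h2] _]]; have := lt_le_trans h2 h1; rewrite ltxx.
rewrite (PrI_igi hB iN iEp) (PrI_igi hB iZ iEn).
have TE : Pr P Tk = Pr P (Tk `&` N) + Pr P (Tk `&` Z).
  rewrite -PrUD; [|exact: mm iN|exact: mm iZ|].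
    rewrite -setIUr (_ : N `|` Z = setT) ?setIT//; apply/seteqP; split => w //= _.
    by case: (leP (B a w - B v w) 0); [left|right].
  by apply/seteqP; split => w //= [[_ h1] [_ h2]]; have := lt_le_trans h2 h1; rewrite ltxx.
have n0 := Pr_ge0 P (Tk `&` N); have z0 := Pr_ge0 P (Tk `&` Z).
rewrite exprS; apply: (@le_trans _ _ (1 / 4 * Pr P Tk)); first by rewrite ler_pM2l.
rewrite TE mulrDr; apply: lerD; rewrite mulrC; exact: ler_wpM2l.
Qed.

(** Dividing the fixed length [S] into more steps makes a swing within one step as unlikely as
    desired. The bound [kap] is uniform in the starting time. *)
Lemma tube_pos c S : 0 < c -> 0 < S -> exists m kap : _, [/\ (0 < m)%N, 0 < kap, kap <= 1 &
  forall v, kap <= Pr P (tube c (S / m%:R) v m)].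
Proof.
move=> c0 S0.
pose a := (c / 2) ^+ 2 / (2 * sigma ^+ 2 * S).
have a0 : 0 < a by rewrite divr_gt0 ?exprn_gt0 ?divr_gt0// !mulr_gt0// exprn_gt0.
have a8 : 0 <= 8 / a by rewrite divr_ge0// ltW.
have /Num.Theory.truncn_itv/andP[_ n1] := a8; set m := (Num.truncn _).+1 in n1.
have m0 : 0 < m%:R :> R by rewrite ltr0n.
exists m, ((1 / 4) ^+ m); split => //; first by rewrite exprn_ile1//; lra.
move=> v; apply: tube_prob => //; first by rewrite divr_gt0.
have -> : (c / 2) ^+ 2 / (2 * sigma ^+ 2 * (S / m%:R)) = a * m%:R.
  by rewrite /a; field; rewrite !gt_eqF.
have am : 8 <= a * m%:R by rewrite mulrC -ler_pdivrMr// ltW.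
have : expR (- (a * m%:R)) <= 8^-1.
  rewrite expRN lef_pV2 ?posrE ?expR_gt0//; have := expR_ge1Dx (a * m%:R); lra.
lra.
Qed.

End tube.

(** * Convergence of the Euler scheme *)


Section approximation.
Context {d : measure_display} {T : measurableType d} {R : realType}.
Variables (P : probability T R) (sigma : R) (s0 : 0 < sigma).
Variables (beta : R) (beta0 : 0 < beta).
Variables (B : R -> T -> R) (hB : igi P sigma B).

Lemma chain_euler h k u w :
  chain (eulerG beta h) h B k u w = euler beta h (B^~ w) k 0 u.
Proof. by elim: k u => [//|k IH] u; rewrite chainS eulerS IH. Qed.

Definition escape (H v : R) : set T :=
  Dev B beta v H `|` Dev (fun t w => - B t w) beta v H.

Lemma escape_incs H v : incs B [set t | v <= t] (escape H v).
Proof.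
apply: sigmaU; first exact: Dev_meas_wrt.
exact: (incsN (@Dev_meas_wrt _ _ _ (fun t w => - B t w) beta v H)).
Qed.

Lemma escape_measurable H v : measurable (escape H v).
Proof. exact: (incs_measurable (igi_meas hB) (@escape_incs H v)). Qed.

Lemma escape_prob H v : Pr P (escape H v) <= 2 * expR (- (2 * beta / sigma ^+ 2) * H).
Proof.
apply: le_trans (PrU P _ _) _.
- exact: (Dev_measurable hB).
- exact: (Dev_measurable (igiN s0 hB)).
rewrite mulrDl mul1r; apply: lerD; first exact: (Dev_tail s0 hB).
exact: (Dev_tail s0 (igiN s0 hB)).
Qed.

Lemma escape_path H v w (x : R -> R) : continuous (B^~ w) -> bsol beta (B^~ w) x ->
  (forall M : R, exists2 t, M < t & x t = B t w) -> ~ escape H v w -> `|x v - B v w| <= H.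
Proof.
move=> cw sx ret /not_orP[n1 n2].
have cN : continuous (fun t => - B t w) by move=> t; apply: cvgN; exact: cw.
have h1 := Dev_path cw n1; have h2 := @Dev_path _ _ _ (fun t w => - B t w) beta v H w cN n2.
have : x v <= B v w + H by apply: (Xstar_le cw sx ret) => r r0; have := h1 r r0; lra.
have : B v w - H <= x v by apply: (Xstar_ge cw sx ret) => r r0; have := h2 r r0; lra.
by move=> ? ?; rewrite ler_norml; apply/andP; split; lra.
Qed.

Section blocks.
Variables (F : nat -> set T) (S H u : R).
Hypotheses (S0 : 0 < S) (hF : forall j, incs B [set t | u + j%:R * S <= t <= u + j.+1%:R * S] (F j)).

(* The first flat block is counted from [u] outwards, so that it is independent of [escape] at its
   right end. *)
Fixpoint noflat (k : nat) : set T := if k is k'.+1 then noflat k' `&` ~` F k' else setT.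

Fixpoint badflat (k : nat) : set T :=
  if k is k'.+1 then badflat k' `|` (noflat k' `&` F k') `&` escape H (u + k'.+1%:R * S) else set0.

Lemma noflat_incs k : incs B [set t | t <= u + k%:R * S] (noflat k).
Proof.
elim: k => [|k IH]; first exact: sigmaT.
apply: sigmaI.
  apply: (@incsW _ _ _ _ _ _ _ IH) => t /= h; apply: (le_trans h).
  by rewrite lerD2l ler_wpM2r ?(ltW S0)// ler_nat.
by apply: sigmaC; apply: (@incsW _ _ _ _ _ _ _ (@hF k)) => t /= /andP[].
Qed.

Lemma noflat_measurable k : measurable (noflat k).
Proof. exact: (incs_measurable (igi_meas hB) (@noflat_incs k)). Qed.

Lemma F_measurable k : measurable (F k).
Proof. exact: (incs_measurable (igi_meas hB) (@hF k)). Qed.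

Lemma badflat_measurable k : measurable (badflat k).
Proof.
elim: k => [|k IH]; first exact: measurable0.
rewrite [badflat _]/=; apply: measurableU => //; apply: measurableI; last exact: escape_measurable.
by apply: measurableI; [exact: noflat_measurable|exact: F_measurable].
Qed.

Lemma noflat_prob kap k : 0 <= kap -> kap <= 1 -> (forall j, kap <= Pr P (F j)) ->
  Pr P (noflat k) <= (1 - kap) ^+ k.
Proof.
move=> k0 k1 hk; elim: k => [|k IH]; first by rewrite expr0 /Pr probability_setT.
rewrite [noflat _]/= (@PrI_igi _ _ _ P sigma B hB (u + k%:R * S)).
- rewrite exprSr; apply: ler_pM; rewrite ?Pr_ge0// PrC; last exact: F_measurable.
  by have := hk k; lra.
- exact: noflat_incs.
- by apply: sigmaC; apply: (@incsW _ _ _ _ _ _ _ (@hF k)) => t /= /andP[].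
Qed.

(** The events that block [k] is the first flat one are disjoint, their probabilities are the
    decrements of that of [noflat], and each is independent of an escape at its right end. *)
Lemma badflat_prob q k : 0 <= q -> (forall v, Pr P (escape H v) <= q) ->
  Pr P (badflat k) <= q * (1 - Pr P (noflat k)).
Proof.
move=> q0 hq; elim: k => [|k IH].
  by rewrite /= /Pr measure0 probability_setT/= subrr mulr0.
have mN := noflat_measurable k; have mF := F_measurable k.
have mNF : measurable (noflat k `&` F k) by exact: measurableI.
have -> : Pr P (noflat k.+1) = Pr P (noflat k) - Pr P (noflat k `&` F k).
  apply/eqP; rewrite eq_sym subr_eq -PrUD//; first last.
  - by apply/seteqP; split => w //= [[_ h1] [_ h2]].
  - by apply: measurableI => //; exact: measurableC.
  by rewrite -setIUr setUC setUv setIT.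
apply: le_trans (PrU P (badflat_measurable k) _) _.
  by apply: measurableI => //; exact: escape_measurable.
rewrite (@PrI_igi _ _ _ P sigma B hB (u + k.+1%:R * S)).
- have : Pr P (noflat k `&` F k) * Pr P (escape H (u + k.+1%:R * S)) <= Pr P (noflat k `&` F k) * q.
    by rewrite ler_wpM2l ?Pr_ge0.
  by move=> h2; apply: le_trans (lerD IH h2) _; rewrite le_eqVlt; apply/orP; left; apply/eqP; ring.
- apply: sigmaI.
    apply: (@incsW _ _ _ _ _ _ _ (@noflat_incs k)) => t /= h; apply: (le_trans h).
    by rewrite lerD2l ler_wpM2r ?(ltW S0)// ler_nat.
  by apply: (@incsW _ _ _ _ _ _ _ (@hF k)) => t /= /andP[].
- exact: escape_incs.
Qed.

Lemma good_flat k w : ~ noflat k w -> ~ badflat k w ->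
  exists j, [/\ (j < k)%N, F j w & ~ escape H (u + j.+1%:R * S) w].
Proof.
elim: k => [|k IH] nN nB; first by exfalso; apply: nN.
have [Nk|nNk] := pselect (noflat k w); last first.
  have [j [jk Fj ne]] := IH nNk (fun h => nB (or_introl h)).
  by exists j; split => //; exact: ltnW.
exists k; split => //.
  by apply: contrapT => nF; apply: nN.
move=> e; apply: nB; right; split => //; split => //.
by apply: contrapT => nF; apply: nN.
Qed.

End blocks.

(* Uniformity in [u] matters: the law of the chain does not depend on [u], so neither does that of
   X u - B u. *)
Lemma euler_approx (rho : R) : 0 < rho -> exists h n, 0 < h /\ forall u, exists A : set T,
  [/\ measurable A, Pr P A <= rho & forall w, ~ A w -> continuous (B^~ w) ->
    forall x, bsol beta (B^~ w) x -> (forall s t, `|x s - x t| <= beta * `|s - t|) ->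
    (forall M : R, exists2 t, M < t & x t = B t w) ->
    `|x u - B u w - chain (eulerG beta h) h B n u w| <= rho].
Proof.
move=> rho0; set lam := 2 * beta / sigma ^+ 2.
have s20 : 0 < sigma ^+ 2 by rewrite exprn_gt0.
have lam0 : 0 < lam by rewrite divr_gt0// mulr_gt0.
(* The error [2 * c + c + beta * h] of [euler_close] is to be at most [rho]; [H] makes an escape
   have probability at most [rho / 8]; [S] is the time in which speed [beta] covers [2 * H + c]; [J]
   blocks of length [S] leave probability at most [rho / 4] to the absence of a flat one. *)
pose c := rho / 4; have c0 : 0 < c by rewrite divr_gt0.
pose H := 16 / (rho * lam) + rho.
have H1 : 0 < 16 / (rho * lam) by rewrite divr_gt0// mulr_gt0.
have H0 : 0 < H by rewrite addr_gt0.
pose q := 2 * expR (- lam * H).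
have q0 : 0 <= q by rewrite mulr_ge0// expR_ge0.
have q8 : q <= rho / 8.
  have : expR (- lam * H) <= rho / 16.
    have lH : 16 / rho <= lam * H.
      rewrite /H mulrDr (_ : lam * (16 / (rho * lam)) = 16 / rho); last by field; rewrite !gt_eqF.
      by rewrite lerDl mulr_ge0// ltW.
    rewrite mulNr expRN -[leRHS]invrK invf_div lef_pV2 ?posrE ?expR_gt0 ?divr_gt0//.
    by apply: (le_trans lH); apply: le_trans (expR_ge1Dx _); rewrite lerDr.
  rewrite /q; lra.
pose S := (2 * H + c) / beta.
have S0 : 0 < S by rewrite divr_gt0// addr_gt0// mulr_gt0.
have [m [kap [m0 k0 k1 hk]]] := tube_pos s0 hB c0 S0.
have r40 : 0 < rho / 4 by rewrite divr_gt0.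
have [J hJ] := exprn_small k0 k1 r40.
pose a := (c / 2) ^+ 2 / (2 * sigma ^+ 2 * S).
have c2p : 0 < c / 2 by rewrite divr_gt0.
have c22 : 0 < (c / 2) ^+ 2 by rewrite exprn_gt0.
have d2 : 0 < 2 * sigma ^+ 2 * S by rewrite mulr_gt0// mulr_gt0.
have a0 : 0 < a by exact: divr_gt0.
(* The first term controls the probability of a swing in one of the [J * N] short steps, the second
   makes [beta * h <= rho / 4]. *)
pose N0 := 32 * J%:R / (a ^+ 2 * rho) + 4 * beta * S / rho.
have a20 : 0 < a ^+ 2 * rho by rewrite mulr_gt0// exprn_gt0.
have N01 : 0 <= 32 * J%:R / (a ^+ 2 * rho) by apply: divr_ge0; [exact: mulr_ge0|exact: ltW].
have N02 : 0 <= 4 * beta * S / rho.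
  by apply: divr_ge0; [apply: mulr_ge0; [apply: mulr_ge0|]|]; rewrite // ltW.
have N00 : 0 <= N0 by rewrite addr_ge0.
have /Num.Theory.truncn_itv/andP[_ n1] := N00; set N := (Num.truncn N0).+1 in n1.
have Np : 0 < N%:R :> R by rewrite ltr0n.
pose h := S / N%:R; have h0 : 0 < h by rewrite divr_gt0.
have Nh : N%:R * h = S by rewrite /h mulrC divfK// gt_eqF.
have bh : beta * h <= rho / 4.
  have : 4 * beta * S / rho <= N%:R by apply: le_trans (ltW n1); rewrite /N0 lerDr.
  rewrite /h ler_pdivrMr// => l1; rewrite mulrA ler_pdivrMr//; lra.
have cell : (J * N)%:R * (2 * expR (- ((c / 2) ^+ 2 / (2 * sigma ^+ 2 * h)))) <= rho / 4.
  have -> : (c / 2) ^+ 2 / (2 * sigma ^+ 2 * h) = a * N%:R.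
    by rewrite /a /h; field; rewrite !gt_eqF.
  have aN : 0 < a * N%:R by rewrite mulr_gt0.
  have e1 : expR (- (a * N%:R)) <= 4 / (a * N%:R) ^+ 2.
    rewrite expRN -[leRHS]invrK invf_div lef_pV2 ?posrE ?expR_gt0 ?divr_gt0 ?exprn_gt0//.
    have -> : a * N%:R = 2%:R * (a * N%:R / 2) by field.
    rewrite expRM_natl (_ : (2 * (a * N%:R / 2)) ^+ 2 / 4 = (a * N%:R / 2) ^+ 2); last by field.
    rewrite ler_pXn2r ?nnegrE ?expR_ge0 ?divr_ge0 ?(ltW aN)//.
    by apply: le_trans (expR_ge1Dx _); rewrite lerDr.
  have NJ : 32 * J%:R / (a ^+ 2 * rho) <= N%:R by apply: le_trans (ltW n1); rewrite /N0 lerDl.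
  apply: (@le_trans _ _ ((J * N)%:R * (2 * (4 / (a * N%:R) ^+ 2)))).
    by rewrite ler_wpM2l// ler_pM2l.
  rewrite natrM (_ : _ * _ = 8 * J%:R / (a ^+ 2) / N%:R); last by field; rewrite !gt_eqF.
  rewrite ler_pdivrMr//; move: NJ; rewrite ler_pdivrMr// => NJ.
  rewrite ler_pdivrMr ?exprn_gt0//; lra.
exists h, (J * N)%N; split => // u.
pose F j := tube B c (S / m%:R) (u + j%:R * S) m.
have dm0 : 0 < S / m%:R by rewrite divr_gt0// ltr0n.
have mS : m%:R * (S / m%:R) = S by rewrite mulrC divfK// gt_eqF// ltr0n.
have hF j : incs B [set t | u + j%:R * S <= t <= u + j.+1%:R * S] (F j).
  have := @tube_incs _ _ _ B c (S / m%:R) (u + j%:R * S) m (ltW dm0).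
  by rewrite mS (_ : u + j%:R * S + S = u + j.+1%:R * S)// -natr1; ring.
have h0' := ltW h0.
have [mC pC] := @Pr_exists_lt _ _ _ P (fun i => swing B (c / 2) h (u + i%:R * h)) (J * N)
  (2 * expR (- ((c / 2) ^+ 2 / (2 * sigma ^+ 2 * h))))
  (fun i => swing_measurable hB (c / 2) (u + i%:R * h) h0')
  (fun i => swing_prob s0 hB (u + i%:R * h) c2p h0).
set CC := [set w | exists2 i, _ & _] in mC pC.
have mN := noflat_measurable S0 hF J; have mB := @badflat_measurable F S H u S0 hF J.
have mE := escape_measurable H (u + J%:R * S).
exists (CC `|` (noflat F J `|` (badflat F S H u J `|` escape H (u + J%:R * S)))); split.
- exact: measurableU mC (measurableU _ _ mN (measurableU _ _ mB mE)).
- have p1 := noflat_prob S0 hF J (ltW k0) k1 (fun j => hk _).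
  have p2 := @badflat_prob F S H u S0 hF q J q0 (escape_prob H).
  have p3 := escape_prob H (u + J%:R * S); rewrite -/lam -/q in p3.
  have := Pr_ge0 P (noflat F J) => n0.
  have p2' : Pr P (badflat F S H u J) <= q.
    by apply: (le_trans p2); rewrite ler_piMr//; lra.
  have u1 := PrU P mB mE.
  have u2 := PrU P mN (measurableU _ _ mB mE).
  have u3 := PrU P mC (measurableU _ _ mN (measurableU _ _ mB mE)).
  lra.
- move=> w /not_orP[nC /not_orP[nN /not_orP[nB nE]]] cw x sx lx ret.
  have [j [jJ Fj ne]] := good_flat nN nB.
  have esc := escape_path cw sx ret.
  rewrite chain_euler.
  apply: (@le_trans _ _ (2 * c + c + beta * h)); last by rewrite /c; lra.
  have [_ flat] := tube_path cw c0 dm0 Fj; rewrite mS in flat.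
  apply: (@euler_close _ beta beta0 (B^~ w) x cw sx lx h c c H N j J u h0 (ltW c0) (ltW c0)); rewrite ?Nh//.
  + by rewrite /H /c; lra.
  + by rewrite /S mulrCA divff ?mulr1// gt_eqF.
  + move=> i iN r hr.
    have ns : ~ swing B (c / 2) h (u + i%:R * h) w by move=> sw; apply: nC; exists i.
    have sp := swing_path cw c2p h0 ns.
    have hh : 0 <= h <= h by rewrite lexx ltW.
    have := sp r hr; have := sp h hh; rewrite !ler_norml => /andP[p1 p2] /andP[p3 p4].
    by apply/andP; clear -p1 p2 p3 p4; split; lra.
  + exact: esc.
  + exact: esc.
Qed.

End approximation.

(** * Mean distance of the solution *)


Lemma cvg_eventually_cst {R : realType} (f : nat -> R) (l : R) (N : nat) :
  (forall n, (N <= n)%N -> f n = l) -> f @ \oo --> l.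
Proof. by move=> h; apply: cvg_near_cst; exists N => // n /= /h ->. Qed.

Lemma small_eq0 {R : realType} (a C : R) : 0 <= C ->
  (forall r, 0 < r -> r <= 1 -> `|a| <= r * C) -> a = 0.
Proof.
move=> C0 h; apply/eqP; rewrite -normr_eq0; apply/negPn/negP => a0.
have {}a0 : 0 < `|a| by rewrite lt_neqAle eq_sym a0 normr_ge0.
have C1 : 0 < 2 * (C + 1) by rewrite mulr_gt0// ltr_wpDl.
pose r := Num.min 1 (`|a| / (2 * (C + 1))).
have r0 : 0 < r by rewrite lt_min ltr01 divr_gt0.
have r1 : r <= 1 by rewrite ge_min lexx.
have rC : r * (2 * (C + 1)) <= `|a| by rewrite -ler_pdivlMr// ge_min lexx orbT.
have := h r r0 r1; nra.
Qed.

Lemma clip_lip {R : realType} (c x y : R) : 0 <= c ->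
  `|Num.max (- c) (Num.min c x) - Num.max (- c) (Num.min c y)| <= `|x - y|.
Proof.
move=> c0; have cc : - c <= c by lra.
have := ler_norm (x - y); have := ler_norm (- (x - y)); rewrite normrN => h1 h2.
rewrite ler_norml; apply/andP.
case: (leP c x) => h4; case: (leP c y) => h5; rewrite ?(max_r cc);
  case: (leP (- c) x) => h6; case: (leP (- c) y) => h7; split; lra.
Qed.

Section expectation_limits.
Context {d : measure_display} {T : measurableType d} {R : realType}.
Variable P : probability T R.

Lemma Ex_ae_eq (f g : T -> R) : measurable_fun setT f -> measurable_fun setT g ->
  {ae P, forall w, f w = g w} -> Ex P f = Ex P g.
Proof.
move=> mf mg fg; rewrite /Ex /Rintegral; congr fine; apply: ae_eq_integral => //.
- exact/measurable_EFinP.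
- exact/measurable_EFinP.
- by apply: filterS fg => w e _; rewrite e.
Qed.

Lemma le_Ex_ae (f g : T -> R) : itg P f -> itg P g ->
  {ae P, forall w, f w <= g w} -> Ex P f <= Ex P g.
Proof.
move=> fi gi fg; pose g' w := Num.max (f w) (g w).
have mg' : measurable_fun setT g' by apply: measurable_maxr; [exact: itg_mf fi|exact: itg_mf gi].
have -> : Ex P g = Ex P g'.
  apply: Ex_ae_eq => //; first exact: itg_mf gi.
  by apply: filterS fg => w h; rewrite /g' max_r.
apply: le_Ex => //; last by move=> w; rewrite le_max lexx.
apply: itg_le (itgD (itg_norm fi) (itg_norm gi)) => // w; rewrite /g'.
by case: (leP (f w) (g w)) => _; rewrite ?lerDl ?lerDr.
Qed.

Lemma Ex_dct (f_ : nat -> T -> R) (f g : T -> R) : (forall n, measurable_fun setT (f_ n)) ->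
  measurable_fun setT f -> {ae P, forall w, f_ ^~ w @ \oo --> f w} -> itg P g ->
  {ae P, forall w n, `|f_ n w| <= g w} -> Ex P (f_ n) @[n --> \oo] --> Ex P f.
Proof.
move=> mf_ mf ff gi fg.
have [] := @dominated_convergence _ _ _ P setT measurableT (fun n => EFin \o f_ n) (EFin \o f) (EFin \o g).
- by move=> n; exact/measurable_EFinP.
- exact/measurable_EFinP.
- by apply: filterS ff => w h _; apply/cvg_EFin; [exact: nearW|exact: h].
- exact: gi.
- by apply: filterS fg => w h n _ /=; rewrite lee_fin.
move=> fi _ h; apply: fine_cvg; have := ExE fi; rewrite /= => e.
by move: h; rewrite e.
Qed.

End expectation_limits.

Section stationary.
Context {d : measure_display} {T : measurableType d} {R : realType}.
Variables (P : probability T R) (sigma : R) (s0 : 0 < sigma).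
Variables (beta : R) (beta0 : 0 < beta).
Variables (B X : R -> T -> R) (hB : igi P sigma B).
Hypothesis mX : forall t, measurable_fun setT (X t).
Hypothesis hX : {ae P, forall w, bsol beta (B^~ w) (X^~ w) /\
  (forall M : R, exists2 t, M < t & X t w = B t w)}.

Let D u w := X u w - B u w.
Let lam := 2 * beta / sigma ^+ 2.

Let mD u : measurable_fun setT (D u).
Proof. by apply: measurable_funB => //; exact: (igi_meas hB). Qed.

Lemma diff_itg2 u : itg2 P (D u).
Proof.
have lam0 : 0 < lam by rewrite divr_gt0 ?mulr_gt0 ?exprn_gt0.
have C0 : 0 <= 2 * expR lam by rewrite mulr_ge0 ?expR_ge0.
apply: (tail_itg2 (mD u) lam0 C0 _).1 => x x0.
apply: (@le_trans _ _ (Pr P (escape beta B (x - 1) u))).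
  apply: le_Pr_ae; [|exact: (escape_measurable _ hB)|].
    by apply: measurable_ge; apply: measurableT_comp => //; exact: mD.
  apply: filterS2 hX (igi_cont hB) => w [sx ret] cw /= xD; apply: contrapT => ne.
  by have := escape_path cw sx ret ne; rewrite -/(D u w); lra.
apply: le_trans (escape_prob s0 beta0 hB _ _) _.
by rewrite -[2 * expR lam * _]mulrA -expRD ler_pM2l// ler_expR -/lam; lra.
Qed.

(** Outside the exceptional set of [euler_approx], of probability at most [r ^+ 2], [psi] changes by
    at most [L * r ^+ 2]; on it the bound is [2 * M * |zeta|], split by
    [|zeta| <= r * zeta ^+ 2 + 1 / (4 * r)]. The weight [zeta] will be 1 for stationarity and an
    increment of [B] for the lack of correlation. *)
Lemma psi_approx (psi : R -> R) (L M r : R) : measurable_fun setT psi ->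
  0 <= L -> (forall x, `|psi x| <= M) -> (forall x y, `|psi x - psi y| <= L * `|x - y|) ->
  0 < r -> exists h n, 0 < h /\ forall u zeta, itg2 P zeta ->
   `|Ex P (fun w => psi (D u w) * zeta w) -
     Ex P (fun w => psi (chain (eulerG beta h) h B n u w) * zeta w)| <=
    L * r ^+ 2 * Ex P (fun w => `|zeta w|) + 2 * M * (r * (Ex P (fun w => zeta w ^+ 2) + 1 / 4)).
Proof.
move=> mpsi L0 psiM psiL r0.
have r20 : 0 < r ^+ 2 by rewrite exprn_gt0.
have [h [n [h0 hA]]] := euler_approx s0 beta0 hB r20.
exists h, n; split => // u z iz.
have [A [mA pA hw]] := hA u.
have mY := chain_mfun hB h0 (measurable_eulerG beta h) n u.
set Y := chain _ _ _ _ _ in mY hw *.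
have M0 : 0 <= M by apply: le_trans (psiM 0).
have ipsi (V : T -> R) : measurable_fun setT V -> itg P (fun w => psi (V w) * z w).
  move=> mV; apply: (itg_le _ _ (itgZ M (itg_norm (itg2_itg iz)))).
    by apply: measurable_funM; [exact: (measurableT_comp mpsi)|exact: iz.1].
  by move=> w; rewrite normrM ler_wpM2r.
have i1 := ipsi _ (mD u); have i2 := ipsi _ mY.
rewrite -ExB//; apply: le_trans (ler_norm_Ex (itgB i1 i2)) _.
have iA := itg_ind P mA.
have i3 := itgZ (L * r ^+ 2) (itg_norm (itg2_itg iz)).
have i4 := itgZ (2 * M * r) iz.2.
have i5 := itgZ (2 * M / (4 * r)) iA.
have i6 := itgD i4 i5; have i7 := itgD i3 i6.
apply: (@le_trans _ _ (Ex P (fun w => L * r ^+ 2 * `|z w| + (2 * M * r * z w ^+ 2 + 2 * M / (4 * r) * \1_A w)))).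
  apply: le_Ex_ae => //; first exact: itg_norm (itgB i1 i2).
  apply: filterS3 hX (igi_cont hB) (ae_beta_lipschitz s0 beta0 hB) => w [sx ret] cw lip.
  rewrite -mulrBl normrM.
  have [Aw|nA] := pselect (A w).
    rewrite indicE mem_set//= mulr1.
    have : `|psi (D u w) - psi (Y w)| <= 2 * M.
      by apply: le_trans (ler_normB _ _) _; have := psiM (D u w); have := psiM (Y w); lra.
    move=> b1; apply: (@le_trans _ _ (2 * M * `|z w|)); first by rewrite ler_wpM2r.
    have : `|z w| <= r * z w ^+ 2 + 1 / (4 * r).
      rewrite -(@ler_pM2l _ (4 * r)) ?mulr_gt0// mulrDr mulrCA [4 * r * (1 / _)]mulrC divfK ?gt_eqF ?mulr_gt0//.
      rewrite -(real_normK (num_real (z w))); have := sqr_ge0 (2 * r * `|z w| - 1); lra.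
    move=> b2; apply: (@le_trans _ _ (2 * M * (r * z w ^+ 2 + 1 / (4 * r)))).
      by rewrite ler_wpM2l// mulr_ge0.
    have -> : 2 * M * (r * z w ^+ 2 + 1 / (4 * r)) = 2 * M * r * z w ^+ 2 + 2 * M / (4 * r).
      by field; rewrite gt_eqF.
    by rewrite lerDr; apply: mulr_ge0 => //; apply: mulr_ge0 => //; exact: ltW.
  rewrite indicE memNset//= mulr0 addr0.
  have cl : `|D u w - Y w| <= r ^+ 2 by exact: (hw w nA cw _ sx (lip _ sx) ret).
  have b1 : `|psi (D u w) - psi (Y w)| <= L * r ^+ 2.
    by apply: (le_trans (psiL _ _)); rewrite ler_wpM2l.
  apply: (@le_trans _ _ (L * r ^+ 2 * `|z w|)); first by rewrite ler_wpM2r.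
  by rewrite lerDl mulr_ge0 ?sqr_ge0// !mulr_ge0// ltW.
rewrite (ExD i3 i6) (ExD i4 i5) (ExZ _ (itg_norm (itg2_itg iz))) (ExZ _ iz.2) (ExZ _ iA) Ex_ind//.
rewrite lerD2l [leRHS]mulrA mulrDr lerD2l.
have : 2 * M / (4 * r) * Pr P A <= 2 * M / (4 * r) * r ^+ 2.
  by rewrite ler_wpM2l// divr_ge0// mulr_ge0// ltW.
by rewrite (_ : 2 * M / (4 * r) * r ^+ 2 = 2 * M * r * (1 / 4))//; field; rewrite gt_eqF.
Qed.

Lemma psi_stationary (psi : R -> R) (L M u t : R) : measurable_fun setT psi ->
  0 <= L -> (forall x, `|psi x| <= M) -> (forall x y, `|psi x - psi y| <= L * `|x - y|) ->
  (forall x, 0 <= psi x) ->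
  Ex P (fun w => psi (D u w)) = Ex P (fun w => psi (D t w)).
Proof.
move=> mpsi L0 psiM psiL psi0; apply/eqP; rewrite -subr_eq0; apply/eqP.
have M0 : 0 <= M by apply: le_trans (psiM 0).
have E1 : Ex P (fun w : T => `|1 : R|) = 1 by rewrite normr1 Ex_cst.
have E2 : Ex P (fun w : T => (1 : R) ^+ 2) = 1 by rewrite expr1n Ex_cst.
apply: (@small_eq0 _ _ (2 * (L + 2 * M * (1 + 1 / 4)))).
  by rewrite mulr_ge0// addr_ge0// !mulr_ge0//; lra.
move=> r r0 r1; have [h [n [h0 H]]] := psi_approx mpsi L0 psiM psiL r0.
have i1 : itg2 P (fun=> 1 : R) by exact: itg2_cst.
have H' v : `|Ex P (fun w => psi (D v w)) - Ex P (fun w => psi (chain (eulerG beta h) h B n v w))| <=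
    L * r ^+ 2 + 2 * M * (r * (1 + 1 / 4)).
  have := H v _ i1; rewrite E1 E2 mulr1.
  by congr (`|Ex P _ - Ex P _| <= _); apply/funext => w; rewrite mulr1.
have mY v := chain_mfun hB h0 (measurable_eulerG beta h) n v.
have := H' u; have := H' t.
have -> : Ex P (fun w => psi (chain (eulerG beta h) h B n t w)) = Ex P (fun w => psi (chain (eulerG beta h) h B n u w)).
  apply: (eq_law_Ex (f := psi)) => // A mA; exact: (chain_law hB h0 (measurable_eulerG beta h)).
set eY := Ex P (fun w => psi (chain _ _ _ _ _ _)).
have : L * r ^+ 2 <= r * L.
  by rewrite mulrC ler_wpM2r// expr2 ler_piMr// ltW.
rewrite !ler_norml => h1 /andP[h2 h3] /andP[h4 h5]; apply/andP; split; lra.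
Qed.

(** The chain depends only on increments after [u], hence is independent of [B u - B t], which has
    mean 0; the error of the approximation vanishes with [r]. *)
Lemma psi_uncorrelated (psi : R -> R) (L M u t : R) : measurable_fun setT psi ->
  0 <= L -> (forall x, `|psi x| <= M) -> (forall x y, `|psi x - psi y| <= L * `|x - y|) ->
  t < u -> Ex P (fun w => psi (D u w) * (B u w - B t w)) = 0.
Proof.
move=> mpsi L0 psiM psiL tu; pose z w := B u w - B t w.
have M0 : 0 <= M by apply: le_trans (psiM 0).
have g := igi_law hB tu; have su : 0 < sigma * Num.sqrt (u - t) by rewrite mulr_gt0// sqrtr_gt0 subr_gt0.
have iz : itg2 P z := gaussian_itg2 su g.
set a := Ex P (fun w => `|z w|); set q := Ex P (fun w => z w ^+ 2).
have a0 : 0 <= a by apply: Ex_ge0.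
have q0 : 0 <= q by apply: Ex_ge0 => w; rewrite sqr_ge0.
apply: (@small_eq0 _ _ (L * a + 2 * M * (q + 1 / 4))).
  by rewrite addr_ge0// !mulr_ge0//; lra.
move=> r r0 r1; have [h [n [h0 H]]] := psi_approx mpsi L0 psiM psiL r0.
have mY := chain_mfun hB h0 (measurable_eulerG beta h) n u.
have := H u _ iz; rewrite -/a -/q.
set Y := chain _ _ _ _ _ in mY *.
have ipsi : itg P (fun w => psi (Y w)).
  apply: (itg_le _ _ (itg_cst P M)); first exact: (measurableT_comp mpsi).
  by move=> w; exact: psiM.
have ind : indep_rv P (fun w => psi (Y w)) z.
  move=> A C mA mC.
  have mpA : measurable (psi @^-1` A) by have := mpsi measurableT A mA; rewrite setTI.
  have hz : incs B [set v | v <= u] (z @^-1` C).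
    by apply: (@incs_inc _ _ _ B [set v | v <= u] t u) => //=; exact: ltW.
  have hY : incs B [set v | u <= v] ((fun w => psi (Y w)) @^-1` A).
    exact: (@chain_meas _ _ _ B (eulerG beta h) h h0 (measurable_eulerG beta h) n u _ mpA).
  by rewrite setIC (igi_indep hB hz hY) muleC.
have [_ ->] := indep_ExM ipsi (itg2_itg iz) ind.
rewrite (_ : Ex P z = 0); last exact: Ex_V g.
rewrite mulr0 subr0 => /le_trans; apply.
rewrite [leRHS]mulrDr; apply: lerD; last by rewrite le_eqVlt; apply/orP; left; apply/eqP; ring.
rewrite (_ : L * r ^+ 2 * a = r ^+ 2 * (L * a)); last by ring.
by rewrite ler_wpM2r ?mulr_ge0// expr2 ler_piMr// ltW.
Qed.

(** The square is neither bounded nor Lipschitz, so [|x|] is cut off at [K] first; dominated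
    convergence removes the cut. *)
Lemma diff_sq_stationary u t : Ex P (fun w => D u w ^+ 2) = Ex P (fun w => D t w ^+ 2).
Proof.
pose psi (K : nat) (x : R) := Num.min `|x| K%:R ^+ 2.
have g0 (K : nat) (x : R) : 0 <= Num.min `|x| K%:R by rewrite le_min normr_ge0 ler0n.
have gK (K : nat) (x : R) : Num.min `|x| K%:R <= K%:R by rewrite ge_min lexx orbT.
have mpsi K : measurable_fun setT (psi K).
  by apply: measurable_funX; apply: measurable_minr => //; exact: normr_measurable.
have lim v : Ex P (fun w => psi n (D v w)) @[n --> \oo] --> Ex P (fun w => D v w ^+ 2).
  apply: (Ex_dct _ _ _ (diff_itg2 v).2).
  - by move=> n; apply: (measurableT_comp (mpsi n)).
  - by apply: measurable_funX.
  - apply: nearW => w.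
    have D0 := normr_ge0 (D v w); have /Num.Theory.truncn_itv/andP[_ n1] := D0.
    apply: (cvg_eventually_cst (N := (Num.truncn `|D v w|).+1)) => n hn.
    rewrite /psi min_l ?real_normK ?num_real//; apply: le_trans (ltW n1) _.
    by rewrite ler_nat.
  - apply: nearW => w n; rewrite /psi ger0_norm ?sqr_ge0// -(real_normK (num_real (D v w))).
    by rewrite ler_pXn2r ?nnegrE// ge_min lexx.
have E n : Ex P (fun w => psi n (D u w)) = Ex P (fun w => psi n (D t w)).
  apply: (@psi_stationary _ (2 * n%:R) (n%:R ^+ 2)) => //.
  - by move=> x; rewrite /psi ger0_norm ?sqr_ge0// ler_pXn2r ?nnegrE.
  - move=> x y; rewrite /psi subr_sqr normrM mulrC; apply: ler_pM => //.
      by rewrite ger0_norm ?addr_ge0//; have := gK n x; have := gK n y; lra.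
    have : `| `|x| - `|y| | <= `|x - y| by exact: ler_dist_dist.
    rewrite !ler_norml => /andP[h1 h2]; apply/andP.
    by case: (leP `|x| n%:R); case: (leP `|y| n%:R) => h3 h4; split; lra.
  - by move=> x; rewrite /psi sqr_ge0.
have := lim u; under eq_fun do rewrite E; move=> l1.
exact: (cvg_unique _ l1 (lim t)).
Qed.

Lemma diff_uncorrelated u t : t < u -> Ex P (fun w => D u w * (B u w - B t w)) = 0.
Proof.
move=> tu; pose psi (K : nat) (x : R) := Num.max (- K%:R) (Num.min K%:R x).
have g := igi_law hB tu; have su : 0 < sigma * Num.sqrt (u - t) by rewrite mulr_gt0// sqrtr_gt0 subr_gt0.
have iz : itg2 P (fun w => B u w - B t w) := gaussian_itg2 su g.
have mpsi K : measurable_fun setT (psi K).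
  by apply: measurable_maxr => //; exact: measurable_minr.
have n0 n : 0 <= n%:R :> R by [].
have pn n x : `|psi n x| <= `|x|.
  have h0 := n0 n; have h1 := ler_norm x; have h2 := ler_norm (- x); rewrite normrN in h2.
  rewrite ler_norml /psi le_max le_min ge_max ge_min; apply/andP; split.
    by apply/orP; right; apply/andP; split; lra.
  by apply/andP; split; [lra|apply/orP; right].
have : Ex P (fun w => psi n (D u w) * (B u w - B t w)) @[n --> \oo] -->
    Ex P (fun w => D u w * (B u w - B t w)).
  apply: (Ex_dct _ _ _ (itg_norm (itgM (diff_itg2 u) iz))).
  - by move=> n; apply: measurable_funM; [exact: (measurableT_comp (mpsi n))|exact: iz.1].
  - by apply: measurable_funM; [exact: mD|exact: iz.1].
  - apply: nearW => w.
    have D0 := normr_ge0 (D u w); have /Num.Theory.truncn_itv/andP[_ n1] := D0.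
    apply: (cvg_eventually_cst (N := (Num.truncn `|D u w|).+1)) => n hn.
    congr (_ * _); have : `|D u w| <= n%:R by apply: le_trans (ltW n1) _; rewrite ler_nat.
    by rewrite ler_norml /psi => /andP[h1 h2]; rewrite min_r// max_r.
  - by apply: nearW => w n; rewrite !normrM ler_wpM2r.
have E n : Ex P (fun w => psi n (D u w) * (B u w - B t w)) = 0.
  apply: (@psi_uncorrelated _ 1 n%:R) => //.
  - move=> x; rewrite ler_norml /psi le_max lexx/= ge_max ge_min lexx/=.
    by rewrite andbT; have := n0 n; lra.
  - by move=> x y; rewrite mul1r; exact: clip_lip.
have l0 : Ex P (fun w => psi n (D u w) * (B u w - B t w)) @[n --> \oo] --> (0 : R).
  by apply: (cvg_eventually_cst (N := 0%N)) => n _; exact: E.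
by move=> l1; exact: (cvg_unique _ l1 l0).
Qed.

(* Expand the square of D t = D u + (X t - X u) + (B u - B t) with t = u - s^2: the second moments of
   D t and D u cancel and D u is uncorrelated with B u - B t. *)
Lemma diff_drift_bound u s : 0 < s ->
  `|2 * Ex P (fun w => D u w * (X (u - s ^+ 2) w - X u w)) / s ^+ 2 + sigma ^+ 2|
    <= (beta ^+ 2 * s + beta * (1 + sigma ^+ 2)) * s.
Proof.
(* With time step [s ^+ 2] the increment [xi] of [B] has standard deviation [sigma * s], while the
   displacement [eta] of [X] is at most [beta * s ^+ 2]. So the means of [eta ^+ 2] and [eta * xi]
   are of order [s ^+ 4] and [s ^+ 3], and vanish after division by [s ^+ 2]. *)
move=> sp; set dl := s ^+ 2; have d0 : 0 < dl by rewrite exprn_gt0.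
set t := u - dl; have tu : t < u by rewrite gtrBl.
have ut : u - t = dl by rewrite /t; ring.
have g := igi_law hB tu; rewrite ut in g.
have sd : Num.sqrt dl = s by rewrite /dl sqrtr_sqr ger0_norm// ltW.
rewrite sd in g.
have ss : 0 < sigma * s by rewrite mulr_gt0.
pose xi w := B u w - B t w; pose eta w := X t w - X u w.
have ix : itg2 P xi := gaussian_itg2 ss g.
have iu := diff_itg2 u; have it := diff_itg2 t.
have De w : D t w = D u w + (eta w + xi w) by rewrite /D /eta /xi; ring.
have ie : itg2 P eta.
  have -> : eta = (fun w => D t w - D u w - xi w) by apply/funext => w; rewrite De; ring.
  by apply: itg2B => //; exact: itg2B.
have eb : {ae P, forall w, `|eta w| <= beta * dl}.
  apply: filterS2 hX (ae_beta_lipschitz s0 beta0 hB) => w [sx _] lip.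
  have := lip _ sx t u; rewrite (_ : t - u = - dl) ?normrN ?(ger0_norm (ltW d0))//.
  by rewrite -ut; ring.
have b0 := ltW beta0; have bd0 : 0 <= beta * dl by rewrite mulr_ge0// ltW.
have E2 : Ex P (fun w => eta w ^+ 2) <= (beta * dl) ^+ 2.
  rewrite -[leRHS](Ex_cst P); apply: le_Ex_ae; [exact: ie.2|exact: itg_cst|].
  apply: filterS eb => w h; rewrite -(real_normK (num_real (eta w))).
  by rewrite ler_pXn2r ?nnegrE.
have E20 : 0 <= Ex P (fun w => eta w ^+ 2) by apply: Ex_ge0 => w; rewrite sqr_ge0.
have X2 : Ex P (fun w => xi w ^+ 2) = sigma ^+ 2 * dl by rewrite (Ex_V2 ss g) exprMn.
have X1 : Ex P (fun w => `|xi w|) <= s * (1 + sigma ^+ 2) / 2.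
  have i1 := itgZ (1 / (2 * s)) ix.2; have i2 := itg_cst P (s / 2).
  apply: (@le_trans _ _ (Ex P (fun w => 1 / (2 * s) * xi w ^+ 2 + s / 2))).
    apply: le_Ex; [exact: itg_norm (itg2_itg ix)|exact: itgD|].
    move=> w; rewrite -(real_normK (num_real (xi w))) -(@ler_pM2l _ (2 * s)) ?mulr_gt0//.
    rewrite (_ : 2 * s * (1 / (2 * s) * `|xi w| ^+ 2 + s / 2) = `|xi w| ^+ 2 + s ^+ 2); last first.
      by field; rewrite gt_eqF.
    by have := sqr_ge0 (`|xi w| - s); lra.
  rewrite (ExD i1 i2) (ExZ _ ix.2) X2 Ex_cst /dl.
  by rewrite le_eqVlt; apply/orP; left; apply/eqP; field; rewrite gt_eqF.
have iex := itgM ie ix; have iue := itgM iu ie; have iux := itgM iu ix.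
have EX : `|Ex P (fun w => eta w * xi w)| <= beta * dl * (s * (1 + sigma ^+ 2) / 2).
  apply: le_trans (ler_norm_Ex iex) _.
  apply: (@le_trans _ _ (beta * dl * Ex P (fun w => `|xi w|))); last by rewrite ler_wpM2l.
  rewrite -(ExZ _ (itg_norm (itg2_itg ix))); apply: le_Ex_ae.
  - exact: itg_norm.
  - exact: itgZ (itg_norm (itg2_itg ix)).
  - by apply: filterS eb => w h; rewrite normrM ler_wpM2r.
have := diff_sq_stationary u t.
have -> : (fun w => D t w ^+ 2) = (fun w => D u w ^+ 2 + (eta w ^+ 2 + (xi w ^+ 2 +
    (2 * (D u w * eta w) + (2 * (D u w * xi w) + 2 * (eta w * xi w)))))).
  by apply/funext => w; rewrite De; ring.
have j1 := itgZ 2 iex; have j2 := itgZ 2 iux; have j3 := itgZ 2 iue.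
have j4 := itgD j2 j1; have j5 := itgD j3 j4; have j6 := itgD ix.2 j5; have j7 := itgD ie.2 j6.
rewrite (ExD iu.2 j7) (ExD ie.2 j6) (ExD ix.2 j5) (ExD j3 j4) (ExD j2 j1) (ExZ _ iue) (ExZ _ iux) (ExZ _ iex).
rewrite (diff_uncorrelated tu) mulr0 add0r X2.
set e2 := Ex P (fun w => eta w ^+ 2) in E2 E20 *; set ue := Ex P (fun w => D u w * eta w).
set ex := Ex P _ in EX *; set du := Ex P _ => eq0.
have eq1 : 2 * ue + sigma ^+ 2 * dl = - (e2 + 2 * ex) by lra.
rewrite -/t -/eta -/ue.
have -> : 2 * ue / dl + sigma ^+ 2 = (2 * ue + sigma ^+ 2 * dl) / dl by field; rewrite gt_eqF.
rewrite eq1 normrM normfV (ger0_norm (ltW d0)) normrN ler_pdivrMr//.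
apply: (@le_trans _ _ (e2 + 2 * `|ex|)).
  by apply: (le_trans (ler_normD _ _)); rewrite (ger0_norm E20) normrM ger0_norm.
have -> : (beta ^+ 2 * s + beta * (1 + sigma ^+ 2)) * s * dl =
  (beta * dl) ^+ 2 + 2 * (beta * dl * (s * (1 + sigma ^+ 2) / 2)) by rewrite /dl; field.
by apply: lerD => //; rewrite ler_pM2l.
Qed.

(** Off the contact set [x] is a line just before [u], so the quotient eventually equals its limit;
    on the contact set the factor [x u - b u] vanishes, whatever the slope of [x]. *)
Lemma slope_limit (b x : R -> R) (u : R) (s : nat -> R) : continuous b -> bsol beta b x ->
  (forall n, 0 < s n) -> (forall e, 0 < e -> exists N, forall n, (N <= n)%N -> s n < e) ->
  exists N, forall n, (N <= n)%N ->
    (x u - b u) * (x (u - s n) - x u) / s n = - (beta * `|x u - b u|).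
Proof.
move=> cb sx sp s_0.
have main b' x' : continuous b' -> bsol beta b' x' -> b' u < x' u ->
    exists N, forall n, (N <= n)%N ->
    (x' u - b' u) * (x' (u - s n) - x' u) / s n = - (beta * `|x' u - b' u|).
  move=> cb' sx' bx.
  have cx := bsol_cont sx'.
  have cf : continuous (fun t => x' t - b' t) by move=> t; apply: cvgB; [exact: cx|exact: cb'].
  have f0 : 0 < x' u - b' u by rewrite subr_gt0.
  have /nbhs_ballP[e /= e0 eb] : \forall y \near u, 0 < x' y - b' y by exact: cvgr_gt (cf u) _ f0.
  have [N hN] := s_0 e e0; exists N => n Nn.
  have sn := sp n; have se := hN n Nn.
  have := @above_line _ beta b' x' (u - s n) u sx' _ _.
  rewrite (_ : u - (u - s n) = s n); last by ring.
  move=> hh; have {hh} E : x' u = x' (u - s n) + beta * s n.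
    apply: hh; first by rewrite gerBl ltW.
    move=> r /andP[r1 r2]; rewrite -subr_gt0; apply: eb; rewrite /ball/= ger0_norm; lra.
  rewrite (gtr0_norm f0) (_ : x' (u - s n) - x' u = - (beta * s n)); last by lra.
  by field; rewrite gt_eqF.
have [bx|xb|e] := ltgtP (b u) (x u).
- exact: main.
- have cNb : continuous (fun t => - b t) by move=> t; apply: cvgN; exact: cb.
  have := main _ _ cNb (bsolN sx); rewrite ltrN2 => /(_ xb)[N hN]; exists N => n /hN.
  rewrite -opprD normrN => <-; rewrite -opprD mulrNN; congr (_ * _ / _); ring.
- by exists 0%N => n _; rewrite e subrr normr0 mulr0 oppr0 !mul0r.
Qed.

(** The mean of [D u * (X (u - s ^+ 2) - X u) / s ^+ 2] has two limits as [s] tends to 0: dominated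
    convergence gives [- beta] times the mean of [|D u|], [diff_drift_bound] gives
    [- sigma ^+ 2 / 2]. *)
Lemma mean_abs_diff u : Ex P (fun w => `|D u w|) = sigma ^+ 2 / (2 * beta).
Proof.
pose s (n : nat) : R := n.+1%:R^-1.
have sp n : 0 < s n by rewrite invr_gt0 ltr0n.
have s1 n : s n <= 1 by rewrite invf_le1 ?ltr0n// ler1n.
have s2 n : 0 < s n ^+ 2 by rewrite exprn_gt0.
have ssmall e : 0 < e -> exists N, forall n, (N <= n)%N -> s n < e.
  move=> e0; have ei : 0 <= e^-1 by rewrite invr_ge0 ltW.
  have /Num.Theory.truncn_itv/andP[_ n1] := ei; exists (Num.truncn e^-1) => n hn.
  rewrite -(invrK e) ltf_pV2 ?posrE ?invr_gt0 ?ltr0n//; apply: lt_le_trans n1 _.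
  by rewrite ler_nat ltnS.
have s2small e : 0 < e -> exists N, forall n, (N <= n)%N -> s n ^+ 2 < e.
  move=> e0; have [N hN] := ssmall e e0; exists N => n /hN; apply: le_lt_trans.
  by rewrite expr2 ler_piMl// ltW.
pose f n w := D u w * (X (u - s n ^+ 2) w - X u w) / s n ^+ 2.
have mdX n : measurable_fun setT (fun w => X (u - s n ^+ 2) w - X u w) by exact: measurable_funB.
have mf n : measurable_fun setT (f n).
  by apply: measurable_funM => //; apply: measurable_funM.
have lim1 : Ex P (f n) @[n --> \oo] --> Ex P (fun w => - (beta * `|D u w|)).
  apply: (Ex_dct mf _ _ (itgZ beta (itg_norm (itg2_itg (diff_itg2 u))))).
  - apply: measurableT_comp => //; apply: measurable_funM => //.
    by apply: measurableT_comp.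
  - apply: filterS2 hX (igi_cont hB) => w [sx _] cw.
    have [N hN] := slope_limit u cw sx s2 s2small.
    exact: (cvg_eventually_cst hN).
  - apply: filterS2 hX (ae_beta_lipschitz s0 beta0 hB) => w [sx _] lip n.
    rewrite /f normrM normfV (gtr0_norm (s2 n)) ler_pdivrMr// normrM.
    have := lip _ sx (u - s n ^+ 2) u; rewrite (_ : u - s n ^+ 2 - u = - s n ^+ 2); last by ring.
    rewrite normrN (gtr0_norm (s2 n)) => l1.
    rewrite (_ : beta * `|D u w| * s n ^+ 2 = `|D u w| * (beta * s n ^+ 2)); last by ring.
    exact: ler_wpM2l.
have lim2 : Ex P (f n) @[n --> \oo] --> - (sigma ^+ 2 / 2).
  apply/cvgrPdist_lt => e e0.
  pose C := (beta ^+ 2 + beta * (1 + sigma ^+ 2)) / 2 + 1.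
  have C0 : 0 < C.
    by rewrite ltr_wpDl// divr_ge0// addr_ge0 ?sqr_ge0// mulr_ge0 ?(ltW beta0)// addr_ge0// sqr_ge0.
  have [N hN] := ssmall (e / C) (divr_gt0 e0 C0).
  exists N => // n /= /hN; rewrite ltr_pdivlMr// => sC.
  have iD : itg P (fun w => D u w * (X (u - s n ^+ 2) w - X u w)).
    apply: (itgM (diff_itg2 u)).
    have -> : (fun w => X (u - s n ^+ 2) w - X u w) =
      (fun w => D (u - s n ^+ 2) w - D u w - (B u w - B (u - s n ^+ 2) w)).
      by apply/funext => w; rewrite /D; ring.
    apply: itg2B; first by apply: itg2B; exact: diff_itg2.
    have lt : u - s n ^+ 2 < u by rewrite gtrBl.
    have g := igi_law hB lt; apply: gaussian_itg2 g.
    by rewrite mulr_gt0// sqrtr_gt0 subr_gt0.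
  have -> : Ex P (f n) = Ex P (fun w => D u w * (X (u - s n ^+ 2) w - X u w)) / s n ^+ 2.
    by rewrite mulrC -ExZ//; congr Ex; apply/funext => w; rewrite /f mulrC.
  have := diff_drift_bound u (sp n); set E := Ex P _ => h.
  have h2 : (beta ^+ 2 * s n + beta * (1 + sigma ^+ 2)) * s n <= 2 * (C - 1) * s n.
    rewrite ler_pM2r// /C (_ : 2 * _ = beta ^+ 2 + beta * (1 + sigma ^+ 2)); last by field.
    by rewrite lerD2r ler_piMr ?sqr_ge0.
  have -> : - (sigma ^+ 2 / 2) - E / s n ^+ 2 = - ((2 * E / s n ^+ 2 + sigma ^+ 2) / 2).
    by field; rewrite gt_eqF.
  rewrite normrN normrM (ger0_norm (_ : 0 <= 2^-1 :> R)) ?invr_ge0//.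
  have sn := sp n; nra.
have : Ex P (fun w => - (beta * `|D u w|)) = - (sigma ^+ 2 / 2) by exact: (cvg_unique _ lim1 lim2).
rewrite ExN; last exact: itgZ (itg_norm (itg2_itg (diff_itg2 u))).
rewrite ExZ; last exact: itg_norm (itg2_itg (diff_itg2 u)).
move=> /oppr_inj h; have -> : sigma ^+ 2 / (2 * beta) = beta^-1 * (sigma ^+ 2 / 2).
  by field; rewrite gt_eqF.
by rewrite -h mulKf// gt_eqF.
Qed.

End stationary.


Section six_limsups.
Context {R : realType}.
Variables (beta c : R) (beta0 : 0 < beta) (b x zp zm : R -> R).
Hypotheses (cb : continuous b) (sx : bsol beta b x).
Hypothesis ret : forall M : R, exists2 t, M < t & x t = b t.
Hypotheses (hp : is_Zplus beta b zp) (hm : is_Zminus beta b zm).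
Hypothesis up : forall c', c < c' -> exists T0, forall t, T0 <= `|t| ->
  forall s u, b s - b u - beta * `|s - t| - beta * `|u - t| <= c' * ln `|t|.

Let xb t : x t - b t <= zp t - zm t.
Proof.
have := Xstar_le_Zplus cb sx ret hp t.
by have [[_ h] _] := hm; have := h t; lra.
Qed.

Let bx t : b t - x t <= zp t - zm t.
Proof.
have := Zminus_le_Xstar cb sx ret hm t.
by have [[_ h] _] := hp; have := h t; lra.
Qed.

Lemma limsup_pinfty_of (f : R -> R) : (forall t, f t <= zp t - zm t) ->
  (forall c', c' < c -> forall T0, exists2 t, T0 <= t & c' * ln t <= f t) ->
  limf_esup (fun t => (f t / ln t)%:E) (pinfty_nbhs R) = c%:E.
Proof.
move=> fz lo; apply: limsup_log_pinfty => // c' cc'; have [T0 hT] := up cc'.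
exists (Num.max T0 0) => t; rewrite ge_max => /andP[tT t0]; apply: le_trans (fz t) _.
by apply: (Zdiff_le beta0 hp hm) => s u; have := hT t; rewrite ger0_norm//; apply.
Qed.

Lemma limsup_ninfty_of (f : R -> R) : (forall t, f t <= zp t - zm t) ->
  (forall c', c' < c -> forall T0, exists2 t, T0 <= t & c' * ln t <= f (- t)) ->
  limf_esup (fun t => (f t / ln `|t|)%:E) (ninfty_nbhs R) = c%:E.
Proof.
move=> fz lo; apply: limsup_log_ninfty => // c' cc'; have [T0 hT] := up cc'.
exists (Num.max T0 0) => t; rewrite ge_max => /andP[tT t0]; apply: le_trans (fz (- t)) _.
by apply: (Zdiff_le beta0 hp hm) => s u; have := hT (- t); rewrite normrN ger0_norm//; apply.
Qed.

Hypothesis lo : forall sg : bool, forall c', c' < c -> forall T0, exists2 t, T0 <= t &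
  c' * ln t <= x (if sg then t else - t) - b (if sg then t else - t).
Hypothesis loN : forall sg : bool, forall c', c' < c -> forall T0, exists2 t, T0 <= t &
  c' * ln t <= - x (if sg then t else - t) - - b (if sg then t else - t).

(** Both [x - b] and [b - x] lie below [zp - zm], so one upper bound serves all six limits, and the
    lower bound for [x - b] also serves [zp - zm]. *)
Lemma six_limsups :
  [/\ limf_esup (fun t : R => ((x t - b t) / ln `|t|)%:E) (ninfty_nbhs R) = c%:E,
      limf_esup (fun t : R => ((x t - b t) / ln t)%:E) (pinfty_nbhs R) = c%:E,
      limf_esup (fun t : R => ((b t - x t) / ln `|t|)%:E) (ninfty_nbhs R) = c%:E &
      [/\ limf_esup (fun t : R => ((b t - x t) / ln t)%:E) (pinfty_nbhs R) = c%:E,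
          limf_esup (fun t : R => ((zp t - zm t) / ln `|t|)%:E) (ninfty_nbhs R) = c%:E &
          limf_esup (fun t : R => ((zp t - zm t) / ln t)%:E) (pinfty_nbhs R) = c%:E]].
Proof.
have N t : - x t - - b t = b t - x t by ring.
split; last split.
- apply: (limsup_ninfty_of xb) => c' cc' T0; exact: (lo false).
- apply: (limsup_pinfty_of xb) => c' cc' T0; exact: (lo true).
- apply: (limsup_ninfty_of bx) => c' cc' T0.
  by have [t tT h] := loN false cc' T0; exists t => //; rewrite -N.
- apply: (limsup_pinfty_of bx) => c' cc' T0.
  by have [t tT h] := loN true cc' T0; exists t => //; rewrite -N.
- apply: (@limsup_ninfty_of (fun t => zp t - zm t)) => // c' cc' T0.
  by have [t tT h] := lo false cc' T0; exists t => //; exact: le_trans (xb _).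
- apply: (@limsup_pinfty_of (fun t => zp t - zm t)) => // c' cc' T0.
  by have [t tT h] := lo true cc' T0; exists t => //; exact: le_trans (xb _).
Qed.

End six_limsups.

Theorem theorem5p5 (R : realType) (d : measure_display) (T : measurableType d)
    (P : probability T R) (sigma beta : R) (hsigma : 0 < sigma)
    (hbeta : 0 < beta)
    (B X Zp Zm : R -> {RV P >-> R})
    (hB : two_sided_brownian_motion sigma B)
    (hX : {ae P, forall w, is_Xstar beta (fun t => B t w) (fun t => X t w)})
    (hZp : {ae P, forall w, is_Zplus beta (fun t => B t w) (fun t => Zp t w)})
    (hZm : {ae P, forall w, is_Zminus beta (fun t => B t w) (fun t => Zm t w)}) :
  [/\ {ae P, forall w,
        let c := (sigma ^+ 2 / (2 * beta))%:E in
        [/\ limf_esup (fun t : R => ((X t w - B t w) / ln `|t|)%:E)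
              (ninfty_nbhs R) = c,
            limf_esup (fun t : R => ((X t w - B t w) / ln t)%:E)
              (pinfty_nbhs R) = c,
            limf_esup (fun t : R => ((B t w - X t w) / ln `|t|)%:E)
              (ninfty_nbhs R) = c &
            [/\ limf_esup (fun t : R => ((B t w - X t w) / ln t)%:E)
                  (pinfty_nbhs R) = c,
                limf_esup (fun t : R => ((Zp t w - Zm t w) / ln `|t|)%:E)
                  (ninfty_nbhs R) = c &
                limf_esup (fun t : R => ((Zp t w - Zm t w) / ln t)%:E)
                  (pinfty_nbhs R) = c]]},
      (forall t : R,
        ('E_P[fun w => (`|B t w - X t w|)%R] = (1 / 2 * (sigma ^+ 2 / beta))%R%:E)%E) &
      (forall t : R,
        ('E_P[fun w => (Zp t w - B t w)%R] = (3 / 4 * (sigma ^+ 2 / beta))%R%:E)%E /\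
        ('E_P[fun w => (B t w - Zm t w)%R] = (3 / 4 * (sigma ^+ 2 / beta))%R%:E)%E)].
Proof.
(* [W] agrees with [B] at all times outside a null set; the almost sure hypotheses are transferred
   to it. *)
have [W [hW WB]] := two_sided_igi hsigma hB.
have WBf : {ae P, forall w, (fun t => B t w) = W^~ w}.
  by apply: filterS WB => w h; apply/funext => t; rewrite h.
have mX t : measurable_fun setT (X t) by exact: measurable_funPT.
have mB t : measurable_fun setT (B t) by exact: measurable_funPT.
have mZp t : measurable_fun setT (Zp t) by exact: measurable_funPT.
have mZm t : measurable_fun setT (Zm t) by exact: measurable_funPT.
have mW t := igi_meas hW t.
have hX' : {ae P, forall w, bsol beta (W^~ w) ((fun t w => X t w)^~ w) /\
    (forall M : R, exists2 t, M < t & X t w = W t w)}.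
  apply: filterS2 WBf hX => w e [sx ret]; have e' t : B t w = W t w by have := congr1 (@^~ t) e.
  rewrite e in sx; split; first exact: bsolP.
  by move=> M; have [t Mt xt] := ret M; exists t => //; rewrite -e'.
have hZp' : {ae P, forall w, is_Zplus beta (W^~ w) ((fun t w => Zp t w)^~ w)}.
  by apply: filterS2 WBf hZp => w ->.
have hZm' : {ae P, forall w, is_Zminus beta (W^~ w) (fun t => Zm t w)}.
  by apply: filterS2 WBf hZm => w ->.
have hN := igiN hsigma hW.
have c34 : 3 / 2 * (2 * beta / sigma ^+ 2)^-1 = 3 / 4 * (sigma ^+ 2 / beta).
  by field; rewrite !gt_eqF.
split.
- have lo : {ae P, forall w (sg : bool) x, bsol beta (W^~ w) x ->
      (forall M : R, exists2 t, M < t & x t = W t w) ->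
      forall c, c < sigma ^+ 2 / (2 * beta) -> forall T0, exists2 t, T0 <= t &
      c * ln t <= x (if sg then t else - t) - W (if sg then t else - t) w}.
    by apply: ae_count => sg; exact: ae_lower.
  have loN : {ae P, forall w (sg : bool) x, bsol beta (fun t => - W t w) x ->
      (forall M : R, exists2 t, M < t & x t = - W t w) ->
      forall c, c < sigma ^+ 2 / (2 * beta) -> forall T0, exists2 t, T0 <= t &
      c * ln t <= x (if sg then t else - t) - - W (if sg then t else - t) w}.
    by apply: ae_count => sg; exact: (ae_lower hsigma hbeta hN).
  have up := ae_upper_norm hsigma hbeta hW.
  apply: filterS3 (filterI hX' (filterI hZp' hZm')) (filterI lo loN) (filterI up (filterI (igi_cont hW) WB)).
  move=> w [[sx ret] [hp hm]] [l1 l2] [u1 [cw e]].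
  have eb : W^~ w = (fun t => B t w) by apply/funext => t; rewrite e.
  apply: (@six_limsups _ beta _ hbeta (fun t => B t w) (fun t => X t w) (fun t => Zp t w) (fun t => Zm t w)).
  + by rewrite -eb.
  + by rewrite -eb.
  + by move=> M; have [t Mt xt] := ret M; exists t => //; rewrite -e.
  + by rewrite -eb.
  + by rewrite -eb.
  + move=> c' cc'; have [T0 h] := u1 c' cc'; exists T0 => t ht s u.
    by rewrite -!e; exact: h.
  + move=> sg c' cc' T0; have [t tT h] := l1 sg _ sx ret c' cc' T0.
    by exists t => //; rewrite -e.
  + move=> sg c' cc' T0.
    have retN (M : R) : exists2 t, M < t & - X t w = - W t w.
      by have [t Mt xt] := ret M; exists t => //; rewrite xt.
    have [t tT h] := l2 sg (fun t => - X t w) (bsolN sx) retN c' cc' T0.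
    by exists t => //; rewrite -e.
- move=> t; rewrite unlock.
  transitivity (\int[P]_w (`|X t w - W t w|)%:E)%E.
    apply: ae_eq_integral => //.
    + by apply/measurable_EFinP; apply: measurableT_comp => //; exact: measurable_funB.
    + by apply/measurable_EFinP; apply: measurableT_comp => //; exact: measurable_funB.
    + by apply: filterS WB => w e _; rewrite -e distrC.
  have iD := diff_itg2 hsigma hbeta hW mX hX' t.
  rewrite (ExE (itg_norm (itg2_itg iD))) (mean_abs_diff hsigma hbeta hW mX hX' t).
  by congr EFin; field; rewrite gt_eqF.
- move=> t; rewrite unlock; split.
    rewrite -c34 -(@mean_Zplus _ _ _ P sigma hsigma beta hbeta _ (fun t w => Zp t w) t hW (mZp t) hZp').
    apply: ae_eq_integral => //.
    + by apply/measurable_EFinP; exact: measurable_funB.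
    + by apply/measurable_EFinP; exact: measurable_funB.
    + by apply: filterS WB => w e _; rewrite -e.
  (* The largest minorant of [W] is minus the least majorant of [- W], and [- W] has the same
     independence and law of increments. *)
  have mN : measurable_fun setT (fun w => - Zm t w) by exact: measurableT_comp.
  have hZN : {ae P, forall w, is_Zplus beta ((fun t w => - W t w)^~ w) ((fun t w => - Zm t w)^~ w)}.
    by apply: filterS hZm' => w; exact: ZplusN.
  rewrite -c34 -(@mean_Zplus _ _ _ P sigma hsigma beta hbeta _ (fun t w => - Zm t w) t hN mN hZN).
  apply: ae_eq_integral => //.
  + by apply/measurable_EFinP; exact: measurable_funB.
  + by apply/measurable_EFinP; apply: measurable_funB => //; exact: measurableT_comp.
  + by apply: filterS WB => w e _; rewrite -e opprK addrC.
Qed.
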